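(* Let $(X_i)_{i\in\mathbb N}$ be a stationary process of $\mathbb R^d$-valued random vectors whose multidimensional distribution function $F$ is continuous. Assume there is a vector space $\mathcal G$ of measurable functions $\mathbb R^d\to\mathbb R$, containing the constant functions and equipped with a seminorm $\|\cdot\|_{\mathcal G}$, such that: (i) for every $f\in\mathcal G$ with $\|f\|_\infty<\infty$ and ${\rm E}f(X_0)=0$ there is $\sigma_f^2<\infty$ with $\frac1{\sqrt n}\sum_{i=1}^n f(X_i)\to N(0,\sigma_f^2)$ in distribution; (ii) $\mathcal G$ approximates the indicator functions with a $(\mathcal G,F)$-control function $\Psi$; (iii) there are constants $r\ge1$, an integer $p>rd$, real numbers $\gamma_1,\dots,\gamma_p$ with $0\le\gamma_i<\frac ir+2(p-i)-d$ for all $i=1,\dots,p$, and nondecreasing functions $\Phi_1,\dots,\Phi_p:\mathbb R_0^+\to\mathbb R_0^+$ with $\Phi_i(2\Psi(z))=\mathcal O(z^{\gamma_i})$ as $z\to\infty$, such that the moment bound (M) holds with these $C,r,p,\Phi_1,\dots,\Phi_p$ for every $f\in\mathcal G$ with $\|f\|_\infty\le1$ and every $n\ge1$. Then the empirical CLT holds: there is a centered Gaussian process $(W(t))_{t\in[-\infty,\infty]^d}$ with almost surely continuous sample paths such that $U_n\to W$ in distribution in $\mathbb D([-\infty,\infty]^d)$.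
   Context: Inequalities between vectors of $[-\infty,\infty]^d$ are componentwise. $F(t)=P(X_0\le t)$, and $F_1,\dots,F_d$ denote the marginal distribution functions of $X_0$. The empirical process is $U_n(t)=\frac1{\sqrt n}\sum_{i=1}^n\big(\mathbf 1\{X_i\le t\}-F(t)\big)$, $t\in[-\infty,\infty]^d$, viewed as a random element of $\mathbb D([-\infty,\infty]^d)$, the space of multidimensional càdlàg functions on $[-\infty,\infty]^d$ with the multidimensional Skorokhod metric (a complete separable metric space). Modulus of continuity: for $g:\mathbb R^d\to\mathbb R$ (or $\mathbb R\to\mathbb R$), $w_g(\delta)=\sup\{|g(t)-g(s)|:\|t-s\|\le\delta\}$. $(\mathcal G,F)$-control function: a nondecreasing $\Psi:\mathbb R_0^+\to\mathbb R_0^+$ such that for every $a<b$ in $[-\infty,\infty]^d$ there is $\phi_{(a,b)}\in\mathcal G$ with $\mathbf 1\{x\le a\}\le\phi_{(a,b)}(x)\le\mathbf 1\{x\le b\}$ for all $x\in\mathbb R^d$ and $\|\phi_{(a,b)}\|_{\mathcal G}\le\Psi\big(1/\min_{i=1,\dots,d}w_{F_i}(b_i-a_i)\big)$. If such $\Psi$ exists, $\mathcal G$ is said to approximate the indicator functions with $(\mathcal G,F)$-control function $\Psi$. Moment bound (M) with constants $C>0$, $r\ge1$, $p\in\mathbb N^*$ and nondecreasing $\Phi_1,\dots,\Phi_p:\mathbb R_0^+\to\mathbb R_0^+$, for a function $f$: for all $n\ge1$, $${\rm E}\Big|\sum_{i=1}^n\big(f(X_i)-{\rm E}f(X_0)\big)\Big|^{2p}\le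 C\sum_{i=1}^p n^i\,\|f(X_0)-{\rm E}f(X_0)\|_r^i\,\Phi_i\big(\|f-{\rm E}f(X_0)\|_{\mathcal G}\big),$$ where $\|\cdot\|_r$ is the $L^r$ norm. *)

(* Defs.v *)
From HB Require Import structures.
From mathcomp Require Import all_boot all_order all_algebra.
From mathcomp Require Import all_classical all_reals all_analysis.
Set Implicit Arguments. Unset Strict Implicit. Unset Printing Implicit Defensive.
Import Order.TTheory GRing.Theory Num.Theory.
Import numFieldNormedType.Exports.
Local Open Scope classical_set_scope.
Local Open Scope ring_scope.

Section defs.
Context {R : realType}.

Definition leE d (x : 'I_d -> R) (t : 'I_d -> \bar R) : Prop :=
  forall i, ((x i)%:E <= t i)%E.

Definition coord_gen (I : Type) : set (set (I -> R)) :=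
  [set A | exists (i : I) (B : set R), measurable B /\ A = [set x | B (x i)]].
Definition borel_prod (I : Type) : set (set (I -> R)) := <<s @coord_gen I >>.

Definition measurable_Rd d (f : ('I_d -> R) -> R) : Prop :=
  forall B : set R, measurable B -> @borel_prod 'I_d (f @^-1` B).

Section process.
Context {d0 : measure_display} {T : measurableType d0} (P : probability T R).
Context {d : nat} (X : nat -> T -> 'I_d -> R).

Definition stationary : Prop :=
  forall (m k : nat) (A : set ('I_m.+1 * 'I_d -> R)), @borel_prod _ A ->
    P [set w | A (fun jc => X (k + jc.1)%N w jc.2)] =
    P [set w | A (fun jc => X jc.1 w jc.2)].

Definition cdf (t : 'I_d -> \bar R) : R := fine (P [set w | leE (X 0 w) t]).

Definition marg (i : 'I_d) (x : R) : R := fine (P [set w | X 0 w i <= x]).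

Definition cdf_continuous : Prop :=
  forall (t : 'I_d -> R) (e : R), 0 < e -> exists2 del : R, 0 < del &
    forall s : 'I_d -> R, (forall i, `|s i - t i| < del) ->
      `|cdf (fun i => (s i)%:E) - cdf (fun i => (t i)%:E)| < e.

Definition expE (Y : T -> R) : \bar R := (\int[P]_w (Y w)%:E)%E.

End process.

Definition supn d (f : ('I_d -> R) -> R) : \bar R :=
  ereal_sup [set (`|f x|)%:E | x in [set: 'I_d -> R]].

Definition modc (g : R -> R) (del : \bar R) : R :=
  sup [set e | exists t s : R, ((`|t - s|)%:E <= del)%E /\ e = `|g t - g s|].

Definition seminormed_space d (G : set (('I_d -> R) -> R))
    (nG : (('I_d -> R) -> R) -> R) : Prop :=
  [/\ (forall f, G f -> measurable_Rd f),
      (forall c : R, G (fun _ => c)),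
      (forall f g, G f -> G g -> G (fun x => f x + g x)),
      (forall (a : R) f, G f -> G (fun x => a * f x)) &
      [/\ (forall f, G f -> 0 <= nG f),
          (forall f g, G f -> G g -> nG (fun x => f x + g x) <= nG f + nG g) &
          (forall (a : R) f, G f -> nG (fun x => a * f x) = `|a| * nG f)]].

Definition nondecr_nonneg (Psi : R -> R) : Prop :=
  (forall x y, 0 <= x -> x <= y -> Psi x <= Psi y) /\
  (forall x, 0 <= x -> 0 <= Psi x).

Definition control_fun d (G : set (('I_d -> R) -> R))
    (nG : (('I_d -> R) -> R) -> R) (Fm : 'I_d -> R -> R) (Psi : R -> R) : Prop :=
  nondecr_nonneg Psi /\
  forall a b : 'I_d -> \bar R, (forall i, (a i < b i)%E) ->
    exists phi, [/\ G phi,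
      (forall x, \1_[set y | leE y a] x <= phi x <= \1_[set y | leE y b] x) &
      nG phi <= Psi (1 / \big[Num.min/1]_(i < d) modc (Fm i) (b i - a i)%E)].

Definition gauss_law (v : R) : set R -> \bar R :=
  fun B => if v == 0 then (\1_B 0)%:E else normal_prob 0 (Num.sqrt v) B.

Definition gauss_expect (v : R) (g : R -> R) : \bar R :=
  if v == 0 then (g 0)%:E
  else (\int[lebesgue_measure]_x (g x * normal_pdf 0 (Num.sqrt v) x)%:E)%E.

Definition bounded_continuous (g : R -> R) : Prop :=
  continuous g /\ exists M : R, forall x, `|g x| <= M.

Section process2.
Context {d0 : measure_display} {T : measurableType d0} (P : probability T R).
Context {d : nat} (X : nat -> T -> 'I_d -> R).

Definition cvg_dist_normal (Y : nat -> T -> R) (v : R) : Prop :=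
  forall g, bounded_continuous g ->
    (fun n => \int[P]_w (g (Y n w))%:E)%E @ \oo --> gauss_expect v g.

Definition clt_cond (G : set (('I_d -> R) -> R)) : Prop :=
  forall f, G f -> (supn f < +oo)%E -> expE P (fun w => f (X 0 w)) = 0%E ->
    exists v : R, 0 <= v /\
      cvg_dist_normal
        (fun n w => (Num.sqrt n%:R)^-1 * \sum_(1 <= i < n.+1) f (X i w)) v.

Definition moment_cond (G : set (('I_d -> R) -> R))
    (nG : (('I_d -> R) -> R) -> R) (Psi : R -> R) : Prop :=
  exists (r : R) (p : nat) (gam : nat -> R) (Phi : nat -> R -> R) (C : R),
  [/\ 1 <= r, r * d%:R < p%:R, 0 < C,
    (forall i, (1 <= i <= p)%N ->
       0 <= gam i /\ gam i < i%:R / r + 2 * (p - i)%:R - d%:R) &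
   [/\ (forall i, (1 <= i <= p)%N -> nondecr_nonneg (Phi i) /\
       exists (K z0 : R), forall z, z0 <= z -> Phi i (2 * Psi z) <= K * z `^ gam i) &
    forall f, G f -> (supn f <= 1)%E -> forall n : nat, (1 <= n)%N ->
      let m := fine (expE P (fun w => f (X 0 w))) in
      (\int[P]_w (`| \sum_(1 <= i < n.+1) (f (X i w) - m) | ^+ (2 * p))%:E <=
       (C * \sum_(1 <= i < p.+1)
           (n%:R ^+ i * fine (Lnorm P r%:E (fun w => (f (X 0 w) - m)%:E)) ^+ i
            * Phi i (nG (fun x => f x - m))))%:E)%E]].

Definition Uemp (n : nat) (w : T) (t : 'I_d -> \bar R) : R :=
  (Num.sqrt n%:R)^-1 *
    \sum_(1 <= i < n.+1) (\1_[set x | leE x t] (X i w) - cdf P X t).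

End process2.

Definition near_box d (t : 'I_d -> \bar R) (Q : ('I_d -> \bar R) -> Prop) : Prop :=
  exists U : 'I_d -> set (\bar R), (forall i, nbhs (t i) (U i)) /\
    forall s, (forall i, U i (s i)) -> Q s.

Definition quadrant d (rho : 'I_d -> bool) (t s : 'I_d -> \bar R) : Prop :=
  forall i, if rho i then (t i <= s i)%E else (s i < t i)%E.

Definition cadlag d (x : ('I_d -> \bar R) -> R) : Prop :=
  forall (t : 'I_d -> \bar R) (rho : 'I_d -> bool), exists L : R,
    (forall e : R, 0 < e ->
       near_box t (fun s => quadrant rho t s -> `|x s - L| < e)) /\
    ((forall i, rho i) -> L = x t).

Definition tchange (l : \bar R -> \bar R) : Prop :=
  (forall u v, (u < v)%E -> (l u < l v)%E) /\ (forall v, exists u, l u = v).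

Definition skod d (x y : ('I_d -> \bar R) -> R) : \bar R :=
  ereal_inf [set e | exists lam : 'I_d -> \bar R -> \bar R,
    (forall i, tchange (lam i)) /\
    e = maxe
      (ereal_sup [set z | exists i u, z = (`|contract (lam i u) - contract u|)%:E])
      (ereal_sup [set z | exists t, z = (`|x t - y (fun i => lam i (t i))|)%:E])].

Definition sko_bounded_continuous d (h : (('I_d -> \bar R) -> R) -> R) : Prop :=
  (exists M : R, forall x, cadlag x -> `|h x| <= M) /\
  forall x, cadlag x -> forall e : R, 0 < e -> exists2 del : R, 0 < del &
    forall y, cadlag y -> (skod x y < del%:E)%E -> `|h x - h y| < e.

Definition cont_path d (x : ('I_d -> \bar R) -> R) : Prop :=
  forall t (e : R), 0 < e -> near_box t (fun s => `|x s - x t| < e).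

Definition centered_gaussian {d' : measure_display} {T' : measurableType d'}
    (Q : probability T' R) (I : Type) (W : I -> T' -> R) : Prop :=
  forall (m : nat) (ts : 'I_m -> I) (a : 'I_m -> R),
    let Y := fun w => \sum_(k < m) a k * W (ts k) w in
    measurable_fun setT Y /\
    exists v : R, 0 <= v /\
      forall B : set R, measurable B -> Q (Y @^-1` B) = gauss_law v B.

Definition empirical_clt {d0 : measure_display} {T : measurableType d0}
    (P : probability T R) d (X : nat -> T -> 'I_d -> R) : Prop :=
  exists (d' : measure_display) (T' : measurableType d') (Q : probability T' R)
         (W : ('I_d -> \bar R) -> T' -> R),
    [/\ centered_gaussian Q W,
        (forall w, cont_path (fun t => W t w)) &
        forall h, sko_bounded_continuous h ->
          (forall n, measurable_fun setT (fun w => h (Uemp P X n w))) /\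
          measurable_fun setT (fun w => h (fun t => W t w)) /\
          (fun n => \int[P]_w (h (Uemp P X n w))%:E)%E @ \oo -->
            (\int[Q]_w (h (fun t => W t w))%:E)%E].

End defs.

(* Main.v *)
Require Import Defs.
From HB Require Import structures.
From mathcomp Require Import all_boot all_order all_algebra.
From mathcomp Require Import all_classical all_reals all_analysis.
From mathcomp Require Import measurable_realfun.
From mathcomp Require Import ring lra zify.
Set Implicit Arguments. Unset Strict Implicit. Unset Printing Implicit Defensive.
Import Order.TTheory GRing.Theory Num.Theory.
Import numFieldNormedType.Exports.
Local Open Scope classical_set_scope.
Local Open Scope ring_scope.

(* Chaining along dyadic grids of quantiles. At level [k], the functions
   [psi k j] of [G], sandwiched between indicators of neighbouring grid orthants,
   give a field [n^-1/2 sum_i (psi k j (X_i) - E)] indexed by a finite grid. The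
   moment bound controls the differences between neighbouring grid points and
   between consecutive levels, up to 4^k of order [n]; beyond that the sandwich
   itself bounds the error. Hence the empirical process is uniformly close to
   the step path of the field at a fixed level. The central limit theorem for
   linear combinations makes the whole field converge to a Gaussian field, which
   is realized on [0, 1]; it inherits the difference bounds, so by Borel-Cantelli
   its step paths converge uniformly to continuous paths [W]. A functional [h]
   continuous for the Skorokhod metric is the increasing limit of its
   inf-convolutions with multiples of the uniform distance, which depend
   Lipschitz-continuously on the paths; this gives liminf E h(U_n) >= E h(W),
   and the same for [- h]. *)

(** * Expectations and dyadic rounding *)

(** The sandwich at level [k] has a bias of order [sqrt n * d / 2^k], which is below [e] only once
    [4^k] exceeds [A * n] with [A] of order [(d / e)^2]. The moment bound must therefore serve up to
    [4^k <= A * n], and there the condition on [gam i] says that its term [i], divided by [n^p], is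
    at most a constant times [A^p * 2^(- k * (d + kap))] for some [kap > 0]. The factor
    [2^(- k * d)] pays for the number of grid points, and [2^(- k * kap)] is split evenly between
    the allowed difference [b^k] and a geometric probability bound. As [A] depends on [e] and [d]
    only, [A^p] is absorbed by the choice of the starting level. The one-dimensional limits are
    centred Gaussian but possibly degenerate, so an atom at [0] has to be allowed everywhere: the
    boundaries of the cells that describe the limit law avoid it, and Gaussian variables are treated
    as [sqrt v] times a standard one. The tests are bounded Lipschitz functions throughout: these
    are what polynomials in sines approximate, and what the inf-convolutions provide. *)

Section sequences_of_reals.
Context {R : realType}.
Implicit Types (u v : nat -> R) (l : R).

Lemma cvgnP u l : u @ \oo --> l <->
  (forall e : R, 0 < e -> exists N, forall n, (N <= n)%N -> `|u n - l| <= e).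
Proof.
split => [/cvgrPdist_le ul e e0|ul].
  have [N _ uN] := ul _ e0.
  by exists N => n Nn; rewrite distrC; exact: uN.
apply/cvgrPdist_le => e e0; have [N uN] := ul _ e0.
by exists N => // n /= Nn; rewrite distrC; exact: uN.
Qed.

Lemma cvgn_le u l (M : R) : u @ \oo --> l -> (forall n, u n <= M) -> l <= M.
Proof.
move=> ul uM; rewrite -(cvg_lim _ ul)//; apply: limr_le; first exact: cvgP ul.
exact: nearW.
Qed.

Lemma cvgn_ge u l (M : R) : u @ \oo --> l -> (forall n, M <= u n) -> M <= l.
Proof.
move=> ul uM; rewrite -(cvg_lim _ ul)//; apply: limr_ge; first exact: cvgP ul.
exact: nearW.
Qed.

Lemma cvgn_uniq u l m : u @ \oo --> l -> u @ \oo --> m -> l = m.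
Proof. by move=> ul um; rewrite -(cvg_lim _ ul)// (cvg_lim _ um). Qed.

Lemma cvgn_ext u v l : u =1 v -> u @ \oo --> l -> v @ \oo --> l.
Proof. by move=> /funext ->. Qed.

Lemma cvgn_sum (I : Type) (r : seq I) (p : pred I) (u : I -> nat -> R) (l : I -> R) :
  (forall i, p i -> (u i) @ \oo --> l i) ->
  (fun n => \sum_(i <- r | p i) u i n) @ \oo --> \sum_(i <- r | p i) l i.
Proof.
move=> ul; elim: r => [|i r ih].
  by rewrite big_nil; apply: (cvgn_ext (u := fun=> 0)) => [n|]; [rewrite big_nil|exact: cvg_cst].
case pi : (p i); last first.
  by rewrite big_cons pi; apply: cvgn_ext ih => n; rewrite big_cons pi.
rewrite big_cons pi.
by apply: cvgn_ext (cvgD (ul i pi) ih) => n; rewrite big_cons pi.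
Qed.

Lemma cauchy_cvgn u :
  (forall e : R, 0 < e -> exists N, forall n m, (N <= n)%N -> (N <= m)%N ->
    `|u n - u m| <= e) -> exists l : R, u @ \oo --> l.
Proof.
move=> cu; suff /cvg_ex[l ul] : cvgn u by exists l.
apply/cauchy_cvgP/cauchy_exP => e e0.
have [N uN] := cu (e / 2) (divr_gt0 e0 (ltr0Sn _ _)).
exists (u N); exists N => // n /= Nn.
rewrite -ball_normE /ball_/= (le_lt_trans (uN _ _ _ Nn))//.
by rewrite ltr_pdivrMr// ltr_pMr// ltr1n.
Qed.

(** For functionals that are only approximable by others with known limits: the Cauchy property is
    inherited, so no candidate for the limit of [u] has to be named. *)
Lemma cvgn_approx u :
  (forall e : R, 0 < e -> exists v, (exists l, v @ \oo --> l) /\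
     exists N, forall n, (N <= n)%N -> `|u n - v n| <= e) ->
  exists l : R, u @ \oo --> l.
Proof.
move=> uv; apply: cauchy_cvgn => e e0.
have e3 : 0 < e / 4 by rewrite divr_gt0.
have [v [[l /cvgnP vl] [N uvN]]] := uv _ e3.
have [N' vN'] := vl _ e3.
exists (maxn N N') => n m; rewrite !geq_max => /andP[n1 n2] /andP[m1 m2].
have := uvN _ n1; have := uvN _ m1; have := vN' _ n2; have := vN' _ m2.
by rewrite !ler_norml; lra.
Qed.

End sequences_of_reals.

Section expectation.
Context {R : realType} {d0 : measure_display} {T : measurableType d0}.
Variable P : probability T R.
Implicit Types (f g : T -> R) (A : set T).

(** [fine] loses nothing where [Ex] is used, namely on the bounded random variables singled out by
    [brv]; this keeps the estimates in the reals. *)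
Definition Ex f : R := fine (\int[P]_w (f w)%:E)%E.
Definition pr A : R := fine (P A).
Definition brv f : Prop :=
  measurable_fun [set: T] f /\ exists M : R, forall w, `|f w| <= M.

Lemma brv_meas f : brv f -> measurable_fun [set: T] f.
Proof. by case. Qed.

Lemma brv_integrable f : brv f -> P.-integrable [set: T] (EFin \o f).
Proof.
move=> [mf [M fM]]; apply: measurable_bounded_integrable => //.
  by rewrite [ltLHS]probability_setT ltry.
by exists M; split; [exact: num_real|move=> x Mx w _; exact: le_trans (fM _) (ltW Mx)].
Qed.

Lemma EFin_Ex f : brv f -> (Ex f)%:E = (\int[P]_w (f w)%:E)%E.
Proof.
by move=> bf; rewrite /Ex fineK//; exact: integrable_fin_num (brv_integrable bf).
Qed.

Lemma brv_cst (c : R) : brv (fun=> c).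
Proof. by split; [exact: measurable_cst|exists `|c|]. Qed.

Lemma brvD f g : brv f -> brv g -> brv (fun w => f w + g w).
Proof.
move=> [mf [M fM]] [mg [N gN]]; split; first exact: measurable_funD.
by exists (M + N) => w; rewrite (le_trans (ler_normD _ _))// lerD.
Qed.

Lemma brvM f g : brv f -> brv g -> brv (fun w => f w * g w).
Proof.
move=> [mf [M fM]] [mg [N gN]]; split; first exact: measurable_funM.
by exists (M * N) => w; rewrite normrM ler_pM.
Qed.

Lemma brvN f : brv f -> brv (fun w => - f w).
Proof.
move=> bf; have := brvM (brv_cst (-1)) bf.
by congr brv; apply/funext => w; rewrite mulN1r.
Qed.

Lemma brvB f g : brv f -> brv g -> brv (fun w => f w - g w).
Proof. by move=> bf bg; apply: brvD => //; exact: brvN. Qed.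

Lemma brvZ (a : R) f : brv f -> brv (fun w => a * f w).
Proof. by move=> bf; apply: brvM => //; exact: brv_cst. Qed.

Lemma brv_abs f : brv f -> brv (fun w => `|f w|).
Proof.
move=> [mf [M fM]]; split; first exact: measurableT_comp.
by exists M => w; rewrite normr_id.
Qed.

Lemma brvX f n : brv f -> brv (fun w => f w ^+ n).
Proof.
move=> bf; elim: n => [|n ih]; first by under eq_fun do rewrite expr0; exact: brv_cst.
by under eq_fun do rewrite exprS; exact: brvM.
Qed.

Lemma brv_sum (I : Type) (r : seq I) (p : pred I) (F : I -> T -> R) :
  (forall i, p i -> brv (F i)) -> brv (fun w => \sum_(i <- r | p i) F i w).
Proof.
move=> bF; elim: r => [|i r ih].
  by under eq_fun do rewrite big_nil; exact: brv_cst.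
case pi : (p i); last by under eq_fun do rewrite big_cons pi.
by under eq_fun do rewrite big_cons pi; apply: brvD => //; exact: bF.
Qed.

Lemma brv_indic A : measurable A -> brv (fun w => \1_A w).
Proof.
move=> mA; split; first exact: measurable_indic.
by exists 1 => w; rewrite indicE; case: (_ \in _); rewrite ?normr1 ?normr0.
Qed.

Lemma ExD f g : brv f -> brv g -> Ex (fun w => f w + g w) = Ex f + Ex g.
Proof. by move=> bf bg; apply: RintegralD => //; exact: brv_integrable. Qed.

Lemma ExB f g : brv f -> brv g -> Ex (fun w => f w - g w) = Ex f - Ex g.
Proof. by move=> bf bg; apply: RintegralB => //; exact: brv_integrable. Qed.

Lemma ExZ (a : R) f : brv f -> Ex (fun w => a * f w) = a * Ex f.
Proof. by move=> bf; apply: RintegralZl => //; exact: brv_integrable. Qed.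

Lemma Ex_cst (c : R) : Ex (fun=> c) = c.
Proof.
by rewrite /Ex integral_cst//= probability_setT mule1.
Qed.

Lemma ExN f : brv f -> Ex (fun w => - f w) = - Ex f.
Proof.
by move=> bf; rewrite -mulN1r -ExZ//; congr Ex; apply/funext => w; rewrite mulN1r.
Qed.

Lemma Ex_sum (I : Type) (r : seq I) (p : pred I) (F : I -> T -> R) :
  (forall i, p i -> brv (F i)) ->
  Ex (fun w => \sum_(i <- r | p i) F i w) = \sum_(i <- r | p i) Ex (F i).
Proof.
move=> bF; elim: r => [|i r ih].
  by rewrite big_nil -[RHS]Ex_cst; congr Ex; apply/funext => w; rewrite big_nil.
rewrite big_cons; case pi : (p i); last first.
  by rewrite -ih; congr Ex; apply/funext => w; rewrite big_cons pi.
rewrite -ih -ExD//; last 2 first.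
- exact: bF.
- exact: brv_sum.
by congr Ex; apply/funext => w; rewrite big_cons pi.
Qed.

Lemma Ex_le f g : brv f -> brv g -> (forall w, f w <= g w) -> Ex f <= Ex g.
Proof.
move=> bf bg fg; apply: le_Rintegral => //; exact: brv_integrable.
Qed.

Lemma Ex_ge0 f : (forall w, 0 <= f w) -> 0 <= Ex f.
Proof. by move=> f0; apply: Rintegral_ge0 => w _; exact: f0. Qed.

Lemma Ex_norm f : brv f -> `|Ex f| <= Ex (fun w => `|f w|).
Proof. by move=> bf; apply: le_normr_Rintegral => //; exact: brv_integrable. Qed.

Lemma Ex_norm_le f (M : R) : brv f -> (forall w, `|f w| <= M) -> `|Ex f| <= M.
Proof.
move=> bf fM; rewrite (le_trans (Ex_norm bf))// -[leRHS]Ex_cst.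
by apply: Ex_le => //; [exact: brv_abs|exact: brv_cst].
Qed.

Lemma EFin_pr A : measurable A -> (pr A)%:E = P A.
Proof. by move=> mA; rewrite /pr fineK// fin_num_measure. Qed.

Lemma Ex_indic A : measurable A -> Ex (fun w => \1_A w) = pr A.
Proof. by move=> mA; rewrite /Ex integral_indic// setIT. Qed.

Lemma pr_ge0 A : 0 <= pr A.
Proof. by rewrite /pr fine_ge0. Qed.

Lemma pr_le1 A : measurable A -> pr A <= 1.
Proof. by move=> mA; rewrite -lee_fin EFin_pr// probability_le1. Qed.

Lemma pr_le A B : measurable A -> measurable B -> A `<=` B -> pr A <= pr B.
Proof.
by move=> mA mB AB; rewrite -lee_fin !EFin_pr// le_measure// inE.
Qed.

Lemma pr_setT : pr setT = 1.
Proof. by rewrite /pr probability_setT. Qed.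

Lemma pr_set0 : pr set0 = 0.
Proof. by rewrite /pr measure0. Qed.

Lemma pr_setC A : measurable A -> pr (~` A) = 1 - pr A.
Proof.
move=> mA; apply: EFin_inj; rewrite EFin_pr ?probability_setC ?EFinB ?EFin_pr//.
exact: measurableC.
Qed.

Lemma prU A B : measurable A -> measurable B -> pr (A `|` B) <= pr A + pr B.
Proof.
move=> mA mB; rewrite -lee_fin EFinD !EFin_pr//; last exact: measurableU.
exact: measureU2.
Qed.

Lemma pr_bigcup_fin (I : Type) (r : seq I) (p : pred I) (F : I -> set T) :
  (forall i, p i -> measurable (F i)) ->
  pr (\big[setU/set0]_(i <- r | p i) F i) <= \sum_(i <- r | p i) pr (F i).
Proof.
move=> mF; elim: r => [|i r ih]; first by rewrite !big_nil pr_set0.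
rewrite !big_cons; case pi : (p i) => //.
rewrite (le_trans (prU (mF _ pi) _)) ?lerD2l//.
exact: bigsetU_measurable.
Qed.

Lemma pr_markov A f (c : R) : measurable A -> brv f -> (forall w, 0 <= f w) ->
  (forall w, A w -> c <= f w) -> c * pr A <= Ex f.
Proof.
move=> mA bf f0 fA; rewrite -Ex_indic// -ExZ; last exact: brv_indic.
apply: Ex_le => //; first exact/brvZ/brv_indic.
move=> w; rewrite indicE; have [|_] := boolP (w \in A); rewrite ?mulr1 ?mulr0// inE => wA.
exact: fA.
Qed.

Lemma Ex_dct (F : nat -> T -> R) f (M : R) :
  (forall n, measurable_fun [set: T] (F n)) ->
  (forall n w, `|F n w| <= M) -> (forall w, (fun n => F n w) @ \oo --> f w) ->
  brv f /\ (fun n => Ex (F n)) @ \oo --> Ex f.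
Proof.
move=> mF FM Ff.
have mf : measurable_fun [set: T] f.
  by apply: (@measurable_fun_cvg _ _ _ _ F) => // w _; exact: Ff.
have bf : brv f.
  split => //; exists M => w.
  by apply: (@cvgn_le R (fun n => `|F n w|)) => [|n //]; apply: cvg_norm; exact: Ff.
have bF n : brv (F n) by split => //; exists M => w; exact: FM.
split => //.
apply: fine_cvg; rewrite -/(Ex f) EFin_Ex//.
apply: (@dominated_cvg _ _ _ P setT measurableT _ _ (fun=> M%:E)) => //.
- by move=> n; apply/measurable_EFinP.
- by move=> w _; apply: cvg_EFin; [exact: nearW|exact: Ff].
- by apply: brv_integrable; exact: brv_cst.
- by move=> n w _; rewrite lee_fin.
Qed.

Lemma Ex_dist (A : set T) f g (e M : R) : measurable A -> 0 <= e ->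
  brv f -> brv g -> (forall w, `|f w| <= M) -> (forall w, `|g w| <= M) ->
  (forall w, ~ A w -> `|f w - g w| <= e) ->
  `|Ex f - Ex g| <= e + 2 * M * pr A.
Proof.
move=> mA e0 bf bg fM gM fg.
rewrite -ExB// (le_trans (Ex_norm _))//; first exact: brvB.
rewrite -(Ex_cst e) -Ex_indic// -ExZ; last exact: brv_indic.
rewrite -ExD; [|exact: brv_cst|exact/brvZ/brv_indic].
apply: Ex_le => [||w].
- by apply/brv_abs/brvB.
- by apply: brvD; [exact: brv_cst|exact/brvZ/brv_indic].
rewrite indicE; have [wA|/negP wA] := boolP (w \in A).
  rewrite mulr1 (le_trans (ler_normB _ _))//.
  rewrite (_ : 2 * M = M + M); last by ring.
  by rewrite -[leLHS]add0r lerD// lerD.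
by rewrite mulr0 addr0; apply: fg => ?; apply: wA; rewrite inE.
Qed.

End expectation.

Section dyadic_rounding.
Context {R : realType}.
Implicit Types x y : R.

Definition dyfl (k : nat) x : R := (Num.floor (2 ^+ k * x))%:~R / 2 ^+ k.

Lemma dyfl_le k x : dyfl k x <= x.
Proof.
rewrite /dyfl ler_pdivrMr ?exprn_gt0// mulrC.
exact: ge_floor.
Qed.

Lemma dyfl_gt k x : x - (2 ^+ k)^-1 < dyfl k x.
Proof.
rewrite /dyfl ltr_pdivlMr ?exprn_gt0// mulrBl mulVf ?expf_neq0//.
by rewrite ltrBlDr mulrC -intrD1 floorD1_gt.
Qed.

Lemma dyfl_dist k x : `|dyfl k x - x| <= (2 ^+ k)^-1.
Proof.
have := dyfl_le k x; have := dyfl_gt k x.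
by rewrite ler_norml; lra.
Qed.

Lemma expr_small (c rho e : R) : 0 <= rho < 1 -> 0 <= c -> 0 < e ->
  exists N, forall n, (N <= n)%N -> c * rho ^+ n <= e.
Proof.
move=> /andP[r0 r1] c0 e0; have c1 : 0 < c + 1 by rewrite ltr_wpDl.
have /cvgnP/(_ _ (divr_gt0 e0 c1))[N HN] : (fun n => rho ^+ n) @ \oo --> 0.
  by apply: cvg_expr; rewrite ger0_norm.
exists N => n /HN; rewrite subr0 ger0_norm ?exprn_ge0// ler_pdivlMr// => h.
by rewrite (le_trans _ h)// mulrC ler_wpM2l ?exprn_ge0// lerDl.
Qed.

Lemma inv2X_small (e : R) : 0 < e -> exists k0, forall k, (k0 <= k)%N ->
  (2 ^+ k)^-1 <= e.
Proof.
move=> e0; have /cvgnP/(_ e e0)[N HN] : (fun k => (2 ^+ k)^-1 : R) @ \oo --> 0.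
  under eq_fun do rewrite -exprVn.
  by apply: cvg_expr; rewrite ger0_norm ?invr_ge0// invf_lt1// ltr1n.
exists N => k Nk; have := HN _ Nk.
by rewrite subr0 ger0_norm// invr_ge0 exprn_ge0.
Qed.

End dyadic_rounding.

Section measurability.
Context {R : realType} {d0 : measure_display} {T : measurableType d0}.

Lemma measurable_le_cst (f : T -> R) (c : R) : measurable_fun [set: T] f ->
  measurable [set w | f w <= c].
Proof.
move=> mf; rewrite (_ : [set w | _] = [set: T] `&` f @^-1` `]-oo, c]%classic).
  exact: mf.
by rewrite setTI; apply/seteqP; split => w /=; rewrite in_itv.
Qed.

Lemma measurable_gt_cst (f : T -> R) (c : R) : measurable_fun [set: T] f ->
  measurable [set w | c < f w].
Proof.
move=> mf; rewrite (_ : [set w | _] = [set: T] `&` f @^-1` `]c, +oo[%classic).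
  exact: mf.
by rewrite setTI; apply/seteqP; split => w /=; rewrite in_itv/= andbT.
Qed.

(* A function of finitely many random reals is the limit of its values at
   dyadically rounded arguments, each of which takes countably many values. *)
Lemma measurable_dyfl (J : finType) (Xi : J -> T -> R) (H : (J -> R) -> R) :
  (forall j, measurable_fun [set: T] (Xi j)) ->
  (forall w, (fun k => H (fun j => dyfl k (Xi j w))) @ \oo --> H (Xi ^~ w)) ->
  measurable_fun [set: T] (fun w => H (Xi ^~ w)).
Proof.
move=> mXi HXi.
apply: (@measurable_fun_cvg _ _ _ _ (fun k w => H (fun j => dyfl k (Xi j w)))) => //.
move=> k _ B mB; rewrite setTI.
pose D (z : J -> int) : set T :=
  \bigcap_(j in [set: J]) [set w | Num.floor (2 ^+ k * Xi j w) = z j].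
have mD z : measurable (D z).
  apply: fin_bigcap_measurable => // j _.
  have -> : [set w | Num.floor (2 ^+ k * Xi j w) = z j] =
      (fun w => 2 ^+ k * Xi j w) @^-1` `[(z j)%:~R, (z j + 1)%:~R[%classic.
    apply/seteqP; split => w /=; rewrite in_itv/=.
      by move=> <-; rewrite ge_floor floorD1_gt.
    by rewrite -floor_ge_int -floor_lt_int ltzD1 => ?; apply: le_anti; rewrite andbC.
  rewrite -[X in measurable X]setTI.
  by apply: (measurable_funM (measurable_cst _) (mXi j)).
have -> : (fun w => H (fun j => dyfl k (Xi j w))) @^-1` B =
    \bigcup_(z : {ffun J -> int})
      (if H (fun j => (z j)%:~R / 2 ^+ k) \in B then D z else set0).
  apply/seteqP; split => w /=.
    move=> Bw; exists [ffun j => Num.floor (2 ^+ k * Xi j w)] => //.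
    rewrite ifT; first by move=> j _ /=; rewrite ffunE.
    rewrite inE; move: Bw; congr B; congr H; apply/funext => j.
    by rewrite ffunE.
  case=> z _; case: ifPn => //; rewrite inE => Bz Dz.
  move: Bz; congr B; congr H; apply/funext => j.
  by rewrite /dyfl (Dz j).
apply: countable_bigcupT_measurable; first exact: countableP.
by move=> z; case: ifP.
Qed.

End measurability.

(** * Convergence of bounded Lipschitz functionals from cosine transforms *)

Section lipschitz.
Context {R : realType}.
Implicit Types (g : (nat -> R) -> R) (x y : nat -> R).

(** The arguments are sequences because the field over all levels is a single sequence; the bound
    through the first [m] terms also forces [g] to depend on these only. *)
Definition lipn (m : nat) (K : R) g : Prop := 0 <= K /\
  forall x y, `|g x - g y| <= K * \sum_(j < m) `|x j - y j|.

Lemma lipn_ext m K g x y : lipn m K g -> (forall j, (j < m)%N -> x j = y j) -> g x = g y.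
Proof.
move=> [_ lg] xy; apply/eqP; rewrite -subr_eq0 -normr_le0 (le_trans (lg x y))//.
by rewrite big1 ?mulr0// => j _; rewrite xy// subrr normr0.
Qed.

Lemma lipn_unif m K g x y (e : R) : lipn m K g ->
  (forall j, (j < m)%N -> `|x j - y j| <= e) -> `|g x - g y| <= K * m%:R * e.
Proof.
move=> [K0 lg] xy; rewrite (le_trans (lg _ _))// -mulrA ler_wpM2l//.
rewrite (@le_trans _ _ (\sum_(j < m) e))//; first by apply: ler_sum => j _; exact: xy.
by rewrite sumr_const card_ord mulr_natl.
Qed.

Lemma lipn_cvg m K g (x : nat -> nat -> R) y : lipn m K g ->
  (forall j, (j < m)%N -> (fun k => x k j) @ \oo --> y j) ->
  (fun k => g (x k)) @ \oo --> g y.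
Proof.
move=> lg xy; have [K0 _] := lg; apply/cvgnP => e e0.
(* The [+ 1] allows [K * m = 0]; the same device recurs in later choices of constants. *)
have K1 : 0 < K * m%:R + 1 by rewrite ltr_wpDl// mulr_ge0.
have {}xy (j : 'I_m) : exists N, forall k, (N <= k)%N ->
    `|x k j - y j| <= e / (K * m%:R + 1).
  by have /cvgnP := xy j (ltn_ord j); apply; rewrite divr_gt0.
have [N HN] := choice xy.
exists (\max_(j < m) N j)%N => k Nk.
rewrite (le_trans (@lipn_unif _ _ _ _ _ (e / (K * m%:R + 1)) lg _))//.
  move=> j jm; apply: (HN (Ordinal jm)); apply: leq_trans Nk.
  exact: (leq_bigmax (Ordinal jm)).
by rewrite mulrCA ler_piMr ?(ltW e0)// ler_pdivrMr// mul1r lerDl.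
Qed.

Lemma lipn_meas {d0 : measure_display} {T : measurableType d0} m K g (Y : T -> nat -> R) :
  lipn m K g -> (forall j, (j < m)%N -> measurable_fun [set: T] (fun w => Y w j)) ->
  measurable_fun [set: T] (fun w => g (Y w)).
Proof.
move=> lg mY.
(* Extension by [0] turns [g] into a function on a finite product, as [measurable_dyfl] wants. *)
pose ex (x : 'I_m -> R) (j : nat) : R := if insub j is Some i then x i else 0.
have HE w : g (Y w) = g (ex (fun j => Y w j)).
  by apply: (lipn_ext lg) => j jm; rewrite /ex insubT.
rewrite (_ : (fun w => g (Y w)) = fun w => g (ex (fun j : 'I_m => Y w j))); last exact/funext.
apply: (@measurable_dyfl _ _ _ _ (fun (j : 'I_m) w => Y w j) (g \o ex)) => [j|w].
  exact: mY.
apply: (lipn_cvg lg) => j jm; rewrite /ex insubT//=.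
apply/cvgnP => e /inv2X_small[k0 Hk0]; exists k0 => k /Hk0; apply: le_trans.
exact: dyfl_dist.
Qed.

Lemma brv_lipn {d0 : measure_display} {T : measurableType d0} m K g
    (Y : T -> nat -> R) (M : R) :
  lipn m K g -> (forall x, `|g x| <= M) ->
  (forall j, (j < m)%N -> measurable_fun [set: T] (fun w => Y w j)) ->
  brv (fun w => g (Y w)).
Proof. by move=> lg gM mY; split; [exact: lipn_meas lg mY|exists M]. Qed.

End lipschitz.

Section smallness.
Context {R : realType}.

Lemma div_small (c e : R) : 0 <= c -> 0 < e -> exists2 L, 0 < L & c / L <= e.
Proof.
move=> c0 e0; exists ((c + 1) / e); first by rewrite divr_gt0// ltr_wpDl.
rewrite invf_div mulrCA ler_piMr ?(ltW e0)// ler_pdivrMr ?ltr_wpDl// mul1r lerDl.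
exact: ler01.
Qed.

Lemma div_sqrt_small (c e : R) : 0 <= c -> 0 < e ->
  exists N, c * (Num.sqrt N.+1%:R)^-1 <= e.
Proof.
move=> c0 e0; have := archi_boundP (sqr_ge0 (c / e)); set N := Num.bound _ => hN.
exists N; rewrite ler_pdivrMr ?sqrtr_gt0// mulrC -ler_pdivrMr//.
rewrite -[leLHS]ger0_norm ?divr_ge0 ?(ltW e0)// -sqrtr_sqr ler_wsqrtr//.
by rewrite (le_trans (ltW hN))// ler_nat.
Qed.

End smallness.

Section sine.
Context {R : realType}.
Implicit Types x y L : R.

Lemma cos_lip x y : `|cos x - cos y| <= `|x - y|.
Proof.
wlog xy : x y / x < y => [H|].
  have [/H//|/H|->] := ltgtP x y; last by rewrite !subrr.
  by rewrite distrC (distrC y).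
have [] := @MVT R cos (fun z => - sin z) x y xy.
- by apply: continuous_subspaceT => z; exact: continuous_cos.
move=> z _ e; rewrite distrC e (distrC x) normrM normrN ler_piMl//.
by rewrite ler_norml sin_geN1 sin_le1.
Qed.

(** The quadratic bound is weaker than the cubic one near [0], but it holds on the whole line and
    involves only the second moments that are under control. *)
Lemma sin_dist0 x : `|sin x - x| <= x ^+ 2.
Proof.
wlog x0 : x / 0 < x => [H|].
  have [x0|/H//|->] := ltgtP x 0; last by rewrite sin0 subrr normr0 expr0n.
  have := H (- x); rewrite oppr_gt0 => /(_ x0).
  by rewrite sinN -opprD normrN sqrrN.
have [] := @MVT R (fun z => sin z - z) (fun z => cos z - 1) 0 x x0.
- apply: continuous_subspaceT => z; apply: continuousB => //; exact: continuous_sin.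
move=> z; rewrite in_itv/= => /andP[z0 zx]; rewrite sin0 !subr0 => ->.
rewrite normrM expr2 (gtr0_norm x0) ler_pM2r//.
have := cos_lip z 0; rewrite cos0 subr0 (gtr0_norm z0) => /le_trans; apply.
exact: ltW.
Qed.

Lemma sin_rescale L x : 0 < L -> `|L * sin (x / L) - x| <= x ^+ 2 / L.
Proof.
move=> L0; rewrite (_ : L * _ - x = L * (sin (x / L) - x / L)); last first.
  by field; rewrite gt_eqF.
rewrite normrM gtr0_norm// (_ : x ^+ 2 / L = L * (x / L) ^+ 2); last first.
  by field; rewrite gt_eqF.
by rewrite ler_pM2l// sin_dist0.
Qed.

End sine.

(* Bernstein's operator in several variables, one Bernoulli trial at a time:
   [trials tr F k q] is the expectation of [F] at [k] plus the vector counting,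
   for each coordinate [j], the successes among the independent trials in [tr]
   that are labelled [j], each of which has success probability [q j]. *)
Section bernstein.
Context {R : realType}.
Implicit Types (F : (nat -> nat) -> R) (q : nat -> R) (k : nat -> nat).

Definition bump1 j k : nat -> nat := fun i => (k i + (i == j))%N.

Fixpoint trials (tr : seq nat) F k q : R :=
  if tr is j :: tr' then
    q j * trials tr' F (bump1 j k) q + (1 - q j) * trials tr' F k q
  else F k.

Lemma trials_le tr F F' k q : (forall j, 0 <= q j <= 1) ->
  (forall k, F k <= F' k) -> trials tr F k q <= trials tr F' k q.
Proof.
move=> q01 FF'; elim: tr k => //= j tr ih k; have /andP[q0 q1] := q01 j.
by rewrite lerD// ler_wpM2l// subr_ge0.
Qed.

Lemma trials_lin tr (a : R) F F' k q :
  trials tr (fun k => a * F k + F' k) k q = a * trials tr F k q + trials tr F' k q.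
Proof. by elim: tr k => //= j tr ih k; rewrite !ih; ring. Qed.

Lemma trials_cst tr (c : R) k q : trials tr (fun=> c) k q = c.
Proof. by elim: tr k => //= j tr ih k; rewrite !ih; ring. Qed.

Lemma trials_sum m tr (F : nat -> (nat -> nat) -> R) k q :
  trials tr (fun k => \sum_(j < m) F j k) k q = \sum_(j < m) trials tr (F j) k q.
Proof.
elim: m => [|m ih].
  rewrite big_ord0 -[RHS](trials_cst tr 0 k q); congr trials.
  by apply/funext => ?; rewrite big_ord0.
rewrite big_ord_recr/= -ih addrC -[trials _ (F m) _ _]mul1r -trials_lin; congr trials.
by apply/funext => ?; rewrite big_ord_recr/= mul1r addrC.
Qed.

(** Squared bias plus the binomial variance [N q (1 - q)], where [N] is the number of trials
    labelled [j]. *)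
Lemma trials_sqr tr j (c : R) k q :
  trials tr (fun k => ((k j)%:R - c) ^+ 2) k q =
  ((k j)%:R + (count_mem j tr)%:R * q j - c) ^+ 2 + (count_mem j tr)%:R * (q j * (1 - q j)).
Proof.
elim: tr k => [|i tr ih] k /=; first by rewrite !mul0r !addr0.
rewrite !ih /bump1 (eq_sym j i); case: eqVneq => [->|_]; rewrite /= ?addn0 ?add0n.
  by rewrite !natrD; ring.
by ring.
Qed.

Definition multitrials m N : seq nat := flatten [seq nseq N j | j <- iota 0 m].

Lemma count_multitrials m N j : (j < m)%N -> count_mem j (multitrials m N) = N.
Proof.
move=> jm; rewrite /multitrials.
elim: m jm => // m ih; rewrite -[in iota _ _]addn1 iotaD map_cat flatten_cat count_cat /= cats0.
rewrite count_nseq add0n ltnS leq_eqVlt => /predU1P[->|jm].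
  rewrite /= eqxx mul1n [X in (X + _)%N](_ : _ = 0)%N ?add0n//.
  apply/count_memPn/negP => /flatten_mapP[i]; rewrite mem_iota => /andP[_ im].
  by rewrite mem_nseq => /andP[_ /eqP ji]; move: im; rewrite -ji add0n ltnn.
by rewrite ih//= (gtn_eqF jm) mul0n addn0.
Qed.

Lemma bernstein_lipn m K (g : (nat -> R) -> R) q N : lipn m K g ->
  (forall j, 0 <= q j <= 1) ->
  `|trials (multitrials m N.+1) (fun k => g (fun j => (k j)%:R / N.+1%:R)) (fun=> 0%N) q
     - g q| <= K * m%:R * (Num.sqrt N.+1%:R)^-1.
Proof.
move=> lg q01; have [K0 lgE] := lg; set s := Num.sqrt _; set tr := multitrials _ _.
have s0 : 0 < s by rewrite sqrtr_gt0.
have s2 : s ^+ 2 = N.+1%:R by rewrite sqr_sqrtr.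
(* With [u = k j / N.+1 - q j], this is [(s u^2 + s^-1) / 2 >= |u|]: a bound on the absolute
   deviation that is linear in the square, hence computable by [trials_sqr]. *)
pose D1 (j : nat) (k : nat -> nat) :=
  (2 * s ^+ 3)^-1 * ((k j)%:R - N.+1%:R * q j) ^+ 2 + (2 * s)^-1.
(* The summand [0] gives [D] the form [a * F + F'] of [trials_lin]. *)
pose D k := K * \sum_(j < m) D1 j k + 0.
have DE : trials tr D (fun=> 0%N) q <= K * m%:R * s^-1.
  rewrite trials_lin trials_cst addr0 -mulrA ler_wpM2l// trials_sum.
  rewrite (@le_trans _ _ (\sum_(j < m) s^-1))//; last first.
    by rewrite sumr_const card_ord mulr_natl.
  apply: ler_sum => j _; rewrite trials_lin trials_cst trials_sqr.
  rewrite count_multitrials// add0r subrr expr0n/= add0r -s2.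
  have /andP[q0 q1] := q01 j.
  have h : q j * (1 - q j) <= 1 by nra.
  rewrite (_ : _ * _ = (2 * s)^-1 * (q j * (1 - q j))); last first.
    by field; rewrite gt_eqF.
  rewrite (_ : s^-1 = (2 * s)^-1 * 1 + (2 * s)^-1); last by field; rewrite gt_eqF.
  by rewrite lerD2r ler_wpM2l// invr_ge0 mulr_ge0// ltW.
have FD k : `|g (fun j => (k j)%:R / N.+1%:R) - g q| <= D k.
  rewrite (le_trans (lgE _ _))// /D addr0 ler_wpM2l//; apply: ler_sum => j _; rewrite /D1.
  set u := (k j)%:R / _ - q j.
  rewrite (_ : (k j)%:R - _ = s ^+ 2 * u); last first.
    by rewrite /u s2 mulrBr mulrCA divff// mulr1.
  rewrite (_ : _ + _ = (2 * s)^-1 * ((s * u) ^+ 2 + 1)); last first.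
    by field; rewrite gt_eqF.
  rewrite -[leLHS]mul1r (_ : 1 * `|u| = (2 * s)^-1 * (2 * `|s * u|)); last first.
    by rewrite normrM gtr0_norm//; field; rewrite gt_eqF.
  rewrite ler_pM2l ?invr_gt0 ?mulr_gt0// -[(s * u) ^+ 2]real_normK ?num_real//.
  by rewrite -subr_ge0 (_ : _ - _ = (`|s * u| - 1) ^+ 2) ?sqr_ge0//; ring.
set Fg := fun k => g (fun j : nat => (k j)%:R / N.+1%:R) in FD *.
have h1 : g q <= trials tr D (fun=> 0%N) q + trials tr Fg (fun=> 0%N) q.
  rewrite -(mul1r (trials tr D _ _)) -trials_lin -{1}(trials_cst tr (g q) (fun=> 0%N) q).
  by apply: trials_le => // k; have := FD k; rewrite -/(Fg k) mul1r ler_norml; lra.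
have h2 : trials tr Fg (fun=> 0%N) q <= trials tr D (fun=> 0%N) q + g q.
  rewrite -(mul1r (trials tr D _ _)) -(trials_cst tr (g q) (fun=> 0%N) q) -trials_lin.
  by apply: trials_le => // k; have := FD k; rewrite -/(Fg k) mul1r ler_norml; lra.
by rewrite ler_norml; lra.
Qed.

End bernstein.

(* Convergence of all the cosine transforms of the finite-dimensional marginals,
   together with bounded second moments, yields convergence of the expectations
   of all bounded Lipschitz functions: polynomials in the [sin (v j / L)] are
   trigonometric polynomials in [v], they approximate Lipschitz functions of
   the [L * sin (v j / L)], and [L * sin (v j / L)] tends to [v j]. *)
Section trigonometric_convergence.
Context {R : realType} {d0 : measure_display} {T : measurableType d0}.
Variables (P : probability T R) (V : nat -> T -> nat -> R).
Hypothesis bV : forall n j, brv (fun w => V n w j).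
Hypothesis V2 : forall j, exists C : R, forall n, Ex P (fun w => V n w j ^+ 2) <= C.
Definition linf (al : seq (R * nat)) (v : nat -> R) : R := \sum_(x <- al) x.1 * v x.2.
Hypothesis Vtrig : forall al b, exists l : R,
  (fun n => Ex P (fun w => cos (linf al (V n w) + b))) @ \oo --> l.

Implicit Types F : (nat -> R) -> R.

Definition bdF F := forall n, brv (fun w => F (V n w)).

(** The arbitrary cosine factor makes the class stable under multiplication by sines, which
    convergence of the expectation of [F] alone would not be. *)
Definition adm F := bdF F /\ forall al b, exists l : R,
  (fun n => Ex P (fun w => F (V n w) * cos (linf al (V n w) + b))) @ \oo --> l.

Lemma brv_linf al n : brv (fun w => linf al (V n w)).
Proof. by apply: brv_sum => x _; apply/brvM/bV; exact: brv_cst. Qed.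

Lemma measurable_sin : measurable_fun [set: R] (@sin R).
Proof. by apply: continuous_measurable_fun => x; exact: continuous_sin. Qed.

Lemma measurable_cos : measurable_fun [set: R] (@cos R).
Proof. by apply: continuous_measurable_fun => x; exact: continuous_cos. Qed.

Lemma brv_cos (f : T -> R) : measurable_fun [set: T] f -> brv (fun w => cos (f w)).
Proof.
move=> mf; split; first exact: measurableT_comp measurable_cos mf.
by exists 1 => w; rewrite ler_norml cos_geN1 cos_le1.
Qed.

Lemma brv_sin (f : T -> R) : measurable_fun [set: T] f -> brv (fun w => sin (f w)).
Proof.
move=> mf; split; first exact: measurableT_comp measurable_sin mf.
by exists 1 => w; rewrite ler_norml sin_geN1 sin_le1.
Qed.

Lemma brv_coslin al b n : brv (fun w => cos (linf al (V n w) + b)).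
Proof.
by apply: brv_cos; apply: brv_meas; apply: brvD; [exact: brv_linf|exact: brv_cst].
Qed.

Lemma adm1 : adm (fun=> 1).
Proof.
split => [n|al b]; first exact: brv_cst.
by have [l] := Vtrig al b; exists l; under eq_fun do under eq_fun do rewrite mul1r.
Qed.

Lemma adm_lin (a b : R) F G : adm F -> adm G -> adm (fun v => a * F v + b * G v).
Proof.
move=> [bF aF] [bG aG]; split => [n|al c]; first by apply: brvD; exact: brvZ.
have [l Fl] := aF al c; have [m Gm] := aG al c; exists (a * l + b * m).
rewrite (_ : (fun n => _) = fun n =>
    a * Ex P (fun w => F (V n w) * cos (linf al (V n w) + c)) +
    b * Ex P (fun w => G (V n w) * cos (linf al (V n w) + c))).
  by apply: cvgD; apply: cvgMr.
apply/funext => n; rewrite -!ExZ -?ExD; try apply: brvZ; try apply: brvM => //; try exact: brv_coslin.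
by congr Ex; apply/funext => w; ring.
Qed.

Lemma adm_ext F G : F =1 G -> adm F -> adm G.
Proof. by move=> /funext ->. Qed.

(** [2 sin A cos B = sin (A + B) + sin (A - B)], each sine being a cosine shifted by [pi / 2]; the
    second one carries the opposite coefficients of [al]. *)
Lemma adm_sin F L j : adm F -> adm (fun v => sin (v j / L) * F v).
Proof.
move=> [bF aF]; split => [n|al c].
  apply: brvM => //; apply: brv_sin; apply: brv_meas; apply: brvM => //.
  exact: brv_cst.
have [l Fl] := aF ((L^-1, j) :: al) (c - pi / 2).
have [m Fm] := aF ((L^-1, j) :: [seq (- x.1, x.2) | x <- al]) (- c - pi / 2).
exists (2^-1 * l + 2^-1 * m).
rewrite (_ : (fun n => _) = fun n =>
    2^-1 * Ex P (fun w => F (V n w) * cos (linf ((L^-1, j) :: al) (V n w) + (c - pi / 2))) +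
    2^-1 * Ex P (fun w => F (V n w) *
      cos (linf ((L^-1, j) :: [seq (- x.1, x.2) | x <- al]) (V n w) + (- c - pi / 2)))).
  by apply: cvgD; apply: cvgMr.
apply/funext => n; rewrite -!ExZ -?ExD; try apply: brvZ; try apply: brvM => //; try exact: brv_coslin.
congr Ex; apply/funext => w; rewrite /linf !big_cons big_map/=.
set B := \sum_(x <- al) x.1 * _; set A := V n w j / L.
rewrite (_ : \sum_(i <- al) - i.1 * V n w i.2 = - B); last first.
  by rewrite -sumrN; apply: eq_bigr => i _; rewrite mulNr.
rewrite (mulrC L^-1) -/A.
rewrite (_ : A + B + _ = (A + (B + c)) - pi / 2); last by ring.
rewrite (_ : A - B + _ = (A - (B + c)) - pi / 2); last by ring.
by rewrite !cosBpihalf sinD sinB; field.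
Qed.

Lemma adm_trials L (tr : seq nat) (G : (nat -> nat) -> R) k F :
  adm F -> adm (fun v => trials tr G k (fun j => (1 + sin (v j / L)) / 2) * F v).
Proof.
elim: tr k F => [|j tr ih] k F aF /=.
  by apply: adm_ext (adm_lin (G k) 0 aF aF) => v; ring.
have a1 := ih (bump1 j k) _ aF; have a0 := ih k _ aF.
apply: adm_ext (adm_lin 1 1 (adm_lin 2^-1 2^-1 a1 (adm_sin L j a1))
  (adm_lin 2^-1 (- 2^-1) a0 (adm_sin L j a0))) => v.
by field.
Qed.

Lemma cvg_Ex_lipn m K (g : (nat -> R) -> R) (M : R) : lipn m K g ->
  (forall v, `|g v| <= M) -> exists l : R, (fun n => Ex P (fun w => g (V n w))) @ \oo --> l.
Proof.
move=> lg gM; have [K0 lgE] := lg.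
have bg n : brv (fun w => g (V n w)).
  by apply: (brv_lipn lg gM) => j _; exact: brv_meas.
apply: cvgn_approx => e e0.
have [C HC] := choice V2.
pose S := \sum_(j < m) `|C j|.
have S0 : 0 <= S by apply: sumr_ge0.
(* By [sin_rescale] the passage to [L * sin (v j / L)] costs at most [K * S / L] in expectation,
   uniformly in [n]. *)
have [L L0 HL] := div_small (mulr_ge0 K0 S0) (divr_gt0 e0 (ltr0Sn R 1)).
(* [g] in the variables [y j = (1 + sin (v j / L)) / 2], which lie in [[0, 1]] and can serve as
   success probabilities. *)
pose g' (y : nat -> R) := g (fun j => L * (2 * y j - 1)).
have lg' : lipn m (K * (2 * L)) g'.
  split; first by rewrite mulr_ge0// mulr_ge0// ltW.
  move=> x y; rewrite (le_trans (lgE _ _))// -mulrA ler_wpM2l// mulr_sumr ler_sum// => j _.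
  rewrite (_ : _ - _ = 2 * L * (x j - y j)); last by ring.
  by rewrite normrM gtr0_norm// mulr_gt0.
have [N HN] : exists N, K * (2 * L) * m%:R * (Num.sqrt N.+1%:R)^-1 <= e / 2.
  by apply: div_sqrt_small; rewrite ?divr_gt0// !mulr_ge0// ltW.
pose F (v : nat -> R) := trials (multitrials m N.+1)
  (fun k => g' (fun j => (k j)%:R / N.+1%:R)) (fun=> 0%N) (fun j => (1 + sin (v j / L)) / 2) * 1.
have [bF aF] : adm F by apply: adm_trials; exact: adm1.
exists (fun n => Ex P (fun w => F (V n w))); split.
  have [l Fl] := aF [::] 0; exists l; apply: cvgn_ext Fl => n.
  congr Ex; apply/funext => w.
  by rewrite /linf big_nil addr0 cos0 mulr1.
exists 0%N => n _.
have q01 (w : T) j : 0 <= (1 + sin (V n w j / L)) / 2 <= 1.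
  by have := sin_geN1 (V n w j / L); have := sin_le1 (V n w j / L); lra.
rewrite -ExB// (le_trans (Ex_norm _ _))//; first exact: brvB.
rewrite (@le_trans _ _ (Ex P (fun w => \sum_(j < m) (K / L * V n w j ^+ 2) + e / 2)))//.
  apply: Ex_le => [||w].
  - by apply/brv_abs/brvB.
  - apply: brvD; last exact: brv_cst.
    by apply: brv_sum => j _; apply/brvZ/brvX.
  rewrite (_ : g (V n w) - _ = (g (V n w) - g (fun j => L * sin (V n w j / L))) -
     (F (V n w) - g' (fun j => (1 + sin (V n w j / L)) / 2))); last first.
    rewrite /g' [in X in _ - (_ - X)](_ : (fun j => _) = fun j => L * sin (V n w j / L)).
      by ring.
    by apply/funext => j; field.
  rewrite (le_trans (ler_normB _ _))// lerD//.
    rewrite (le_trans (lgE _ _))// mulr_sumr ler_sum// => j _.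
    by rewrite -mulrA ler_wpM2l// (mulrC L^-1) distrC; apply: sin_rescale.
  by rewrite /F mulr1 (le_trans (bernstein_lipn _ lg' (q01 w))).
rewrite ExD; last 2 first.
- by apply: brv_sum => j _; apply/brvZ/brvX.
- exact: brv_cst.
rewrite Ex_sum; last by move=> j _; apply/brvZ/brvX.
rewrite Ex_cst [leRHS](splitr e) lerD2r (le_trans _ HL)//.
rewrite -mulrA (mulrC S) mulrA /S mulr_sumr; apply: ler_sum => j _.
rewrite ExZ; last exact: brvX.
rewrite ler_wpM2l//; first by rewrite divr_ge0// ltW.
by rewrite (le_trans (HC _ _))// ler_norm.
Qed.

End trigonometric_convergence.

(** * Random bits with prescribed law *)

Section borel_cantelli.
Context {R : realType} {d0 : measure_display} {T : measurableType d0}.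
Variables (Q : probability T R) (A : nat -> set T) (c rho : R).
Hypothesis mA : forall n, measurable (A n).
Hypothesis c_ge0 : 0 <= c.
Hypothesis rho01 : 0 <= rho < 1.
Hypothesis prA : forall n, pr Q (A n) <= c * rho ^+ n.

(** The event that only finitely many of the [A n] occur. *)
Definition eventually_not : set T := \bigcup_M \bigcap_(n in [set n | (M <= n)%N]) ~` A n.

Lemma measurable_eventually_not : measurable eventually_not.
Proof.
apply: bigcupT_measurable => M; apply: bigcap_measurableType => n _.
exact: measurableC.
Qed.

Lemma pr_tail M : pr Q (\bigcup_n A (M + n)%N) <= c * rho ^+ M / (1 - rho).
Proof.
have /andP[r0 r1] := rho01.
have mU : measurable (\bigcup_n A (M + n)%N) by exact: bigcupT_measurable.
have {mU}cv : (fun k => pr Q (\bigcup_(n < k) A (M + n)%N)) @ \oo --> pr Q (\bigcup_n A (M + n)%N).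
  apply: fine_cvg; rewrite -/(pr _ _) EFin_pr//.
  have eU : \bigcup_n A (M + n)%N = \bigcup_k \bigcup_(n < k) A (M + n)%N.
    apply/seteqP; split => w; first by move=> [n _ An]; exists n.+1 => //; exists n => //=.
    by move=> [k _ [n _ An]]; exists n.
  rewrite [X in _ --> Q X]eU; apply: nondecreasing_cvg_mu.
  - by move=> k; apply: bigcup_measurable => n _; exact: mA.
  - by rewrite -eU.
  - move=> k l kl; apply/subsetPset => w [n nk An]; exists n => //=.
    exact: leq_trans nk kl.
apply: cvgn_le cv _ => k.
rewrite bigcup_mkord (le_trans (pr_bigcup_fin Q _ _))//.
rewrite (@le_trans _ _ (\sum_(n < k) c * rho ^+ (M + n)))//.
  by apply: ler_sum => n _; exact: prA.
rewrite ler_pdivlMr ?subr_gt0//.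
have -> : (\sum_(n < k) c * rho ^+ (M + n)) * (1 - rho) = c * rho ^+ M * (1 - rho ^+ k).
  elim: k => [|k ih]; first by rewrite big_ord0 expr0 subrr mul0r mulr0.
  by rewrite big_ord_recr/= mulrDl ih exprD exprS; ring.
by rewrite ler_piMr ?mulr_ge0 ?exprn_ge0// lerBlDr lerDl exprn_ge0.
Qed.

Lemma pr_eventually_not : pr Q eventually_not = 1.
Proof.
have /andP[r0 r1] := rho01.
apply/eqP; rewrite eq_le pr_le1/=; last exact: measurable_eventually_not.
apply/ler_addgt0Pr => e e0.
have [|M HM] := @expr_small R (c / (1 - rho)) rho e rho01 _ e0.
  by rewrite divr_ge0// subr_ge0 ltW.
have {HM} := HM _ (leqnn M); rewrite mulrAC => HM.
have mU : measurable (\bigcup_n A (M + n)%N) by exact: bigcupT_measurable.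
rewrite -lerBlDr (@le_trans _ _ (pr Q (~` \bigcup_n A (M + n)%N)))//.
  by rewrite pr_setC// lerB// (le_trans (pr_tail M)).
apply: pr_le; first exact: measurableC.
  exact: measurable_eventually_not.
move=> w Aw; exists M => // n /= Mn An; apply: Aw; exists (n - M)%N => //.
by rewrite subnKC.
Qed.

End borel_cantelli.
(* A random infinite sequence of bits with prescribed probabilities [p] of its
   finite prefixes, by successive subdivision of [0, 1[; prefixes are written
   backwards, the newest bit first. *)
Section random_bits.
Context {R : realType}.
Variable p : seq bool -> R.
Hypothesis p_ge0 : forall e, 0 <= p e.
Hypothesis p_nil : p [::] = 1.
Hypothesis p_split : forall e, p (true :: e) + p (false :: e) = p e.

Notation RT := (measurableTypeR R).
Definition U01 : probability RT R := uniform_prob (@ltr01 R).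

(** Left endpoint of the interval of length [p e] attached to the prefix [e]; the part for [false]
    lies to the left of the part for [true]. *)
Fixpoint lo (e : seq bool) : R :=
  if e is b :: e' then (if b then lo e' + p (false :: e') else lo e') else 0.

Fixpoint digits (m : nat) (x : R) : seq bool :=
  if m is m'.+1 then
    let e := digits m' x in (lo e + p (false :: e) <= x) :: e
  else [::].

Lemma size_digits m x : size (digits m x) = m.
Proof. by elim: m => //= m ->. Qed.

Lemma digitsP m x : 0 <= x < 1 -> lo (digits m x) <= x < lo (digits m x) + p (digits m x).
Proof.
move=> x01; elim: m => [|m] /=; first by rewrite p_nil add0r.
set e := digits m x => /andP[lx xu]; have [h|h] /= := leP (lo e + p (false :: e)) x.
  by rewrite h/= -addrA (addrC (p (false :: e))) p_split.
by rewrite lx h.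
Qed.

Lemma digits_uniq m x e : 0 <= x < 1 -> size e = m -> lo e <= x < lo e + p e ->
  digits m x = e.
Proof.
move=> x01; elim: e m => [|b e ih] [|m]//= [sm] bx.
have [h1 h2] : lo e <= x < lo e + p e /\ b = (lo e + p (false :: e) <= x).
  have pf := p_ge0 (false :: e); have pt := p_ge0 (true :: e); have ps := p_split e.
  by move: bx; case: b; case: leP => h /andP[h1 h2]; split => //; lra.
by rewrite (ih m)// -h2.
Qed.

Lemma lo_ge0 e : 0 <= lo e.
Proof. by elim: e => //= -[] e ih; rewrite ?addr_ge0. Qed.

Lemma lo_le1 e : lo e + p e <= 1.
Proof.
elim: e => [|b e ih] /=; first by rewrite p_nil add0r.
have pf := p_ge0 (false :: e); have pt := p_ge0 (true :: e); have ps := p_split e.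
by case: b; lra.
Qed.

Lemma digits_set m e : size e = m ->
  [set x | digits m x = e] `&` `[0, 1[ = `[lo e, lo e + p e[%classic.
Proof.
move=> sm; apply/seteqP; split => x /=; rewrite !in_itv/=.
  by move=> [<- x01]; exact: digitsP.
move=> bx; have x01 : 0 <= x < 1.
  by have := lo_ge0 e; have := lo_le1 e; move: bx => /andP[]; lra.
by split => //; exact: digits_uniq.
Qed.

Lemma measurable_digits m e : measurable ([set x | digits m x = e] : set RT).
Proof.
elim: m e => [|m ih] [|b e] /=.
- by rewrite (_ : [set x | _] = setT)//; apply/seteqP.
- by rewrite (_ : [set x | _] = set0)//; apply/seteqP; split => // x.
- by rewrite (_ : [set x | _] = set0)//; apply/seteqP; split => // x.
have -> : [set x : R | (lo (digits m x) + p (false :: digits m x) <= x) :: digits m x = b :: e] =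
  [set x | digits m x = e] `&` (if b then `[lo e + p (false :: e), +oo[%classic
                                else `]-oo, lo e + p (false :: e)[%classic).
  apply/seteqP; split => x /=.
    move=> [<- <-]; split => //.
    by case: ifPn => /=; rewrite in_itv/= ?andbT// -ltNge.
  move=> [<-]; case: b; rewrite /= in_itv/= ?andbT => h; first by rewrite h.
  by rewrite leNgt h.
by apply: measurableI; [exact: ih|case: b; exact: measurable_itv].
Qed.

Lemma pr_digits m e : size e = m -> pr U01 [set x : RT | digits m x = e] = p e.
Proof.
move=> sm; have mD := measurable_digits m e; pose A : set RT := [set x | digits m x = e].
have -> : pr U01 A = fine (lebesgue_measure (A `&` `[0, 1])).
  rewrite /pr /U01/= /uniform_prob integral_uniform_pdf; congr fine.
  rewrite (eq_integral (cst 1%E)) ?integral_cst ?mul1e//; first exact: measurableI.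
  by move=> x; rewrite inE/= in_itv/= /uniform_pdf => -[_ ->]; rewrite subr0 invr1.
have muI : lebesgue_measure `[lo e, lo e + p e[%classic = (p e)%:E.
  rewrite lebesgue_measure_itv/= lte_fin ltrDl; case: ltP => h.
    by rewrite -EFinB addrAC subrr add0r.
  by congr EFin; apply/eqP; rewrite eq_le h p_ge0.
have AI : A `&` `[0, 1[ = `[lo e, lo e + p e[%classic by exact: digits_set.
suff -> : lebesgue_measure (A `&` `[0, 1]) = (p e)%:E by [].
apply/eqP; rewrite eq_le -muI -AI; apply/andP; split.
  (* The uniform law lives on the closed interval, the cells only fill [[0, 1[]; the missing point
     [1] is null. *)
  rewrite (@le_trans _ _ (lebesgue_measure ((A `&` `[0, 1[) `|` [set 1])))//.
    apply: le_measure; rewrite ?inE//; try exact: measurableI.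
    - by apply: measurableU => //; exact: measurableI.
    - move=> x [Ax] /=; rewrite in_itv/= => /andP[x0]; rewrite le_eqVlt => /predU1P[->|x1].
        by right.
      by left; split => //=; rewrite in_itv/= x0.
  rewrite (le_trans (measureU2 _ _ _))//; first exact: measurableI.
  rewrite -[leRHS]adde0 leeD// le_eqVlt; apply/orP; left; apply/eqP.
  exact: lebesgue_measure_set1.
apply: le_measure; rewrite ?inE//; try exact: measurableI.
by move=> x [Ax] /=; rewrite !in_itv/= => /andP[-> /ltW ->].
Qed.

Lemma Ex_digits m (phi : seq bool -> R) :
  brv (fun x : RT => phi (digits m x)) /\
  Ex U01 (fun x : RT => phi (digits m x)) = \sum_(t : m.-tuple bool) phi t * p t.
Proof.
have E x : phi (digits m x) =
    \sum_(t : m.-tuple bool) phi t * \1_[set x : RT | digits m x = t] x.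
  have ds : size (digits m x) == m by rewrite size_digits.
  rewrite (bigD1 (Tuple ds))//= indicE mem_set// mulr1 big1 ?addr0// => t tx.
  rewrite indicE memNset ?mulr0//= => dt; move/eqP: tx; apply.
  by apply/val_inj; rewrite /= dt.
have bI (t : m.-tuple bool) : brv (fun x : RT => phi t * \1_[set x : RT | digits m x = t] x).
  by apply/brvZ/brv_indic; exact: measurable_digits.
split; first by under eq_fun do rewrite E; apply: brv_sum.
under [in LHS]eq_fun do rewrite E.
rewrite Ex_sum//; apply: eq_bigr => t _.
rewrite ExZ ?Ex_indic ?pr_digits ?size_tuple//; first exact: measurable_digits.
by apply: brv_indic; exact: measurable_digits.
Qed.

End random_bits.

(** * Realization of the limit law *)

Section lipschitz_algebra.
Context {R : realType}.
Implicit Types (g : (nat -> R) -> R) (x y : nat -> R).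

Lemma sum_dist_mono m m' x y : (m <= m')%N ->
  \sum_(j < m) `|x j - y j| <= \sum_(j < m') `|x j - y j| :> R.
Proof.
move=> mm'; rewrite -!(big_mkord xpredT (fun j => `|x j - y j|)).
by rewrite [leRHS](big_cat_nat (leq0n m) mm')//= lerDl sumr_ge0.
Qed.

Lemma lipn_cst m (c : R) : lipn m 0 (fun=> c).
Proof. by split => // x y; rewrite subrr normr0 mul0r. Qed.

Lemma lipn_mul m m' K K' g g' (M M' : R) : lipn m K g -> (forall x, `|g x| <= M) ->
  lipn m' K' g' -> (forall x, `|g' x| <= M') ->
  lipn (maxn m m') (M * K' + M' * K) (fun x => g x * g' x).
Proof.
move=> [K0 lg] gM [K'0 lg'] gM'.
have M0 : 0 <= M := le_trans (normr_ge0 _) (gM (fun=> 0)).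
have M'0 : 0 <= M' := le_trans (normr_ge0 _) (gM' (fun=> 0)).
split => [|x y]; first by rewrite addr_ge0// mulr_ge0.
rewrite (_ : _ - _ = g x * (g' x - g' y) + g' y * (g x - g y)); last by ring.
rewrite (le_trans (ler_normD _ _))// !normrM mulrDl lerD// -mulrA ler_pM//.
- by rewrite (le_trans (lg' _ _))// ler_wpM2l// sum_dist_mono// leq_maxr.
- by rewrite (le_trans (lg _ _))// ler_wpM2l// sum_dist_mono// leq_maxl.
Qed.

Lemma lipn_coord k K (f : R -> R) : 0 <= K -> (forall a b, `|f a - f b| <= K * `|a - b|) ->
  lipn k.+1 K (fun x => f (x k)).
Proof.
move=> K0 lf; split => // x y; rewrite (le_trans (lf _ _))// ler_wpM2l//.
by rewrite big_ord_recr/= lerDr sumr_ge0.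
Qed.

Definition clamp01 (a : R) : R := if a <= 0 then 0 else if 1 <= a then 1 else a.

Lemma clamp01_bd a : 0 <= clamp01 a <= 1.
Proof. by rewrite /clamp01; case: (leP a 0) => h1; last case: (leP 1 a) => h2; lra. Qed.

Lemma clamp01_ge1 a : 1 <= a -> clamp01 a = 1.
Proof. by rewrite /clamp01 => a1; rewrite a1 leNgt (lt_le_trans ltr01 a1). Qed.

Lemma clamp01_le0 a : a <= 0 -> clamp01 a = 0.
Proof. by rewrite /clamp01 => ->. Qed.

Lemma clamp01_norm a : `|clamp01 a| <= 1.
Proof. by have := clamp01_bd a; rewrite ler_norml; lra. Qed.

Lemma clamp01_lip a b : `|clamp01 a - clamp01 b| <= `|a - b|.
Proof.
have := ler_norm (a - b); have := ler_norm (b - a); rewrite (distrC b) ler_norml /clamp01.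
by case: (leP a 0) => ?; last case: (leP 1 a) => ?; case: (leP b 0) => ?; try case: (leP 1 b) => ?; lra.
Qed.

Lemma clamp01_lipZ (c e : R) : 0 < e ->
  forall a b, `|clamp01 ((a - c) / e) - clamp01 ((b - c) / e)| <= e^-1 * `|a - b|.
Proof.
move=> e0 a b; rewrite (le_trans (clamp01_lip _ _))//.
rewrite (_ : _ - _ = e^-1 * (a - b)); last by ring.
by rewrite normrM gtr0_norm ?invr_gt0.
Qed.

End lipschitz_algebra.

Section limit_law.
Context {R : realType} {d0 : measure_display} {T : measurableType d0}.
Variables (P : probability T R) (V : nat -> T -> nat -> R).
Hypothesis bV : forall n j, brv (fun w => V n w j).
Hypothesis V2 : forall j, exists C : R, forall n, Ex P (fun w => V n w j ^+ 2) <= C.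
Hypothesis Vcvg : forall m K (g : (nat -> R) -> R) (M : R), lipn m K g ->
  (forall v, `|g v| <= M) -> exists l : R, (fun n => Ex P (fun w => g (V n w))) @ \oo --> l.
Hypothesis Vatom : forall j (c : R), c != 0 -> forall e : R, 0 < e ->
  exists2 eps : R, 0 < eps & exists N, forall n, (N <= n)%N ->
    pr P [set w | `|V n w j - c| <= eps] <= e.

(* The limit law may charge 0, since [V n w j] may be degenerate, but no other
   point; the dyadic thresholds used to extract bits are odd multiples of 2^-N and
   thus avoid 0. *)
Definition threshold (i : nat) : nat * R :=
  if unpickle i is Some (k, z, N) then (k, (z *+ 2 + 1)%:~R / 2 ^+ N) else (0%N, 1).

Lemma threshold_neq0 i : (threshold i).2 != 0.
Proof.
rewrite /threshold; case: unpickle => [[[k z] N]|] /=; last exact: oner_neq0.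
rewrite mulf_neq0 ?invr_neq0 ?expf_neq0// intr_eq0; lia.
Qed.

Fixpoint bits (m : nat) (v : nat -> R) : seq bool :=
  if m is m'.+1 then (v (threshold m').1 <= (threshold m').2) :: bits m' v else [::].

Lemma size_bits m v : size (bits m v) = m.
Proof. by elim: m => //= m ->. Qed.

Lemma bits_eq m u v i : bits m u = bits m v -> (i < m)%N ->
  (u (threshold i).1 <= (threshold i).2) = (v (threshold i).1 <= (threshold i).2).
Proof.
by elim: m => //= m ih [] h1 h2; rewrite ltnS leq_eqVlt => /predU1P[->//|]; exact: ih.
Qed.

Lemma bits_drop m m' v : (m <= m')%N -> drop (m' - m) (bits m' v) = bits m v.
Proof.
move=> /subnK e; rewrite -[in bits m' v]e.
by elim: (m' - m)%N => //=; rewrite drop0.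
Qed.

Lemma digits_drop p m m' (x : R) : (m <= m')%N ->
  drop (m' - m) (digits p m' x) = digits p m x.
Proof.
move=> /subnK e; rewrite -[in digits p m' x]e.
by elim: (m' - m)%N => //=; rewrite drop0.
Qed.

Lemma brv_bits m (phi : seq bool -> R) n : brv (fun w => phi (bits m (V n w))).
Proof.
elim: m phi => [|m ih] phi /=; first exact: brv_cst.
set k := (threshold m).1; set c := (threshold m).2.
have bB : brv (fun w => (V n w k <= c)%R%:R : R).
  rewrite (_ : (fun w => _) = \1_[set w | V n w k <= c]).
    by apply/brv_indic/measurable_le_cst; exact: brv_meas.
  apply/funext => w; rewrite indicE; case: leP => h; first by rewrite mem_set.
  by rewrite memNset//= => /le_lt_trans/(_ h); rewrite ltxx.
rewrite (_ : (fun w => _) = fun w => (V n w k <= c)%R%:R * phi (true :: bits m (V n w)) +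
    (1 - (V n w k <= c)%R%:R) * phi (false :: bits m (V n w))).
  apply: brvD; apply: brvM => //.
  - exact: (ih (fun e => phi (true :: e))).
  - by apply: brvB => //; exact: brv_cst.
  - exact: (ih (fun e => phi (false :: e))).
by apply/funext => w; case: (_ <= _); rewrite ?mul1r ?mul0r ?subrr ?subr0 ?mul0r ?addr0 ?add0r ?mul1r.
Qed.

(** The Lipschitz factor [g] carries the induction: the newest bit is replaced with a Lipschitz
    ramp, which is absorbed into [g]. The error lives where the field is within [eps] of the
    threshold, an unlikely event since the threshold is not [0]. *)
Lemma cvg_bits m (phi : seq bool -> R) (Mp : R) m' K g (M : R) :
  (forall e, `|phi e| <= Mp) -> lipn m' K g -> (forall v, `|g v| <= M) ->
  exists l : R, (fun n => Ex P (fun w => phi (bits m (V n w)) * g (V n w))) @ \oo --> l.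
Proof.
elim: m phi Mp m' K g M => [|m ih] phi Mp m' K g M phiM lg gM /=.
  have [l hl] := Vcvg lg gM; exists (phi [::] * l).
  apply: (cvgn_ext (u := fun n => phi [::] * Ex P (fun w => g (V n w)))).
    by move=> n; rewrite ExZ//; apply: (brv_lipn lg gM) => j _; exact: brv_meas.
  exact: cvgMr.
set k := (threshold m).1; set c := (threshold m).2.
have Mp0 : 0 <= Mp := le_trans (normr_ge0 _) (phiM [::]).
have M0 : 0 <= M := le_trans (normr_ge0 _) (gM (fun=> 0)).
have bg n : brv (fun w => g (V n w)).
  by apply: (brv_lipn lg gM) => j _; exact: brv_meas.
apply: cvgn_approx => e e0.
have e1 : 0 < e / (2 * (Mp * M) + 1) by rewrite divr_gt0// ltr_wpDl// !mulr_ge0.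
have [eps eps0 [N HN]] := Vatom k (threshold_neq0 m) e1.
pose ramp (v : nat -> R) := clamp01 ((v k - c) / eps).
have lr : lipn k.+1 eps^-1 ramp.
  by apply: lipn_coord (clamp01_lipZ c eps0); rewrite invr_ge0 ltW.
have lr' : lipn k.+1 eps^-1 (fun v => 1 - ramp v).
  case: lr => h1 h2; split => // x y.
  by rewrite opprB addrC addrA subrK distrC; exact: h2.
have rM v : `|ramp v| <= 1 by exact: clamp01_norm.
have r'M v : `|1 - ramp v| <= 1.
  by have := clamp01_bd ((v k - c) / eps); rewrite ler_norml /ramp; lra.
have br n : brv (fun w => ramp (V n w)).
  by apply: (brv_lipn lr rM) => j _; exact: brv_meas.
have gM' (r : (nat -> R) -> R) : (forall v, `|r v| <= 1) -> forall v, `|r v * g v| <= M.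
  by move=> r1 v; rewrite normrM (le_trans (ler_wpM2r _ (r1 v)))// mul1r.
have [l1 h1] := ih (fun e => phi (true :: e)) Mp _ _ _ _ (fun e => phiM (true :: e))
  (lipn_mul lr' r'M lg gM) (gM' _ r'M).
have [l0 h0] := ih (fun e => phi (false :: e)) Mp _ _ _ _ (fun e => phiM (false :: e))
  (lipn_mul lr rM lg gM) (gM' _ rM).
exists (fun n => Ex P (fun w => phi (true :: bits m (V n w)) * ((1 - ramp (V n w)) * g (V n w))) +
                 Ex P (fun w => phi (false :: bits m (V n w)) * (ramp (V n w) * g (V n w)))).
split; first by exists (l1 + l0); exact: cvgD.
have b1 n : brv (fun w => phi (true :: bits m (V n w)) * ((1 - ramp (V n w)) * g (V n w))).
  apply: brvM; first exact: (brv_bits m (fun e => phi (true :: e))).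
  by apply: brvM => //; apply: brvB => //; exact: brv_cst.
have b0 n : brv (fun w => phi (false :: bits m (V n w)) * (ramp (V n w) * g (V n w))).
  apply: brvM; first exact: (brv_bits m (fun e => phi (false :: e))).
  exact: brvM.
exists N => n Nn; rewrite -ExD//.
have mA : measurable [set w | `|V n w k - c| <= eps].
  by apply/measurable_le_cst/brv_meas/brv_abs/brvB => //; exact: brv_cst.
have phig (ee : seq bool) v : `|phi ee * g v| <= Mp * M by rewrite normrM ler_pM.
apply: (@le_trans _ _ (0 + 2 * (Mp * M) * pr P [set w | `|V n w k - c| <= eps])); last first.
  rewrite add0r (le_trans (ler_wpM2l _ (HN _ Nn))) ?mulr_ge0//.
  rewrite mulrCA ler_piMr ?(ltW e0)// ler_pdivrMr ?ltr_wpDl ?mulr_ge0//.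
  by rewrite mul1r lerDl.
apply: Ex_dist => //.
- by apply: brvM => //; exact: (brv_bits m.+1 phi).
- exact: brvD.
- move=> w; have /andP[r0 r1] := clamp01_bd ((V n w k - c) / eps).
  rewrite -/(ramp _) in r0 r1; have r1' : 0 <= 1 - ramp (V n w) by rewrite subr_ge0.
  rewrite (mulrCA _ (1 - _)) (mulrCA _ (ramp _)) (le_trans (ler_normD _ _))//.
  rewrite !(normrM (1 - _)) !(normrM (ramp _)) (ger0_norm r0) (ger0_norm r1').
  rewrite [leRHS](_ : _ = (1 - ramp (V n w)) * (Mp * M) + ramp (V n w) * (Mp * M)); last by ring.
  by rewrite lerD// ler_wpM2l// phig.
move=> w /= /negP; rewrite -ltNge => h.
have [vc|vc] := leP (V n w k) c.
  rewrite /ramp (_ : clamp01 _ = 0) ?subr0 ?mul1r ?mul0r ?mulr0 ?addr0 ?subrr ?normr0//.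
  by apply: clamp01_le0; rewrite pmulr_lle0 ?invr_gt0// subr_le0.
rewrite /ramp (_ : clamp01 _ = 1) ?subrr ?mul1r ?mul0r ?mulr0 ?add0r ?subrr ?normr0//.
have {}h : 1 <= (V n w k - c) / eps.
  by rewrite ler_pdivlMr// mul1r; move: h; rewrite gtr0_norm ?subr_gt0// => /ltW.
exact: clamp01_ge1.
Qed.

Definition cell (e : seq bool) (v : nat -> R) : R := (bits (size e) v == e)%:R.
(** These limits are nonnegative and consistent, so they can be fed to [digits]; the digits of a
    uniform variable then have the limit law of the bits. *)
Definition cellp (e : seq bool) : R := limn (fun n => Ex P (fun w => cell e (V n w))).

Lemma cell_bd e v : 0 <= cell e v <= 1.
Proof. by rewrite /cell; case: (_ == _); rewrite ?lexx ler01. Qed.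

Lemma brv_cell e n : brv (fun w => cell e (V n w)).
Proof. exact: (brv_bits (size e) (fun f => (f == e)%:R)). Qed.

Lemma cellp_cvg e : (fun n => Ex P (fun w => cell e (V n w))) @ \oo --> cellp e.
Proof.
suff [l hl] : exists l : R, (fun n => Ex P (fun w => cell e (V n w))) @ \oo --> l.
  by rewrite /cellp (cvg_lim _ hl).
have b1 (f : seq bool) : `|(f == e)%:R| <= 1 :> R by case: (_ == _); rewrite ?normr1 ?normr0.
have [|l hl] := @cvg_bits (size e) _ _ 0%N 0 (fun=> 1) 1 b1 (lipn_cst 0 1).
  by move=> v; rewrite normr1.
exists l; apply: cvgn_ext hl => n; congr Ex; apply/funext => w.
by rewrite mulr1.
Qed.

Arguments cellp_cvg : clear implicits.

Lemma cellp_ge0 e : 0 <= cellp e.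
Proof.
apply: cvgn_ge (cellp_cvg e) _ => n; apply: Ex_ge0 => w.
by have /andP[] := cell_bd e (V n w).
Qed.

Lemma cellp_nil : cellp [::] = 1.
Proof.
apply: cvgn_uniq (cellp_cvg [::]) _.
apply: (cvgn_ext (u := fun=> 1)); last exact: cvg_cst.
by move=> n; rewrite -[LHS](Ex_cst P).
Qed.

Lemma cellp_split e : cellp (true :: e) + cellp (false :: e) = cellp e.
Proof.
apply: cvgn_uniq (cellp_cvg e).
apply: cvgn_ext (cvgD (cellp_cvg (true :: e)) (cellp_cvg (false :: e))) => n /=.
transitivity (Ex P (fun w => cell (true :: e) (V n w)) + Ex P (fun w => cell (false :: e) (V n w))) => //.
rewrite -ExD; [|exact: brv_cell|exact: brv_cell]; congr Ex; apply/funext => w.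
rewrite /cell /= !eqseq_cons; case: (_ <= _) => /=; rewrite ?addr0 ?add0r//.
Qed.

Notation RT := (measurableTypeR R).
Notation Q := (@U01 R).
Notation dig := (digits cellp).

Lemma cvg_digits m (phi : seq bool -> R) :
  (fun n => Ex P (fun w => phi (bits m (V n w)))) @ \oo --> Ex Q (fun x => phi (dig m x)).
Proof.
have [_ ->] := Ex_digits cellp_ge0 cellp_nil cellp_split m phi.
have E v : phi (bits m v) = \sum_(t : m.-tuple bool) phi t * cell t v.
  have ds : size (bits m v) == m by rewrite size_bits.
  rewrite (bigD1 (Tuple ds))//= /cell size_bits eqxx mulr1 big1 ?addr0// => t tx.
  rewrite size_tuple; case: eqP => [h|]; rewrite ?mulr0//.
  by move/eqP: tx; case; apply/val_inj; rewrite /= h.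
apply: (cvgn_ext (u := fun n => \sum_(t : m.-tuple bool) phi t * Ex P (fun w => cell t (V n w)))).
  move=> n; under [in RHS]eq_fun do rewrite E.
  rewrite Ex_sum; last by move=> t _; apply/brvZ/brv_cell.
  by apply: eq_bigr => t _; rewrite ExZ//; exact: brv_cell.
by apply: cvgn_sum => t _; apply: cvgMr; exact: cellp_cvg.
Qed.

Lemma brv_digits m (phi : seq bool -> R) : brv (fun x : RT => phi (dig m x)).
Proof. by have [] := Ex_digits cellp_ge0 cellp_nil cellp_split m phi. Qed.

(** Some sequence with the given bits, and the zero sequence if the bits contradict each other. It
    is arbitrary within its cell, so that coordinates are recovered only up to the error of
    [bits_close]. *)
Definition rep (m : nat) (e : seq bool) : nat -> R :=
  xget (fun=> 0) [set v | bits m v = e].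

Lemma bits_rep m v : bits m (rep m (bits m v)) = bits m v.
Proof. by rewrite /rep; case: xgetP => [u _ //|/(_ v)]; case. Qed.

(** The thresholds [(2 z + 1) / 2^(N + 2)] with [|z| <= zbound N] cover [[- 2^N, 2^N]] with room to
    spare. *)
Definition zbound N : nat := (2 ^ (2 * N + 4))%N.

Definition zcode (M k i : nat) : nat := pickle (k, i%:Z - (zbound M)%:Z, M.+2).

Definition zcodes (M : nat) : nat :=
  (\sum_(k < M.+1) \sum_(i < (2 * zbound M).+1) (zcode M k i).+1)%N.

(** A number of bits that reaches every threshold wanted at precision [N], the sum of all codes
    being a crude upper bound for each. Summing over [M <= N] makes it monotone, so that coarser bit
    lists are suffixes of finer ones. *)
Definition precision (N : nat) : nat := (\sum_(M < N.+1) zcodes M)%N.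

Lemma precision_mono N N' : (N <= N')%N -> (precision N <= precision N')%N.
Proof.
move=> NN'; rewrite /precision -!(big_mkord xpredT zcodes).
by rewrite [leqRHS](@big_cat_nat _ _ _ N.+1)//= leq_addr.
Qed.

Lemma precisionP N (k : nat) (z : int) : (k <= N)%N -> (`|z| <= zbound N)%N ->
  (pickle (k, z, N.+2) < precision N)%N.
Proof.
move=> kN zN; rewrite /precision (bigD1 (Ordinal (ltnSn N)))//=.
rewrite {1}/zcodes (bigD1 (Ordinal (kN : k < N.+1)%N))//=.
have iN : (`|(z + (zbound N)%:Z)%R| < (2 * zbound N).+1)%N by lia.
rewrite (bigD1 (Ordinal iN))//= {1}/zcode (_ : _ - _ = z); last by lia.
by do 3 apply: ltn_addr.
Qed.

Lemma bits_close N k u v : (k <= N)%N -> bits (precision N) u = bits (precision N) v ->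
  `|v k| <= 2 ^+ N -> `|u k - v k| <= (2 ^+ N)^-1.
Proof.
move=> kN uv vN; set s : R := 2 ^+ N.+2.
have s0 : 0 < s by rewrite exprn_gt0.
have sE : (2 ^+ N)^-1 = 4 / s :> R.
  by rewrite /s 2!exprS; field; rewrite expf_neq0.
have thrE z : (`|z| <= zbound N)%N ->
    (u k <= (z *+ 2 + 1)%:~R / s) = (v k <= (z *+ 2 + 1)%:~R / s).
  move=> /(precisionP kN)/(bits_eq uv).
  by rewrite /threshold pickleK.
clear uv.
have vs : `|v k * s| <= 2 ^+ (2 * N + 2).
  rewrite normrM (gtr0_norm s0) /s (_ : (2 * N + 2 = N + N.+2)%N); last by lia.
  by rewrite exprD ler_pM2r ?exprn_gt0.
have floorE (x : R) : `|x| <= 2 ^+ (2 * N + 2) -> forall y : R, `|y - x / 2| <= 2 ->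
    (`|Num.floor y| <= zbound N)%N.
  move=> x1 y xy; rewrite -(ler_nat R) natr_absz intr_norm.
  have f1 := ge_floor y; have f2 := floorD1_gt y; rewrite intrD1 in f2.
  rewrite /zbound natrX (_ : (2 * N + 4 = (2 * N + 2) + 2)%N); last by lia.
  rewrite exprD; have : 1 <= 2 ^+ (2 * N + 2) :> R by rewrite exprn_ege1// ler1n.
  move: x1 xy; rewrite !ler_norml; set t := 2 ^+ _; rewrite (_ : 2 ^+ 2 = 4); last by ring.
  by lra.
have zE z : (z *+ 2 + 1)%:~R = 2 * z%:~R + 1 :> R by rewrite mulr2n !intrD; ring.
rewrite sE leNgt; apply/negP => h.
have [uv1|vu1] := leP (u k) (v k).
  (* The threshold [(2 z + 1) / s] lies in []v k - 4 / s, v k - 2 / s]], hence separates [u k] from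
     [v k]. *)
  pose z := Num.floor ((v k * s) / 2 - 3 / 2).
  have zN : (`|z| <= zbound N)%N.
    by apply: (floorE _ vs); rewrite addrAC subrr add0r normrN ger0_norm; lra.
  have := thrE _ zN; rewrite !ler_pdivlMr// zE.
  have f1 := ge_floor ((v k * s) / 2 - 3 / 2); have f2 := floorD1_gt ((v k * s) / 2 - 3 / 2).
  rewrite intrD1 -/z in f1 f2.
  move: h; rewrite ler0_norm ?subr_le0// opprB ltr_pdivrMr// => h.
  by case: (leP (u k * s)) => h1; case: (leP (v k * s)) => h2 //; move=> _; lra.
(* Here [(2 z + 1) / s] lies in []v k, v k + 2 / s]]. *)
pose z := Num.floor ((v k * s) / 2 + 1 / 2).
have zN : (`|z| <= zbound N)%N.
  by apply: (floorE _ vs); rewrite addrAC subrr add0r ger0_norm; lra.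
have := thrE _ zN; rewrite !ler_pdivlMr// zE.
have f1 := ge_floor ((v k * s) / 2 + 1 / 2); have f2 := floorD1_gt ((v k * s) / 2 + 1 / 2).
rewrite intrD1 -/z in f1 f2.
move: h; rewrite gtr0_norm ?subr_gt0// ltr_pdivrMr// => h.
by case: (leP (u k * s)) => h1; case: (leP (v k * s)) => h2 //; move=> _; lra.
Qed.

Arguments cvg_digits : clear implicits.

Lemma measurable_digits_set m (S : set (seq bool)) :
  measurable ([set x | S (dig m x)] : set RT).
Proof.
have [mf _] := brv_digits m (fun e => \1_S e).
have := measurable_gt_cst 2^-1 mf; congr measurable; apply/seteqP; split => x /=.
  rewrite indicE; have [|_] := boolP (_ \in S); first by rewrite inE.
  by rewrite ltNge invr_ge0 ler0n.
by move=> Sx; rewrite indicE mem_set// invf_lt1 ?ltr1n.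
Qed.

Definition apx (N : nat) (x : RT) : nat -> R := rep (precision N) (dig (precision N) x).

Lemma rep_bits_close N k v : (k <= N)%N -> `|v k| <= 2 ^+ N ->
  `|rep (precision N) (bits (precision N) v) k - v k| <= (2 ^+ N)^-1.
Proof. by move=> kN; apply: bits_close => //; exact: bits_rep. Qed.

Lemma pr_large k : exists2 C : R, 0 <= C & forall n N,
  pr P [set w | 2 ^+ N < `|V n w k|] <= C * 4^-1 ^+ N.
Proof.
have [C HC] := V2 k; exists `|C| => // n N.
rewrite exprVn ler_pdivlMr ?exprn_gt0// mulrC (le_trans _ (ler_norm C))//.
rewrite (le_trans _ (HC n))//; apply: pr_markov.
- by apply/measurable_gt_cst/brv_meas/brv_abs.
- exact: brvX.
- by move=> w; exact: sqr_ge0.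
move=> w /= h; rewrite -[leRHS]real_normK ?num_real// (_ : 4 ^+ N = (2 ^+ N) ^+ 2).
  by rewrite ler_sqr ?nnegrE ?exprn_ge0// ltW.
by rewrite -exprM mulnC exprM (_ : 2 ^+ 2 = 4)//; ring.
Qed.

Definition jump k N : set RT := [set x | 2 * (2 ^+ N)^-1 < `|apx N.+1 x k - apx N x k|].

Lemma measurable_jump k N : measurable (jump k N).
Proof.
have := measurable_digits_set (precision N.+1) [set e | 2 * (2 ^+ N)^-1 <
  `|rep (precision N.+1) e k -
    rep (precision N) (drop (precision N.+1 - precision N) e) k|].
by congr measurable; apply/seteqP; split => x /=; rewrite /jump/= /apx digits_drop ?precision_mono.
Qed.

(** The event depends on finitely many bits, so its probability is a limit of probabilities under
    [P]. There both representatives are close to [V n w k], unless the latter exceeds [2^N] in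
    absolute value. *)
Lemma pr_jump k : exists2 C : R, 0 <= C & forall N, (k <= N)%N ->
  pr Q (jump k N) <= C * 4^-1 ^+ N.
Proof.
have [C C0 HC] := pr_large k; exists C => // N kN.
pose S := [set e | 2 * (2 ^+ N)^-1 <
  `|rep (precision N.+1) e k -
    rep (precision N) (drop (precision N.+1 - precision N) e) k|].
have -> : jump k N = [set x : RT | S (dig (precision N.+1) x)].
  by apply/seteqP; split => x /=; rewrite /jump/S/= /apx digits_drop ?precision_mono.
rewrite -Ex_indic; last exact: measurable_digits_set.
apply: cvgn_le (cvg_digits (precision N.+1) (fun e => \1_S e)) _ => n.
rewrite (le_trans _ (HC n N))// -Ex_indic; last by apply/measurable_gt_cst/brv_meas/brv_abs.
apply: Ex_le.
- exact: brv_bits.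
- by apply/brv_indic/measurable_gt_cst/brv_meas/brv_abs.
move=> w; rewrite !indicE; have [|_] := boolP (_ \in S); last by rewrite ler0n.
rewrite inE /S/= bits_drop ?precision_mono// => h.
have [|vN] := boolP (w \in _); first by rewrite lexx.
have {}vN : `|V n w k| <= 2 ^+ N by rewrite leNgt; apply/negP => h'; rewrite mem_set in vN.
have h1 := rep_bits_close kN vN.
have h2 : `|rep (precision N.+1) (bits (precision N.+1) (V n w)) k - V n w k| <= (2 ^+ N.+1)^-1.
  apply: rep_bits_close; first exact: leqW.
  by rewrite (le_trans vN)// ler_eXn2l ?ltr1n.
have h3 : (2 ^+ N.+1)^-1 <= (2 ^+ N)^-1 :> R.
  by rewrite lef_pV2 ?posrE ?exprn_gt0// ler_eXn2l ?ltr1n.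
by exfalso; move: h; apply/negP; rewrite -leNgt; move: h1 h2; rewrite !ler_norml; lra.
Qed.

Definition settled k : set RT := eventually_not (fun N => jump k (k + N)).

Lemma measurable_settled k : measurable (settled k).
Proof. by apply: measurable_eventually_not => N; exact: measurable_jump. Qed.

Lemma pr_settled k : pr Q (settled k) = 1.
Proof.
have [C C0 HC] := pr_jump k.
apply: (@pr_eventually_not _ _ _ _ _ C 4^-1) => //.
- by move=> N; exact: measurable_jump.
- by rewrite invr_ge0 ler0n invf_lt1 ?ltr1n.
move=> N; rewrite (le_trans (HC _ (leq_addr _ _)))// ler_wpM2l// exprD ler_piMl ?exprn_ge0 ?invr_ge0//.
by rewrite exprn_ile1 ?invr_ge0// invf_le1 ?ler1n.
Qed.

Lemma settled_cvg k x : settled k x -> exists l : R, (fun N => apx N x k) @ \oo --> l.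
Proof.
move=> [M _ HM].
have step N : (k + M <= N)%N -> `|apx N.+1 x k - apx N x k| <= 2 * (2 ^+ N)^-1.
  move=> kMN; rewrite leNgt; apply/negP => h; apply: (HM (N - k)%N) => /=; first by lia.
  by rewrite /jump/= subnKC//; lia.
apply: cauchy_cvgn => e e0.
have [N0 HN0] := inv2X_small (divr_gt0 e0 (ltr0Sn R 7)).
have tail N a : (k + M <= N)%N -> `|apx (N + a) x k - apx N x k| <= 4 * (2 ^+ N)^-1 - 4 * (2 ^+ (N + a))^-1.
  move=> kMN; elim: a => [|a ih]; first by rewrite addn0 !subrr normr0.
  have := step (N + a)%N (leq_trans kMN (leq_addr _ _)); rewrite addnS.
  have -> : (2 ^+ (N + a).+1)^-1 = 2^-1 * (2 ^+ (N + a))^-1 :> R by rewrite exprS invfM.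
  move: ih; rewrite !ler_norml; lra.
have dist n : (k + M + N0 <= n)%N -> `|apx n x k - apx (k + M + N0) x k| <= e / 2.
  move=> hn; have := tail (k + M + N0)%N (n - (k + M + N0))%N (leq_addr _ _).
  rewrite subnKC//; have := HN0 _ (leq_addl (k + M) N0).
  have : 0 <= (2 ^+ n)^-1 :> R by rewrite invr_ge0 exprn_ge0.
  lra.
exists (k + M + N0)%N => n m /dist hn /dist hm.
by move: hn hm; rewrite !ler_norml; lra.
Qed.

Definition limit_rv (x : RT) (k : nat) : R :=
  if x \in settled k then limn (fun N => apx N x k) else 0.

(** Putting both the approximations and their limit to [0] off a null event makes the convergence
    hold at every point, as [measurable_fun_cvg] and [Ex_dct] require. *)
Definition apx' N (x : RT) k : R := if x \in settled k then apx N x k else 0.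

Lemma apx'_cvg x k : (fun N => apx' N x k) @ \oo --> limit_rv x k.
Proof.
rewrite /apx' /limit_rv; case: ifPn => [|_]; last exact: cvg_cst.
by rewrite inE => /settled_cvg[l hl]; rewrite (cvg_lim _ hl).
Qed.

Lemma measurable_apx N k : measurable_fun [set: RT] (fun x => apx N x k).
Proof.
by have [] := brv_digits (precision N) (fun e => rep (precision N) e k).
Qed.

Lemma measurable_apx' N k : measurable_fun [set: RT] (fun x => apx' N x k).
Proof.
rewrite (_ : (fun x => _) = fun x => \1_(settled k) x * apx N x k).
  by apply: measurable_funM (measurable_apx N k); apply: measurable_indic; exact: measurable_settled.
by apply/funext => x; rewrite /apx' indicE; case: (_ \in _); rewrite ?mul1r ?mul0r.
Qed.

Lemma measurable_limit_rv k : measurable_fun [set: RT] (fun x => limit_rv x k).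
Proof.
apply: (@measurable_fun_cvg _ _ _ _ (fun N x => apx' N x k)) => [N|x _].
  exact: measurable_apx'.
exact: apx'_cvg.
Qed.

Theorem cvg_limit_rv m K (g : (nat -> R) -> R) (M : R) : lipn m K g ->
  (forall v, `|g v| <= M) ->
  (fun n => Ex P (fun w => g (V n w))) @ \oo --> Ex Q (fun x => g (limit_rv x)).
Proof.
move=> lg gM; have [l hl] := Vcvg lg gM.
have [K0 _] := lg; have M0 : 0 <= M := le_trans (normr_ge0 _) (gM (fun=> 0)).
suff <- : l = Ex Q (fun x => g (limit_rv x)) by [].
have bgV n : brv (fun w => g (V n w)).
  by apply: (brv_lipn lg gM) => j _; exact: brv_meas.
have hQ : (fun N => Ex Q (fun x => g (apx' N x))) @ \oo --> Ex Q (fun x => g (limit_rv x)).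
  apply: (proj2 (@Ex_dct _ _ _ Q (fun N x => g (apx' N x)) _ M _ _ _)) => //.
  - by move=> N; apply: (lipn_meas lg) => j _; exact: measurable_apx'.
  - by move=> x; apply: (lipn_cvg lg) => j _; exact: apx'_cvg.
have {}hQ : (fun N => Ex Q (fun x => g (apx N x))) @ \oo --> Ex Q (fun x => g (limit_rv x)).
  apply: cvgn_ext hQ => N; apply/eqP; rewrite -subr_eq0 -normr_le0.
  have mD : measurable (\bigcup_(k < m) ~` settled k).
    by apply: bigcup_measurable => k _; apply: measurableC; exact: measurable_settled.
  have D0 : pr Q (\bigcup_(k < m) ~` settled k) = 0.
    apply/eqP; rewrite eq_le pr_ge0 andbT bigcup_mkord (le_trans (pr_bigcup_fin Q _ _))//.
      by move=> k _; apply: measurableC; exact: measurable_settled.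
    rewrite big1// => k _; rewrite pr_setC ?pr_settled ?subrr//.
    exact: measurable_settled.
  rewrite (le_trans (@Ex_dist _ _ _ Q _ _ _ 0 M mD _ _ _ _ _ _)) ?D0 ?mulr0 ?addr0//.
  - by apply: (brv_lipn lg gM) => j _; exact: measurable_apx'.
  - by apply: (brv_lipn lg gM) => j _; exact: measurable_apx.
  move=> x Dx; rewrite (lipn_ext (y := apx N x) lg) ?subrr ?normr0// => k km.
  rewrite /apx' mem_set//; apply: contrapT => sx; apply: Dx.
  by exists k.
have hC k : exists c : R, 0 <= c /\
    forall n N, pr P [set w | 2 ^+ N < `|V n w k|] <= c * 4^-1 ^+ N.
  by have [c ? ?] := pr_large k; exists c.
have [C HC] := choice hC.
pose S := \sum_(k < m) C k.
have S0 : 0 <= S by apply: sumr_ge0 => k _; exact: (HC k).1.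
(* At fixed [N] the bits converge in law, and replacing [V n] with the representative of its bits
   costs an error that is uniform in [n]; this exchanges the two limits. *)
have bound N : (m <= N)%N ->
    `|Ex Q (fun x => g (apx N x)) - l| <= (K * m%:R + 2 * M * S) * 2^-1 ^+ N.
  move=> mN.
  have h := @cvg_digits (precision N) (fun e => g (rep (precision N) e)).
  apply: (@cvgn_le R (fun n => `|Ex P (fun w => g (rep (precision N) (bits (precision N) (V n w)))) -
     Ex P (fun w => g (V n w))|)); first by apply: cvg_norm; exact: cvgB.
  move=> n; pose A := \bigcup_(k < m) [set w | 2 ^+ N < `|V n w k|].
  have mB k : measurable [set w | 2 ^+ N < `|V n w k|].
    by apply/measurable_gt_cst/brv_meas/brv_abs.
  have mA : measurable A by apply: bigcup_measurable.
  have prA : pr P A <= S * 2^-1 ^+ N.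
    rewrite /A bigcup_mkord (le_trans (pr_bigcup_fin P _ _))// mulr_suml ler_sum// => k _.
    have [Ck0 HCk] := HC k.
    rewrite (le_trans (HCk _ _))// ler_wpM2l// lerXn2r ?nnegrE ?invr_ge0//.
    by rewrite lef_pV2 ?posrE// ler_nat.
  rewrite (@le_trans _ _ (K * m%:R * (2 ^+ N)^-1 + 2 * M * pr P A))//; last first.
    by rewrite (mulrDl (K * m%:R)) -(exprVn 2 N) lerD2l -[leRHS]mulrA ler_wpM2l ?mulr_ge0.
  apply: Ex_dist => //.
  - by rewrite !mulr_ge0// invr_ge0 exprn_ge0.
  - exact: (brv_bits (precision N) (fun e => g (rep (precision N) e))).
  move=> w Aw; apply: (lipn_unif lg) => k km; apply: rep_bits_close.
    by rewrite ltnW// (leq_trans km).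
  by rewrite leNgt; apply/negP => h'; apply: Aw; exists k.
apply: cvgn_uniq hQ; apply/cvgnP => e e0.
have r2 : 0 <= (2^-1 : R) < 1 by rewrite invr_ge0 ler0n invf_lt1 ?ltr1n.
have [|N HN] := expr_small r2 (_ : 0 <= K * m%:R + 2 * M * S) e0.
  by rewrite addr_ge0 ?mulr_ge0.
exists (maxn m N) => n; rewrite geq_max => /andP[mn Nn].
exact: le_trans (bound _ mn) (HN _ Nn).
Qed.

End limit_law.

(** * Gaussian laws *)

Section gaussian_integrals.
Context {R : realType}.
Notation mu := (@lebesgue_measure R).
Implicit Types (f g : R -> R) (s : R).

Definition gI s f : R := fine (\int[mu]_x (f x * normal_pdf 0 s x)%:E)%E.

Lemma gI_integrable s f (M : R) : measurable_fun [set: R] f -> (forall x, `|f x| <= M) ->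
  mu.-integrable [set: R] (fun x => (f x * normal_pdf 0 s x)%:E).
Proof.
move=> mf fM; have M0 : 0 <= M := le_trans (normr_ge0 _) (fM 0).
apply: (@le_integrable _ _ _ mu [set: R] measurableT _ (fun x => M%:E * (normal_pdf 0 s x)%:E)%E).
- apply/measurable_EFinP; apply: measurable_funM => //; exact: measurable_normal_pdf.
- move=> x _ /=; rewrite lee_fin !normrM ler_wpM2r// (le_trans (fM x))// ler_norm//.
by apply: integrableZl => //; exact: integrable_normal_pdf.
Qed.

Lemma EFin_gI s f (M : R) : measurable_fun [set: R] f -> (forall x, `|f x| <= M) ->
  (gI s f)%:E = (\int[mu]_x (f x * normal_pdf 0 s x)%:E)%E.
Proof.
move=> mf fM; rewrite /gI fineK//.
by apply: integrable_fin_num => //; exact: gI_integrable fM.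
Qed.

Lemma gI_cst s (c : R) : gI s (fun=> c) = c.
Proof.
rewrite /gI; under eq_integral do rewrite EFinM.
rewrite integralZl//; last exact: integrable_normal_pdf.
by rewrite integral_normal_pdf mule1.
Qed.

Lemma gI_D s f g (M N : R) : measurable_fun [set: R] f -> (forall x, `|f x| <= M) ->
  measurable_fun [set: R] g -> (forall x, `|g x| <= N) ->
  gI s (fun x => f x + g x) = gI s f + gI s g.
Proof.
move=> mf fM mg gN; apply: EFin_inj.
rewrite EFinD (EFin_gI s mf fM) (EFin_gI s mg gN) (@EFin_gI _ _ (M + N)).
- rewrite -integralD//; [|exact: gI_integrable fM|exact: gI_integrable gN].
  by apply: eq_integral => x _; rewrite mulrDl EFinD.
- exact: measurable_funD.
- by move=> x; rewrite (le_trans (ler_normD _ _))// lerD.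
Qed.

Lemma gI_dct s (f_ : nat -> R -> R) f (M : R) :
  (forall n, measurable_fun [set: R] (f_ n)) -> (forall n x, `|f_ n x| <= M) ->
  (forall x, (fun n => f_ n x) @ \oo --> f x) ->
  (fun n => gI s (f_ n)) @ \oo --> gI s f.
Proof.
move=> mf fM ff.
have mf' : measurable_fun [set: R] f.
  by apply: (@measurable_fun_cvg _ _ _ _ f_) => // x _; exact: ff.
have f'M x : `|f x| <= M.
  by apply: (@cvgn_le R (fun n => `|f_ n x|)) => [|n //]; apply: cvg_norm; exact: ff.
apply: fine_cvg; rewrite -/(gI s f) (EFin_gI s mf' f'M).
apply: (@dominated_cvg _ _ _ mu setT measurableT _ _ (fun x => M%:E * (normal_pdf 0 s x)%:E)%E).
- move=> n; apply/measurable_EFinP; apply: measurable_funM => //.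
  exact: mf.
  exact: measurable_normal_pdf.
- by move=> x _; apply: cvg_EFin; [exact: nearW|apply: cvgMl; exact: ff].
- by [].
- by apply: integrableZl => //; exact: integrable_normal_pdf.
- move=> n x _; rewrite /= lee_fin normrM (ger0_norm (normal_pdf_ge0 _ _ _)).
  by rewrite ler_wpM2r// normal_pdf_ge0.
Qed.

Lemma gI_itv s f (a b : R) : s != 0 -> a <= b -> measurable_fun [set: R] f ->
  (forall x, 0 <= f x <= 1) -> (forall x, ~~ (a <= x <= b) -> f x = 0) ->
  gI s f <= normal_peak s * (b - a).
Proof.
move=> s0 ab mf f01 f0.
have fM x : `|f x| <= 1 by have := f01 x; rewrite ler_norml; lra.
rewrite -lee_fin (EFin_gI s mf fM).
rewrite (@le_trans _ _ (\int[mu]_(x in `[a, b]) (normal_peak s)%:E)%E)//; last first.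
  rewrite integral_cst//= lebesgue_measure_itv/= lte_fin; case: ltP => h.
    by rewrite -EFinB -EFinM.
  by rewrite mule0 lee_fin mulr_ge0 ?normal_peak_ge0// subr_ge0.
rewrite [leRHS]integral_mkcond; apply: ge0_le_integral => //.
- by move=> x _; rewrite lee_fin mulr_ge0 ?normal_pdf_ge0//; have /andP[] := f01 x.
- by apply/measurable_EFinP; apply: measurable_funM => //; exact: measurable_normal_pdf.
- by apply/(measurable_restrictT _ _).1.
move=> x _; rewrite patchE; case: ifPn => [_|].
  have /andP[h0 h1] := f01 x; rewrite lee_fin -[leRHS]mul1r ler_pM ?normal_pdf_ge0//.
  exact: normal_pdf_ub.
rewrite notin_setE/= in_itv/= => /negP h; rewrite f0 ?mul0r//.
Qed.

Lemma continuous_measR f : continuous f -> measurable_fun [set: R] f.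
Proof. exact: continuous_measurable_fun. Qed.

Lemma gI_scale s f (M : R) : 0 < s -> continuous f -> (forall x, `|f x| <= M) ->
  gI s f = gI 1 (fun z => f (s * z)).
Proof.
move=> s0 cf fM.
have cs : continuous (fun z : R => f (s * z)).
  by move=> z; apply: (@continuous_comp _ _ _ (fun z => s * z) f); [exact: mulrl_continuous|exact: cf].
(* The substitution formula is for nonnegative functions; a bounded [f] is reduced to one by adding
   [M]. *)
suff H (g : R -> R) : continuous g -> (forall x, 0 <= g x) ->
    (\int[mu]_x (g x * normal_pdf 0 s x)%:E = \int[mu]_x (g (s * x) * normal_pdf 0 1 x)%:E)%E.
  have mfR := continuous_measR cf; have mcs := continuous_measR cs.
  have cM (h : R -> R) : continuous h -> continuous (fun x => h x + M).
    by move=> ch x; apply: cvgD; [exact: ch|exact: cvg_cst].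
  have e : gI s (fun x => f x + M) = gI 1 (fun x => f (s * x) + M).
    rewrite /gI; congr fine; apply: (H (fun x => f x + M)); first exact: cM.
    by move=> x; have := fM x; rewrite ler_norml; lra.
  have cstM (x : R) : `|M| <= `|M| by [].
  have e1 := gI_D s mfR fM (measurable_cst M) cstM.
  have e2 := gI_D 1 mcs (fun x => fM (s * x)) (measurable_cst M) cstM.
  by move: e; rewrite e1 e2 (gI_cst s M) (gI_cst 1 M) => /addIr.
move=> cg g0; pose G x := g x * normal_pdf 0 s x.
have s0' : s != 0 by rewrite gt_eqF.
have dF : (fun z : R => s * z)^`()%classic = cst s.
  apply/funext => x; rewrite derive1E deriveM// derive_cst derive_id scaler0 addr0.
  by rewrite /GRing.scale/= mulr1.
have cG : continuous G.
  by move=> x; apply: cvgM; [exact: cg|exact: continuous_normal_pdf].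
rewrite (@increasing_ge0_integration_by_substitutionT _ (fun z => s * z) G) //.
- apply: eq_integral => x _; rewrite dF /G /= !fctE/= -mulrA; congr (_ * _)%:E.
  rewrite !normal_pdfE ?oner_neq0//.
  have -> : normal_fun 0 s (s * x) = normal_fun 0 1 x.
    rewrite /normal_fun !subr0 expr1n; congr expR.
    by rewrite exprMn -mulr_natr; field; rewrite s0'.
  rewrite mulrAC; congr (_ * _); rewrite /normal_peak expr1n mul1r -mulrnAr.
  rewrite sqrtrM ?sqr_ge0// sqrtr_sqr gtr0_norm// invfM mulrAC mulVf// mul1r//.
- by move=> x y xy; rewrite ltr_pM2l.
- by rewrite dF => ?; exact: cvg_cst.
- by rewrite dF; exact: is_cvg_cst.
- by rewrite dF; exact: is_cvg_cst.
- by apply: (gt0_cvgMrNy s0); exact: cvg_id.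
- by apply: (gt0_cvgMry s0); exact: cvg_id.
- by move=> x; rewrite mulr_ge0 ?normal_pdf_ge0.
Qed.

Definition gE (v : R) f : R := fine (gauss_expect v f).

(** One formula for [v = 0] and [v > 0], in which the dependence on [v] is visibly continuous. *)
Lemma gE_gI v f (M : R) : 0 <= v -> continuous f -> (forall x, `|f x| <= M) ->
  gE v f = gI 1 (fun z => f (Num.sqrt v * z)).
Proof.
move=> v0 cf fM; rewrite /gE /gauss_expect; have [->|vn0] := eqVneq v 0.
  by rewrite sqrtr0 /=; under eq_fun do rewrite mul0r; rewrite gI_cst.
by apply: gI_scale cf fM; rewrite sqrtr_gt0 lt_neqAle eq_sym vn0.
Qed.

Lemma EFin_gE v f (M : R) : continuous f -> (forall x, `|f x| <= M) ->
  (gE v f)%:E = gauss_expect v f.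
Proof.
move=> cf fM; rewrite /gE /gauss_expect; case: eqP => // _.
exact: EFin_gI (continuous_measR cf) fM.
Qed.

Lemma gE_cvg (v : R) (s : nat -> R) f (M : R) : 0 <= v ->
  s @ \oo --> Num.sqrt v -> continuous f -> (forall x, `|f x| <= M) ->
  (fun n => gI 1 (fun z => f (s n * z))) @ \oo --> gE v f.
Proof.
move=> v0 sv cf fM; rewrite (gE_gI v0 cf fM); apply: (@gI_dct _ _ _ M) => [n|n x|x].
- apply: continuous_measR => z.
  by apply: (@continuous_comp _ _ _ (fun z => s n * z) f); [exact: mulrl_continuous|exact: cf].
- exact: fM.
- apply: (cvg_comp (fun n => s n * x) f); last exact: cf.
  exact: cvgMl.
Qed.

End gaussian_integrals.

Section gaussian_limits.
Context {R : realType} {d0 : measure_display} {T : measurableType d0}.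
Variable Q : probability T R.

Definition lip1 (K : R) (f : R -> R) := forall a b, `|f a - f b| <= K * `|a - b|.

Lemma lip1_continuous K f : 0 <= K -> lip1 K f -> continuous f.
Proof.
move=> K0 lf x; apply/cvgrPdist_le => e e0; have K1 : 0 < K + 1 by rewrite ltr_wpDl.
near=> y; rewrite (le_trans (lf _ _))// (@le_trans _ _ ((K + 1) * `|x - y|))//.
  by rewrite ler_wpM2r// lerDl.
rewrite mulrC -ler_pdivlMr//; near: y.
by apply: cvgr_dist_le; [exact: cvg_id|rewrite divr_gt0].
Unshelve. all: by end_near. Qed.

(** Bounded Lipschitz tests are the form in which limits of the field are known; [gaussian_rv_law]
    recovers the law on Borel sets. *)
Definition gaussian_rv (Y : T -> R) (v : R) :=
  forall (K M : R) (f : R -> R), 0 <= K -> lip1 K f -> (forall x, `|f x| <= M) ->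
    Ex Q (fun w => f (Y w)) = gE v f.

(* Tightness bounds the standard deviations, a subsequence of which converges. *)
Lemma gaussian_rv_cvg (Y_ : nat -> T -> R) (Y : T -> R) :
  (forall n, measurable_fun [set: T] (Y_ n)) ->
  (forall w, (fun n => Y_ n w) @ \oo --> Y w) ->
  (forall n, exists2 v : R, 0 <= v & gaussian_rv (Y_ n) v) ->
  exists2 v : R, 0 <= v & gaussian_rv Y v.
Proof.
move=> mY YY gY.
have gY' n : exists v : R, 0 <= v /\ gaussian_rv (Y_ n) v.
  by have [v v0 gv] := gY n; exists v.
have [v_ Hv] := choice gY'.
have mY' : measurable_fun [set: T] Y.
  by apply: (@measurable_fun_cvg _ _ _ _ Y_) => // w _; exact: YY.
have cvgE (K M : R) (f : R -> R) : 0 <= K -> lip1 K f -> (forall x, `|f x| <= M) ->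
    (fun n => gE (v_ n) f) @ \oo --> Ex Q (fun w => f (Y w)).
  move=> K0 lf fM; have cf := lip1_continuous K0 lf.
  apply: (cvgn_ext (u := fun n => Ex Q (fun w => f (Y_ n w)))).
    by move=> n; apply: ((Hv n).2 _ _ _ K0 lf fM).
  apply: (proj2 (@Ex_dct _ _ _ Q (fun n w => f (Y_ n w)) _ M _ _ _)) => //.
  - by move=> n; apply: measurableT_comp => //; exact: continuous_measR.
  - by move=> w; apply: cvg_comp; [exact: YY|exact: cf].
have [m Hm] : exists m : nat, pr Q [set w | m%:R < `|Y w|] <= 4^-1.
  have h : (fun m => Ex Q (fun w => \1_[set w | m%:R < `|Y w|] w)) @ \oo --> 0.
    rewrite -[X in _ --> X](Ex_cst Q 0).
    apply: (proj2 (@Ex_dct _ _ _ Q (fun m w => \1_[set w | m%:R < `|Y w|] w) _ 1 _ _ _)) => //.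
    - by move=> m; apply/measurable_indic/measurable_gt_cst/measurableT_comp.
    - by move=> m w; rewrite indicE; case: (_ \in _); rewrite ?normr1 ?normr0.
    move=> w; apply/cvgnP => e e0; exists (Num.bound `|Y w|) => n hn.
    rewrite subr0 indicE memNset ?normr0 ?(ltW e0)//=.
    apply/negP; rewrite -leNgt (le_trans (ltW (archi_boundP (normr_ge0 _))))//.
    by rewrite ler_nat.
  have [|N /(_ N (leqnn _))] := (cvgnP _ _).1 h 4^-1; first by rewrite invr_gt0.
  rewrite subr0 Ex_indic; last by apply/measurable_gt_cst/measurableT_comp.
  by rewrite ger0_norm ?pr_ge0// => ?; exists N.
pose f (x : R) := clamp01 ((`|x| - m%:R) / 1).
have lf : lip1 1 f.
  move=> a b; rewrite mul1r (le_trans (clamp01_lipZ _ ltr01 _ _))// invr1 mul1r.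
  exact: ler_dist_dist.
have cf := lip1_continuous ler01 lf.
have fM x : `|f x| <= 1 by exact: clamp01_norm.
have f01 x : 0 <= f x <= 1 by exact: clamp01_bd.
have fY : Ex Q (fun w => f (Y w)) <= 4^-1.
  rewrite (le_trans _ Hm)// -Ex_indic; last by apply/measurable_gt_cst/measurableT_comp.
  apply: Ex_le.
  - split; first by apply: measurableT_comp => //; exact: continuous_measR.
    by exists 1 => w; exact: fM.
  - by apply/brv_indic/measurable_gt_cst/measurableT_comp.
  move=> w; rewrite indicE; have [|h] := boolP (_ \in _).
    by have /andP[] := f01 (Y w).
  have {}h : `|Y w| <= m%:R by rewrite leNgt; apply/negP => h'; rewrite mem_set in h.
  by rewrite /f clamp01_le0// divr1 subr_le0.
have [N1 HN1] : exists N1, forall n, (N1 <= n)%N -> gE (v_ n) f <= 2^-1.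
  have e4 : 0 < 4^-1 :> R by rewrite invr_gt0.
  have [N1 H1] := (cvgnP _ _).1 (cvgE _ _ _ ler01 lf fM) _ e4.
  by exists N1 => n /H1; rewrite ler_norml; lra.
have p0 : 0 < normal_peak (1 : R) by exact: normal_peak_gt0 (oner_neq0 _).
(* The standard normal law gives [[- eta, eta]] mass at most [2 * eta * normal_peak 1 = 1/4]. If
   [s > (m + 1) / eta], then [f (s z) = 1] off this interval and the integral of [f] is at least
   [3/4], against the bound [1/2]. *)
pose eta : R := (8 * normal_peak 1)^-1.
have eta0 : 0 < eta by rewrite invr_gt0 mulr_gt0.
have sB n : (N1 <= n)%N -> Num.sqrt (v_ n) <= (m%:R + 1) / eta.
  move=> /HN1; rewrite (gE_gI (Hv n).1 cf fM) => h; rewrite leNgt; apply/negP => hB.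
  set s := Num.sqrt _ in h hB.
  have cs : continuous (fun z : R => f (s * z)).
    by move=> z; apply: (@continuous_comp _ _ _ (fun z => s * z) f); [exact: mulrl_continuous|exact: cf].
  have cs' : continuous (fun z : R => 1 - f (s * z)).
    by move=> z; apply: cvgB; [exact: cvg_cst|exact: cs].
  have f'M z : `|1 - f (s * z)| <= 1 by have := f01 (s * z); rewrite ler_norml; lra.
  have e1 := gI_D 1 (continuous_measR cs) (fun z => fM (s * z)) (continuous_measR cs') f'M.
  have e2 : gI 1 (fun z : R => f (s * z) + (1 - f (s * z))) = 1.
    by under eq_fun do rewrite addrC subrK; exact: gI_cst.
  have e3 : gI 1 (fun z : R => 1 - f (s * z)) <= normal_peak 1 * (eta - - eta).
    have en : - eta <= eta by rewrite ge0_cp ?ltW.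
    apply: (gI_itv (oner_neq0 R) en).
    - exact: continuous_measR.
    - by move=> z; have := f01 (s * z); lra.
    move=> z; rewrite -ler_norml -ltNge => hz.
    suff -> : f (s * z) = 1 by rewrite subrr.
    have h1 : m%:R + 1 <= `|s * z|.
      rewrite normrM (ger0_norm (sqrtr_ge0 _)) -/s.
      move: hB; rewrite ltr_pdivrMr// => hB.
      rewrite (le_trans (ltW hB))// ler_wpM2l ?sqrtr_ge0// ltW//.
    by apply: clamp01_ge1; rewrite divr1; lra.
  have e4 : normal_peak 1 * (eta - - eta) = 4^-1 :> R.
    by rewrite /eta; field; rewrite gt_eqF.
  by move: e1 e3; rewrite e2 e4; lra.
have [|phi iphi /cvg_ex[l hl]] := @bolzano_weierstrass R (fun k => Num.sqrt (v_ (k + N1)%N)).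
  exists ((m%:R + 1) / eta); split; first exact: num_real.
  move=> x hx k _ /=; rewrite ger0_norm ?sqrtr_ge0// (le_trans _ (ltW hx))// sB//.
  exact: leq_addl.
have l0 : 0 <= l by apply: cvgn_ge hl _ => k; exact: sqrtr_ge0.
have sl : Num.sqrt (l ^+ 2) = l by rewrite sqrtr_sqr ger0_norm.
exists (l ^+ 2); first exact: sqr_ge0.
move=> K M g K0 lg gM; have cg := lip1_continuous K0 lg.
have h1 := cvgE _ _ _ K0 lg gM.
have h2 : (fun k => gE (v_ (phi k + N1)%N) g) @ \oo --> Ex Q (fun w => g (Y w)).
  apply/cvgnP => e /((cvgnP _ _).1 h1)[N HN]; exists N => k Nk; apply: HN.
  have phige i : (i <= phi i)%N.
    elim: i => // i ih; apply: (leq_ltn_trans ih).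
    by have /increasing_seqP/(_ i) := iphi.
  by rewrite (leq_trans Nk)// (leq_trans (phige k))// leq_addr.
apply: (cvgn_uniq h2); rewrite -sl in hl.
apply: cvgn_ext (gE_cvg (sqr_ge0 l) hl cg gM) => k.
by rewrite (gE_gI (Hv _).1 cg gM).
Qed.

Lemma gaussian_rv_law (Y : T -> R) (v : R) : measurable_fun [set: T] Y -> 0 <= v ->
  gaussian_rv Y v -> forall B : set R, measurable B -> Q (Y @^-1` B) = gauss_law v B.
Proof.
move=> mY v0 gY.
have ray x : Q (Y @^-1` `]-oo, x[%classic) = gauss_law v `]-oo, x[%classic.
  (* Lipschitz ramps that vanish from [x] on and increase to the indicator of the open ray at every
     point, including [x]; an atom of the limit there does no harm. *)
  pose f (k : nat) (y : R) := clamp01 (k.+1%:R * (x - y)).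
  have lf k : lip1 k.+1%:R (f k).
    move=> a b; rewrite (le_trans (clamp01_lip _ _))// -mulrBr normrM ger0_norm//.
    by rewrite opprB addrC addrA subrK distrC.
  have cf k : continuous (f k) by apply: (lip1_continuous _ (lf k)); rewrite ler0n.
  have fM k y : `|f k y| <= 1 by exact: clamp01_norm.
  have fcv y : (fun k => f k y) @ \oo --> (\1_(`]-oo, x[%classic : set R) y : R).
    apply/cvgnP => e e0; rewrite indicE; have [yx|yx] := ltP y x; last first.
      exists 0%N => k _; rewrite memNset/= ?in_itv/= ?ltNge ?yx// /f clamp01_le0.
        by rewrite subrr normr0 ltW.
      by rewrite pmulr_rle0// subr_le0.
    have xy0 : 0 < x - y by rewrite subr_gt0.
    exists (Num.bound (x - y)^-1) => k Nk; rewrite mem_set/= ?in_itv//= /f clamp01_ge1.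
      by rewrite subrr normr0 ltW.
    rewrite -ler_pdivrMr// mul1r (le_trans (ltW (archi_boundP _)))//; first by rewrite invr_ge0 ltW.
    by rewrite ler_nat ltnW.
  have mR : measurable (`]-oo, x[%classic : set R) by exact: measurable_itv.
  have h1 : (fun k => Ex Q (fun w => f k (Y w))) @ \oo --> pr Q (Y @^-1` `]-oo, x[%classic).
    rewrite -Ex_indic; last by rewrite -[X in measurable X]setTI; exact: mY.
    apply: (proj2 (@Ex_dct _ _ _ Q (fun k w => f k (Y w)) _ 1 _ _ _)) => //.
    by move=> k; apply: measurableT_comp => //; exact: continuous_measR.
  have h2 : (fun k => gE v (f k)) @ \oo --> pr Q (Y @^-1` `]-oo, x[%classic).
    by apply: cvgn_ext h1 => k; apply: (gY _ _ _ _ (lf k) (fM k)); rewrite ler0n.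
  rewrite -[LHS]EFin_pr; last by rewrite -[X in measurable X]setTI; exact: mY.
  rewrite /gauss_law; have [ve|vn0] := eqVneq v 0.
    congr EFin; apply: (cvgn_uniq h2); apply: cvgn_ext (fcv 0) => k.
    by rewrite /gE /gauss_expect ve eqxx.
  have h3 : (fun k => gE v (f k)) @ \oo --> gI (Num.sqrt v) (\1_(`]-oo, x[%classic : set R) : R -> R).
    apply: (cvgn_ext (u := fun k => gI (Num.sqrt v) (f k))).
      by move=> k; rewrite /gE /gauss_expect (negbTE vn0).
    by apply: (@gI_dct R _ f _ 1) => // k; exact: continuous_measR.
  rewrite (cvgn_uniq h2 h3) (@EFin_gI _ _ _ 1).
  - rewrite /normal_prob [RHS]integral_mkcond; apply: eq_integral => y _.
    rewrite patchE indicE; case: (_ \in _); rewrite ?mul1r ?mul0r//.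
  - exact: measurable_indic.
  - by move=> y; rewrite indicE; case: (_ \in _); rewrite ?normr1 ?normr0.
pose Ym : {mfun T >-> measurableTypeR R} :=
  HB.pack (Y : T -> measurableTypeR R)
    (isMeasurableFun.Build _ _ T (measurableTypeR R) Y (mY : @measurable_fun _ _ T (measurableTypeR R) setT Y)).
have uniq (m : {measure set (measurableTypeR R) -> \bar R}) :
    (forall x, Q (Y @^-1` `]-oo, x[%classic) = m `]-oo, x[%classic) ->
    forall B : set R, measurable B -> Q (Y @^-1` B) = m B.
  move=> Qm B mB.
  apply: (@measure_unique _ R (measurableTypeR R) (@RGenInftyO.G R)
    (fun n => `]-oo, n%:R[%classic) _ _ _ _ (distribution Q Ym) m).
  - exact: RGenInftyO.measurableE.
  - move=> _ _ [x ->] [y ->]; exists (Num.min x y); apply/seteqP; split => z /=.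
      by rewrite !in_itv/= lt_min => -[-> ->].
    by rewrite !in_itv/= lt_min => /andP[-> ->].
  - by move=> n; exists n%:R.
  - apply/seteqP; split => // x _; exists (Num.bound `|x|) => //=; rewrite in_itv/=.
    by rewrite (le_lt_trans (ler_norm x))// archi_boundP.
  - by move=> _ [x ->]; exact: Qm.
  - by move=> k; rewrite (le_lt_trans (probability_le1 _ _)) ?ltry//; exact: measurable_itv.
  - exact: mB.
move=> B mB; rewrite /gauss_law; case: eqP => ve.
  by apply: (uniq (@dirac _ (measurableTypeR R) 0 R) _ B mB) => x; rewrite ray /gauss_law ve eqxx.
by apply: (uniq (normal_prob 0 (Num.sqrt v)) _ B mB) => x; rewrite ray /gauss_law; case: eqP.
Qed.

End gaussian_limits.

Section weak_convergence_to_gaussian.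
Context {R : realType} {d0 : measure_display} {T : measurableType d0}.
Variables (P : probability T R) (Y : nat -> T -> R) (v : R).
Hypothesis mY : forall n, measurable_fun [set: T] (Y n).
Hypothesis v0 : 0 <= v.
Hypothesis YN : cvg_dist_normal P Y v.

Lemma cvg_dist_Ex (g : R -> R) (M : R) : continuous g -> (forall x, `|g x| <= M) ->
  (fun n => Ex P (fun w => g (Y n w))) @ \oo --> gE v g.
Proof.
move=> cg gM; have bg : bounded_continuous g by split => //; exists M.
by apply: fine_cvg; rewrite (EFin_gE v cg gM); exact: YN.
Qed.

Lemma cvg_dist_atomless (c e : R) : c != 0 -> 0 < e ->
  exists2 eps : R, 0 < eps & exists N, forall n, (N <= n)%N ->
    pr P [set w | `|Y n w - c| <= eps] <= e.
Proof.
move=> c0 e0.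
have [p p0 Hp] : exists2 p : R, 0 < p & v != 0 -> normal_peak (Num.sqrt v) <= p.
  exists (normal_peak (Num.sqrt v) + 1) => [|_]; last by rewrite lerDl.
  by rewrite ltr_wpDl// normal_peak_ge0.
(* The bump [b] below is supported in [[c - 2 eps, c + 2 eps]]. The first bound makes it vanish at
   [0], which settles [v = 0]; the second bounds its Gaussian integral by [p * 4 eps <= e / 2]. *)
pose eps : R := Num.min (`|c| / 2) (e / (8 * p)).
have ac : 0 < `|c| by rewrite normr_gt0.
have eps0 : 0 < eps by rewrite lt_min !divr_gt0// mulr_gt0.
have ec : 2 * eps <= `|c| by rewrite mulrC -ler_pdivlMr// ge_min lexx.
have ep : p * (4 * eps) <= e / 2.
  have : eps <= e / (8 * p) by rewrite ge_min lexx orbT.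
  rewrite ler_pdivlMr ?mulr_gt0//; lra.
exists eps => //.
pose b (x : R) := clamp01 (2 - `|x - c| / eps).
have lb : lip1 eps^-1 b.
  move=> x y; rewrite (le_trans (clamp01_lip _ _))// opprB addrC addrA subrK -mulrBl.
  rewrite normrM (ger0_norm (_ : 0 <= eps^-1)) ?invr_ge0 ?(ltW eps0)// mulrC ler_wpM2l ?invr_ge0 ?(ltW eps0)//.
  rewrite (le_trans (ler_dist_dist _ _))// (_ : _ - _ = - (x - y)) ?normrN//; ring.
have cb : continuous b by apply: (lip1_continuous _ lb); rewrite invr_ge0 ltW.
have bM x : `|b x| <= 1 by exact: clamp01_norm.
have b01 x : 0 <= b x <= 1 by exact: clamp01_bd.
have bout x : 2 * eps <= `|x - c| -> b x = 0.
  by move=> h; rewrite /b clamp01_le0// subr_le0 ler_pdivlMr.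
have gEb : gE v b <= e / 2.
  rewrite /gE /gauss_expect; have [_|vn0] := eqVneq v 0.
    by rewrite /= bout ?divr_ge0 ?(ltW e0)// sub0r normrN.
  have sv : Num.sqrt v != 0 by rewrite sqrtr_eq0 -ltNge lt_neqAle eq_sym vn0.
  have cc : c - 2 * eps <= c + 2 * eps by lra.
  have := @gI_itv R (Num.sqrt v) b _ _ sv cc (continuous_measR cb) b01.
  rewrite /gI => h; apply: (le_trans (h _)).
    move=> x; rewrite -[_ <= _ <= _]/((_ <= _) && (_ <= _)) => hx; apply: bout.
    rewrite leNgt; apply: contra hx; rewrite ltr_norml; lra.
  rewrite (_ : c + _ - _ = 4 * eps); last by ring.
  by rewrite (le_trans _ ep)// ler_wpM2r ?Hp// mulr_ge0// ltW.
have [N HN] := (cvgnP _ _).1 (cvg_dist_Ex cb bM) (e / 2) (divr_gt0 e0 (ltr0Sn R 1)).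
exists N => n /HN hn.
have bY : brv (fun w => b (Y n w)).
  by split; [apply: measurableT_comp => //; exact: continuous_measR|exists 1].
rewrite -[leLHS]mul1r (@le_trans _ _ (Ex P (fun w => b (Y n w))))//; last first.
  by move: hn; rewrite ler_norml; lra.
apply: pr_markov => //.
- apply: measurable_le_cst; apply: measurableT_comp => //.
  by apply: measurable_funB => //; exact: measurable_cst.
- by move=> w; have /andP[] := b01 (Y n w).
move=> w /= h; rewrite /b clamp01_ge1//.
have : `|Y n w - c| / eps <= 1 by rewrite ler_pdivrMr// mul1r.
lra.
Qed.

End weak_convergence_to_gaussian.

(** * Marginals and quantiles *)

Lemma pr_setD {R : realType} {d0 : measure_display} {T : measurableType d0}
    (P : probability T R) (A B : set T) : measurable A -> measurable B -> A `<=` B ->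
  pr P (B `\` A) = pr P B - pr P A.
Proof.
move=> mA mB AB; rewrite -!Ex_indic//; last exact: measurableD.
rewrite -ExB; [|exact: brv_indic|exact: brv_indic].
congr Ex; apply/funext => w; rewrite !indicE.
have [wA|wA] := boolP (w \in A).
  rewrite memNset; last by case=> _; apply; rewrite inE in wA.
  by rewrite mem_set ?subrr//; apply: AB; rewrite inE in wA.
rewrite subr0; congr (_%:R); congr nat_of_bool; apply/idP/idP.
  by rewrite !inE => -[].
by rewrite !inE => wB; split => // /mem_set; apply/negP.
Qed.

Section marginals.
Context {R : realType} {d0 : measure_display} {T : measurableType d0}.
Variables (P : probability T R) (d : nat) (X : nat -> T -> 'I_d -> R).
Hypothesis mX : forall n c, measurable_fun [set: T] (fun w => X n w c).

Definition Fbar (i : 'I_d) (t : \bar R) : R := pr P [set w | ((X 0 w i)%:E <= t)%E].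

Lemma measurable_leE1 n i t : measurable [set w | ((X n w i)%:E <= t)%E].
Proof.
case: t => [x| |].
- by have := measurable_le_cst x (mX n i); congr measurable; apply/seteqP; split => w /=; rewrite lee_fin.
- by rewrite (_ : [set w | _] = setT)//; apply/seteqP; split => w //= _; rewrite leey.
- rewrite (_ : [set w | _] = set0)//; apply/seteqP; split => w //=.
Qed.

Lemma measurable_leE n t : measurable [set w | leE (X n w) t].
Proof.
rewrite (_ : [set w | _] = \bigcap_(i in [set: 'I_d]) [set w | ((X n w i)%:E <= t i)%E]).
  by apply: fin_bigcap_measurable => // i _; exact: measurable_leE1.
by apply/seteqP; split => [w h i _|w h i]; exact: h.
Qed.

Lemma Fbar_ge0 i t : 0 <= Fbar i t.
Proof. exact: pr_ge0. Qed.

Lemma Fbar_le1 i t : Fbar i t <= 1.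
Proof. by apply: pr_le1; exact: measurable_leE1. Qed.

Lemma Fbar_mono i s t : (s <= t)%E -> Fbar i s <= Fbar i t.
Proof.
move=> st; apply: pr_le; [exact: measurable_leE1|exact: measurable_leE1|].
by move=> w /= /le_trans; exact.
Qed.

Lemma FbarNy i : Fbar i -oo%E = 0.
Proof.
rewrite /Fbar (_ : [set w | _] = set0) ?pr_set0//; apply/seteqP; split => w //=.
Qed.

Lemma Fbary i : Fbar i +oo%E = 1.
Proof.
by rewrite /Fbar (_ : [set w | _] = setT) ?pr_setT//; apply/seteqP; split => w //= _; rewrite leey.
Qed.

Lemma FbarE i x : Fbar i x%:E = marg P X i x.
Proof. by congr fine; congr (P _); apply/seteqP; split => w /=; rewrite lee_fin. Qed.

(** A point below [b] but not below [a] has some coordinate in []a i, b i]]. The corners need not be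
    ordered, hence the maximum with [0]. *)
Lemma pr_leE_diff a b : pr P [set w | leE (X 0 w) b] - pr P [set w | leE (X 0 w) a] <=
  \sum_i Num.max 0 (Fbar i (b i) - Fbar i (a i)).
Proof.
pose D i := [set w | ((X 0 w i)%:E <= b i)%E] `\` [set w | ((X 0 w i)%:E <= a i)%E].
have mD i : measurable (D i) by apply: measurableD; exact: measurable_leE1.
have prD i : pr P (D i) <= Num.max 0 (Fbar i (b i) - Fbar i (a i)).
  have [ab|ba] := leP (a i) (b i).
    rewrite pr_setD ?le_max ?lexx ?orbT//; try exact: measurable_leE1.
    by move=> w /= /le_trans; exact.
  rewrite (_ : D i = set0) ?pr_set0 ?le_max ?lexx//.
  by apply/seteqP; split => // w [/= h1 h2]; apply: h2; exact: le_trans h1 (ltW ba).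
rewrite (le_trans _ (ler_sum _ (fun i _ => prD i)))// (le_trans _ (pr_bigcup_fin P _ _))//.
rewrite lerBlDr addrC (le_trans _ (prU P _ _))//; last 2 first.
- exact: measurable_leE.
- exact: bigsetU_measurable.
apply: pr_le; first exact: measurable_leE.
  by apply: measurableU; [exact: measurable_leE|exact: bigsetU_measurable].
move=> w wb; have [wa|wa] := pselect (leE (X 0 w) a); [by left|right].
have [i hi] : exists i, ~ ((X 0 w i)%:E <= a i)%E by apply: contrapT => h; apply: wa => i; apply: contrapT => hi; apply: h; exists i.
by rewrite -bigcup_seq; exists i => /=; [rewrite mem_index_enum|split => //; exact: wb].
Qed.

Lemma pr_eventually_le (Y : T -> R) (e : R) : measurable_fun [set: T] Y -> 0 < e ->
  exists m : R, forall x, m <= x -> pr P [set w | x < Y w] <= e.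
Proof.
move=> mY e0.
have h : (fun m => Ex P (fun w => \1_[set w | m%:R < Y w] w)) @ \oo --> 0.
  rewrite -[X in _ --> X](Ex_cst P 0).
  apply: (proj2 (@Ex_dct _ _ _ P (fun m w => \1_[set w | m%:R < Y w] w) _ 1 _ _ _)) => //.
  - by move=> m; apply/measurable_indic/measurable_gt_cst.
  - by move=> m w; rewrite indicE; case: (_ \in _); rewrite ?normr1 ?normr0.
  move=> w; apply/cvgnP => e1 e10; exists (Num.bound `|Y w|) => n hn.
  rewrite subr0 indicE memNset ?normr0 ?(ltW e10)//=.
  apply/negP; rewrite -leNgt (le_trans (ler_norm _))// (le_trans (ltW (archi_boundP (normr_ge0 _))))//.
  by rewrite ler_nat.
have [N /(_ N (leqnn _))] := (cvgnP _ _).1 h e e0.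
rewrite subr0 Ex_indic; last exact: measurable_gt_cst.
rewrite ger0_norm ?pr_ge0// => hN; exists N%:R => x Nx; rewrite (le_trans _ hN)//.
apply: pr_le; [exact: measurable_gt_cst|exact: measurable_gt_cst|].
by move=> w /= /(le_lt_trans Nx).
Qed.

Lemma marg_setC i x : pr P [set w | x < X 0 w i] = 1 - marg P X i x.
Proof.
have -> : [set w | x < X 0 w i] = ~` [set w | X 0 w i <= x].
  by apply/seteqP; split => w /=; [move=> h; apply/negP; rewrite -ltNge|move/negP; rewrite -ltNge].
by rewrite pr_setC//; exact: measurable_le_cst.
Qed.

Lemma marg_cvgy i (e : R) : 0 < e -> exists m, forall x, m <= x -> 1 - e <= marg P X i x.
Proof.
move=> e0; have [m Hm] := pr_eventually_le (mX 0%N i) e0.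
by exists m => x /Hm; rewrite marg_setC; lra.
Qed.

Lemma marg_cvgNy i (e : R) : 0 < e -> exists m, forall x, x <= m -> marg P X i x <= e.
Proof.
move=> e0; have mN : measurable_fun [set: T] (fun w => - X 0 w i) by exact: measurableT_comp.
have [m Hm] := pr_eventually_le mN e0.
exists (- m - 1) => x xm; rewrite (le_trans _ (Hm (- x - 1) _))//; last by lra.
apply: pr_le; [exact: measurable_le_cst|exact: measurable_gt_cst|].
by move=> w /=; lra.
Qed.

Hypothesis cF : cdf_continuous P X.

(** The other coordinates are fixed at a level [M] which they all stay below with probability at
    least [1 - e / 4]; the marginal is then within [e / 4] of the joint distribution function,
    uniformly in [y]. *)
Lemma marg_continuous i : continuous (marg P X i).
Proof.
move=> x; apply/cvgrPdist_le => e e0.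
have [M HM] : exists M : R, forall j, pr P [set w | M < X 0 w j] <= e / (4 * d%:R).
  have e1 : 0 < e / (4 * d%:R).
    by rewrite divr_gt0// mulr_gt0// ltr0n (leq_trans _ (ltn_ord i)).
  have [m Hm] := choice (fun j => pr_eventually_le (mX 0%N j) e1).
  exists (\sum_j `|m j|) => j; apply: Hm; rewrite (bigD1 j)//=.
  by rewrite (le_trans (ler_norm _))// lerDl sumr_ge0.
pose t y : 'I_d -> R := fun j => if j == i then y else M.
have dist y : `|marg P X i y - Defs.cdf P X (fun j => (t y j)%:E)| <= e / 4.
  pose B := \big[setU/set0]_(j < d) [set w | M < X 0 w j].
  have mB : measurable B by apply: bigsetU_measurable => j _; exact: measurable_gt_cst.
  have prB : pr P B <= e / 4.
    rewrite (le_trans (pr_bigcup_fin P _ _))//; first by move=> j _; exact: measurable_gt_cst.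
    rewrite (le_trans (ler_sum _ (fun j _ => HM j)))// sumr_const card_ord.
    rewrite (_ : _ *+ d = e / 4)// -[LHS]mulr_natr; field.
    by rewrite pnatr_eq0 -lt0n (leq_trans _ (ltn_ord i)).
  have le1 : Defs.cdf P X (fun j => (t y j)%:E) <= marg P X i y.
    apply: pr_le; [exact: measurable_leE|exact: measurable_le_cst|].
    by move=> w /= /(_ i); rewrite /t eqxx lee_fin.
  have le2 : marg P X i y <= Defs.cdf P X (fun j => (t y j)%:E) + pr P B.
    rewrite (le_trans _ (prU P _ _))//; last exact: measurable_leE.
    apply: pr_le; [exact: measurable_le_cst|by apply: measurableU => //; exact: measurable_leE|].
    move=> w /= wy; have [?|nB] := pselect (B w); [by right|left => j].
    rewrite /t; case: eqVneq => [->|_]; rewrite lee_fin// leNgt; apply/negP => h; apply: nB.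
    by rewrite /B -bigcup_seq; exists j => //=; rewrite mem_index_enum.
  by rewrite ler_norml; lra.
have e2 : 0 < e / 2 by rewrite divr_gt0.
have [del del0 Hdel] := cF (t x) e2.
near=> y.
have yx : `|y - x| < del.
  by rewrite distrC; near: y; apply: cvgr_dist_lt => //; exact: cvg_id.
have h1 := dist x; have h2 := dist y.
have h3 : `|Defs.cdf P X (fun j => (t y j)%:E) - Defs.cdf P X (fun j => (t x j)%:E)| < e / 2.
  by apply: Hdel => j; rewrite /t; case: ifP => // _; rewrite subrr normr0.
by move: h1 h2 h3; rewrite !ler_norml ltr_norml; lra.
Unshelve. all: by end_near. Qed.

Arguments marg_continuous : clear implicits.

(** For [0 < u < 1] any preimage will do, the only property used there being [Fbar_quantile]. The
    infinite values let the grid exhaust [[-oo, +oo]] and give a meaning to indices that overshoot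
    it. *)
Definition quantile (i : 'I_d) (u : R) : \bar R :=
  if u <= 0 then -oo%E else if 1 <= u then +oo%E
  else (xget 0 [set x | marg P X i x = u])%:E.

Lemma Fbar_quantile i u : Fbar i (quantile i u) = clamp01 u.
Proof.
rewrite /quantile /clamp01; case: (leP u 0) => u0; first exact: FbarNy.
case: (leP 1 u) => u1; first exact: Fbary.
suff [x hx] : exists x, marg P X i x = u.
  by rewrite FbarE; case: xgetP => [y _ <- //|/(_ x)]; case.
have [m0 H0] := marg_cvgNy i u0.
have u1' : 0 < 1 - u by rewrite subr_gt0.
have [m1 H1] := marg_cvgy i u1'.
have h0 := H0 _ (lexx m0); have h1 := H1 _ (lexx m1).
have [//|m01] := leP m1 m0.
  move=> /(H0 _) h; have := H1 _ (lexx m1) => h'; exists m1; lra.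
have [||c _ hc] := @IVT R (marg P X i) m0 m1 u (ltW m01); last by exists c.
  exact/continuous_subspaceT/marg_continuous.
by rewrite ge_min le_max h0/=; apply/orP; right; lra.
Qed.

Lemma quantile_lt i u t : clamp01 u < Fbar i t -> (quantile i u < t)%E.
Proof.
move=> ut; rewrite ltNge; apply/negP => /(Fbar_mono i).
by rewrite Fbar_quantile leNgt ut.
Qed.

Lemma lt_quantile i u t : Fbar i t < clamp01 u -> (t < quantile i u)%E.
Proof.
move=> ut; rewrite ltNge; apply/negP => /(Fbar_mono i).
by rewrite Fbar_quantile leNgt ut.
Qed.

Lemma modc_bounded i (t s : R) : `|marg P X i t - marg P X i s| <= 1.
Proof.
have := Fbar_ge0 i t%:E; have := Fbar_ge0 i s%:E; have := Fbar_le1 i t%:E; have := Fbar_le1 i s%:E.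
by rewrite !FbarE ler_norml; lra.
Qed.

Lemma modc_ge_dist i (del : \bar R) (t s : R) : ((`|t - s|)%:E <= del)%E ->
  `|marg P X i t - marg P X i s| <= modc (marg P X i) del.
Proof.
move=> ts; apply: sup_upper_bound; last by exists t, s.
split; first by exists `|marg P X i t - marg P X i s|, t, s.
by exists 1 => _ [a [b [_ ->]]]; exact: modc_bounded.
Qed.

(** If an endpoint is infinite then [b - a = +oo], and pairs of points far out in the two tails show
    that the modulus is at least [1]. *)
Lemma modc_ge i a b : (a < b)%E -> Fbar i b - Fbar i a <= modc (marg P X i) (b - a)%E.
Proof.
move=> ab.
have inf : (b - a = +oo)%E -> Fbar i b - Fbar i a <= modc (marg P X i) (b - a)%E.
  move=> ->; rewrite (@le_trans _ _ 1)//.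
    by have := Fbar_le1 i b; have := Fbar_ge0 i a; lra.
  apply/ler_addgt0Pr => e e0; have e2 : 0 < e / 2 by rewrite divr_gt0.
  have [m0 H0] := marg_cvgNy i e2; have [m1 H1] := marg_cvgy i e2.
  have := @modc_ge_dist i +oo%E m1 m0 (leey _); have := H0 _ (lexx m0); have := H1 _ (lexx m1).
  have := ler_norm (marg P X i m1 - marg P X i m0); lra.
case: a b ab inf => [a| |] [b| |]//= ab inf; try by apply: inf.
rewrite !FbarE (le_trans (ler_norm _))//; apply: modc_ge_dist.
by rewrite ger0_norm ?EFinB// subr_ge0 ltW.
Qed.

Lemma near_Fbar i t (e : R) : 0 < e -> nbhs t [set s | `|Fbar i s - Fbar i t| < e].
Proof.
move=> e0; have e2 : 0 < e / 2 by rewrite divr_gt0.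
case: t => [x| |].
- have /cvgrPdist_lt/(_ e e0)/nbhs_image_EFin := @marg_continuous i x.
  by apply: filterS => _ [y hy <-] /=; rewrite !FbarE distrC.
- have [m Hm] := marg_cvgy i e2.
  exists m; split; first exact: num_real.
  move=> s /ltW/(Fbar_mono i); rewrite /= FbarE Fbary => h.
  by have := Hm _ (lexx m); have := Fbar_le1 i s; rewrite ltr_norml; lra.
- have [m Hm] := marg_cvgNy i e2.
  exists m; split; first exact: num_real.
  move=> s /ltW/(Fbar_mono i); rewrite /= FbarE FbarNy => h.
  by have := Hm _ (lexx m); have := Fbar_ge0 i s; rewrite ltr_norml; lra.
Qed.

End marginals.

(** * Moments and deviations of normalized sums *)

Section lnorm_bound.
Context {R : realType} {d0 : measure_display} {T : measurableType d0}.
Variable P : probability T R.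

(** [|Y|^r <= |Y|] because [|Y| <= 1]. The [L^r] norm is thus controlled by an increment of the
    distribution function, to the power [1 / r]: this is the term [i / r] in the condition on
    [gam i]. *)
Lemma Lnorm_le_Ex (Y : T -> R) (r : R) : brv Y -> (forall w, `|Y w| <= 1) -> 1 <= r ->
  fine (Lnorm P r%:E (fun w => (Y w)%:E)) <= (Ex P (fun w => `|Y w|)) `^ r^-1.
Proof.
move=> bY Y1 r1; have r0 : 0 <= r := le_trans ler01 r1.
have bYr : brv (fun w => `|Y w| `^ r).
  split; first by apply: (measurableT_comp (measurable_powR r)); exact: brv_meas (brv_abs bY).
  exists 1 => w; rewrite ger0_norm ?powR_ge0//.
  rewrite [leRHS](_ : 1 = 1 `^ r); last by rewrite powR1.
  by apply: ge0_ler_powR; rewrite ?nnegrE.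
rewrite unlock /Lnorm fine_poweR.
apply: ge0_ler_powR; rewrite ?invr_ge0// ?nnegrE.
- by apply: fine_ge0; apply: integral_ge0 => w _; exact: poweR_ge0.
- exact: Ex_ge0.
rewrite -[leLHS]/(Ex P (fun w => `|Y w| `^ r)).
apply: (Ex_le P bYr (brv_abs bY)) => w.
have [->|Y0] := eqVneq (Y w) 0; first by rewrite normr0 powR0// gt_eqF// (lt_le_trans ltr01).
have a0 : 0 < `|Y w| by rewrite normr_gt0.
by rewrite -[leRHS]powRr1//; apply: ger_powR => //; rewrite a0 Y1.
Qed.

End lnorm_bound.

Section function_space.
Context {R : realType} {d0 : measure_display} {T : measurableType d0}.
Variables (P : probability T R) (d : nat) (X : nat -> T -> 'I_d -> R).
Hypothesis mX : forall n c, measurable_fun [set: T] (fun w => X n w c).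
Variables (G : set (('I_d -> R) -> R)) (nG : (('I_d -> R) -> R) -> R).
Hypothesis GS : seminormed_space G nG.

Lemma measurable_borel_prod n A : @borel_prod R 'I_d A -> measurable [set w | A (X n w)].
Proof.
apply: (@smallest_sub _ (sigma_algebra setT) _ [set A | measurable [set w | A (X n w)]]).
- split => /=.
  + by rewrite (_ : [set w | _] = set0)//; apply/seteqP; split.
  + move=> B mB; rewrite (_ : [set w | _] = ~` [set w | B (X n w)]); first exact: measurableC.
    by apply/seteqP; split => w //= [].
  + move=> F mF; rewrite (_ : [set w | _] = \bigcup_i [set w | F i (X n w)]).
      by apply: bigcupT_measurable => i; exact: mF.
    by apply/seteqP; split => w [i _ h]; exists i.
- move=> B [i [C [mC ->]]] /=; rewrite -[X in measurable X]setTI; exact: mX.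
Qed.

Lemma G_meas n f : G f -> measurable_fun [set: T] (fun w => f (X n w)).
Proof.
case: GS => mG _ _ _ _ /mG mf _ B mB; rewrite setTI.
exact: (measurable_borel_prod n (mf B mB)).
Qed.

Lemma G_brv n f (M : R) : G f -> (forall x, `|f x| <= M) -> brv (fun w => f (X n w)).
Proof. by move=> Gf fM; split; [exact: G_meas|exists M]. Qed.

Lemma G_cst c : G (fun=> c). Proof. by case: GS. Qed.

Lemma G_lin a b f g : G f -> G g -> G (fun x => a * f x + b * g x).
Proof. by case: GS => _ _ aG sG _ Gf Gg; apply: aG; exact: sG. Qed.

Lemma nG_ge0 f : G f -> 0 <= nG f.
Proof. by case: GS => _ _ _ _ [h _ _]; exact: h. Qed.

Lemma nG_lin a b f g : G f -> G g ->
  nG (fun x => a * f x + b * g x) <= `|a| * nG f + `|b| * nG g.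
Proof.
case: GS => _ _ aG sG [_ tG zG] Gf Gg.
by rewrite (le_trans (tG _ _ (sG _ _ Gf) (sG _ _ Gg)))// !zG.
Qed.

Definition csum (n : nat) (f : ('I_d -> R) -> R) (w : T) : R :=
  \sum_(1 <= i < n.+1) (f (X i w) - Ex P (fun w => f (X 0 w))).

Lemma brv_csum n f (M : R) : G f -> (forall x, `|f x| <= M) -> brv (csum n f).
Proof.
move=> Gf fM; apply: brv_sum => i _; apply: brvB; last exact: brv_cst.
exact: G_brv fM.
Qed.

Variable Psi : R -> R.
Hypothesis PsiN : nondecr_nonneg Psi.
Hypothesis GM : moment_cond P X G nG Psi.

Definition moment_exponents (r : R) (p : nat) (gam : nat -> R) : Prop :=
  [/\ 1 <= r, r * d%:R < p%:R &
   forall i, (1 <= i <= p)%N ->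
       0 <= gam i /\ gam i < i%:R / r + 2 * (p - i)%:R - d%:R].

(* The seminorm of constants is controlled by applying the moment bound to a
   small multiple [th * f] of [f]: either [Psi] is eventually bounded below, and
   then [th * (2 * Psi z + nG 1) <= 2 * Psi z], or [Psi] vanishes identically. *)
Lemma small_multiple (p : nat) (gam : nat -> R) (Phi : nat -> R -> R) (c : R) :
  0 <= c -> (forall i, (1 <= i <= p)%N -> 0 <= gam i) ->
  (forall i, (1 <= i <= p)%N -> nondecr_nonneg (Phi i) /\
     exists (K z0 : R), forall z, z0 <= z -> Phi i (2 * Psi z) <= K * z `^ gam i) ->
  exists th K z0 : R, [/\ 0 < th, th <= 2^-1, 0 <= K, 1 <= z0 &
    forall i z, (1 <= i <= p)%N -> z0 <= z ->
      Phi i (th * (2 * Psi z + c)) <= K * z `^ gam i].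
Proof.
move=> c0 gam0 PhiP; have [PsiM Psi0] := PsiN.
have [[z1 [z10 Pz1]]|Pz0] := pselect (exists z, 0 <= z /\ 0 < Psi z); last first.
  pose K := \sum_(i < p.+1) `|Phi i (2^-1 * c)|.
  exists 2^-1, K, 1; split => //; first by rewrite sumr_ge0.
  move=> i z ip z1; have z0 : 0 <= z := le_trans ler01 z1.
  have -> : Psi z = 0.
    apply/eqP; rewrite eq_le Psi0// andbT leNgt; apply/negP => h; apply: Pz0.
    by exists z.
  rewrite mulr0 add0r (le_trans (ler_norm _))// (@le_trans _ _ K)//.
    have ip' : (i < p.+1)%N by case/andP: ip.
    by rewrite /K (bigD1 (Ordinal ip'))//= lerDl sumr_ge0.
  rewrite ler_peMr ?sumr_ge0// -(powRr0 z) ler_powR// gam0//.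
have h i : exists Kz : R * R, (1 <= i <= p)%N ->
    forall z, Kz.2 <= z -> Phi i (2 * Psi z) <= Kz.1 * z `^ gam i.
  have [ip|ip] := boolP (1 <= i <= p)%N; last by exists (0, 0).
  by have [_ [K [z0 H]]] := PhiP i ip; exists (K, z0).
have {h}[Kz HKz] := choice h.
pose K := \sum_(i < p.+1) `|(Kz i).1|.
pose z0 := 1 + z1 + \sum_(i < p.+1) `|(Kz i).2|.
have s0 : 0 <= \sum_(i < p.+1) `|(Kz i).2| by rewrite sumr_ge0.
(* The ratio [2 Psi z / (2 Psi z + c)] is nondecreasing in [Psi z], so that its value at [z1] serves
   for all larger [z]. *)
pose th := Num.min 2^-1 (2 * Psi z1 / (2 * Psi z1 + c)).
have D0 : 0 < 2 * Psi z1 + c by rewrite ltr_pwDl// mulr_gt0.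
exists th, K, z0; split.
- by rewrite lt_min invr_gt0 ltr0n/= divr_gt0// mulr_gt0.
- by rewrite ge_min lexx.
- by rewrite sumr_ge0.
- by rewrite /z0; lra.
move=> i z ip zz; have [[Pm Pp] _] := PhiP i ip.
have z1z : z1 <= z by rewrite (le_trans _ zz)// /z0; lra.
have zpos : 0 <= z := le_trans z10 z1z.
have ip' : (i < p.+1)%N by case/andP: ip.
have th0 : 0 <= th by rewrite le_min invr_ge0 ler0n/= divr_ge0 ?mulr_ge0 ?Psi0 ?(ltW D0).
rewrite (@le_trans _ _ (Phi i (2 * Psi z)))//.
  apply: Pm; first by rewrite mulr_ge0// addr_ge0// mulr_ge0// Psi0.
  rewrite (@le_trans _ _ (2 * Psi z1 / (2 * Psi z1 + c) * (2 * Psi z + c)))//.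
    rewrite ler_wpM2r ?ge_min ?lexx ?orbT// addr_ge0// mulr_ge0// Psi0//.
  rewrite mulrAC ler_pdivrMr//.
  have := PsiM _ _ z10 z1z; have := ltW Pz1; nra.
rewrite (le_trans (HKz i ip z _))//.
  rewrite (le_trans (ler_norm _))// (le_trans _ zz)// /z0 (bigD1 (Ordinal ip'))//=.
  have : 0 <= \sum_(j < p.+1 | j != Ordinal ip') `|(Kz j).2| by rewrite sumr_ge0.
  lra.
rewrite ler_wpM2r ?powR_ge0// (le_trans (ler_norm _))// /K (bigD1 (Ordinal ip'))//=.
by rewrite lerDl sumr_ge0.
Qed.

(** The hypothesis is applied to [th * f]: the factor brings the centred function below [1], as
    [Lnorm_le_Ex] needs, and absorbs the seminorm of its mean. Homogeneity charges [th^(- 2 p)],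
    which is independent of [f], [z] and [n]. *)
Lemma moment_bound : exists (r : R) (p : nat) (gam : nat -> R) (C z0 : R),
  [/\ moment_exponents r p gam, 0 <= C, 1 <= z0 &
   forall f (z del : R) n, G f -> (forall x, `|f x| <= 1) -> z0 <= z ->
     nG f <= 2 * Psi z -> 0 <= del ->
     Ex P (fun w => `|f (X 0 w) - Ex P (fun w => f (X 0 w))|) <= del -> (1 <= n)%N ->
     Ex P (fun w => csum n f w ^+ (2 * p)) <=
     C * \sum_(1 <= i < p.+1) (n%:R ^+ i * (del `^ r^-1) ^+ i * z `^ gam i)].
Proof.
case: GM => r [p [gam [Phi [C [r1 rdp C0 gamP [PhiP HM]]]]]].
pose c := nG (fun=> 1); have c0 : 0 <= c := nG_ge0 (G_cst 1).
have gam0 i : (1 <= i <= p)%N -> 0 <= gam i by move=> /gamP[].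
have [th [K [z0 [th0 th2 K0 z01 HK]]]] := small_multiple c0 gam0 PhiP.
exists r, p, gam, (th ^- (2 * p) * (C * K)), z0; split => //.
  by rewrite mulr_ge0// ?invr_ge0 ?exprn_ge0 ?(ltW th0)// mulr_ge0// ltW.
move=> f z del n Gf f1 zz nf del0 fdel n1.
have [PsiM Psi0] := PsiN.
have zpos : 0 <= z by rewrite (le_trans _ zz)// (le_trans ler01).
set m := Ex P (fun w => f (X 0 w)) in fdel.
have bf k : brv (fun w => f (X k w)) by exact: G_brv f1.
have m1 : `|m| <= 1 by apply: Ex_norm_le => // w; exact: f1.
(* The summand [0 * 1] gives [tf] the form of [G_lin]. *)
pose tf x := th * f x + 0 * 1.
have Gtf : G tf by apply: G_lin => //; exact: G_cst.
have tfE x : tf x = th * f x by rewrite /tf mul0r addr0.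
have mtf : fine (expE P (fun w => tf (X 0 w))) = th * m.
  rewrite -[LHS]/(Ex P (fun w => tf (X 0 w))) /m -ExZ//; congr Ex; apply/funext => w.
  exact: tfE.
have stf : (supn tf <= 1)%E.
  apply: ub_ereal_sup => _ [x _ <-]; rewrite lee_fin tfE normrM (gtr0_norm th0).
  by rewrite (le_trans (ler_pM _ _ th2 (f1 x)))// ?(ltW th0)// mulr1 invf_le1// ler1n.
have := HM tf Gtf stf n n1; rewrite /= mtf => {}HM.
have E1 : (\int[P]_w (`|\sum_(1 <= i < n.+1) (tf (X i w) - th * m)| ^+ (2 * p))%:E =
    (th ^+ (2 * p) * Ex P (fun w => csum n f w ^+ (2 * p)))%:E)%E.
  rewrite -ExZ; last by apply: brvX; exact: brv_csum f1.
  rewrite EFin_Ex; last by apply/brvZ/brvX; exact: brv_csum f1.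
  apply: eq_integral => w _; congr EFin.
  rewrite (_ : \sum_(1 <= i < n.+1) _ = th * csum n f w); last first.
    by rewrite /csum mulr_sumr; apply: eq_bigr => i _; rewrite tfE mulrBr.
  rewrite -normrX exprMn normrM !normrX (gtr0_norm th0); congr (_ * _).
  by rewrite -[RHS]ger0_norm ?normrX// exprM exprn_ge0// sqr_ge0.
rewrite {}E1 lee_fin in HM.
have th2p : 0 < th ^+ (2 * p) by rewrite exprn_gt0.
rewrite -mulrA ler_pdivlMl// (le_trans HM)// -mulrA ler_wpM2l ?(ltW C0)// mulr_sumr.
rewrite big_nat_cond [leRHS]big_nat_cond; apply: ler_sum => i; rewrite andbT ltnS => ip.
rewrite (_ : K * _ = n%:R ^+ i * (del `^ r^-1) ^+ i * (K * z `^ gam i)); last by ring.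
have bY : brv (fun w => th * (f (X 0 w) - m)) by apply/brvZ/brvB => //; exact: brv_cst.
have L1 : fine (Lnorm P r%:E (fun w => (tf (X 0 w) - th * m)%:E)) <= del `^ r^-1.
  rewrite (_ : (fun w => _) = fun w => (th * (f (X 0 w) - m))%:E); last first.
    by apply/funext => w; rewrite tfE mulrBr.
  have Y1 w : `|th * (f (X 0%N w) - m)| <= 1.
    rewrite normrM (gtr0_norm th0).
    have h2 : `|f (X 0 w) - m| <= 2.
      by rewrite (le_trans (ler_normB _ _))// -[leRHS]/(1 + 1) lerD.
    by rewrite (le_trans (ler_pM _ _ th2 h2))// ?(ltW th0)// mulVf.
  rewrite (le_trans (Lnorm_le_Ex P bY Y1 r1))//.
  apply: ge0_ler_powR; rewrite ?nnegrE ?Ex_ge0 ?invr_ge0//; first exact: le_trans ler01 r1.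
  rewrite (le_trans _ fdel)//; apply: Ex_le; first exact: brv_abs.
    by apply/brv_abs/brvB => //; exact: brv_cst.
  by move=> w; rewrite normrM (gtr0_norm th0) ler_piMl// (le_trans th2)// invf_le1// ler1n.
have L0 : 0 <= fine (Lnorm P r%:E (fun w => (tf (X 0 w) - th * m)%:E)).
  by apply: fine_ge0; exact: Lnorm_ge0.
have [[Pm Pp] _] := PhiP i ip.
have nGtf : nG (fun x => tf x - th * m) <= th * (2 * Psi z + c).
  rewrite (_ : (fun x => _) = fun x => th * f x + (- (th * m)) * 1); last first.
    by apply/funext => x; rewrite tfE mulr1.
  rewrite (le_trans (nG_lin _ _ Gf (G_cst 1)))// normrN normrM !(gtr0_norm th0).
  by rewrite -/c -mulrA -mulrDr ler_wpM2l ?(ltW th0)// lerD// ler_piMl.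
have Gtfm : G (fun x => tf x - th * m).
  rewrite (_ : (fun x => _) = fun x => th * f x + (- (th * m)) * 1); last first.
    by apply/funext => x; rewrite tfE mulr1.
  by apply: G_lin => //; exact: G_cst.
rewrite ler_pM ?mulr_ge0 ?exprn_ge0//; first by apply: Pp; exact: nG_ge0.
  by rewrite ler_wpM2l ?exprn_ge0// lerXn2r ?nnegrE ?powR_ge0.
rewrite (le_trans (Pm _ _ (nG_ge0 Gtfm) nGtf))//; exact: HK.
Qed.

End function_space.

Section deviations.
Context {R : realType} {d0 : measure_display} {T : measurableType d0}.
Variables (P : probability T R) (d : nat) (X : nat -> T -> 'I_d -> R).
Hypothesis d_gt0 : (0 < d)%N.
Hypothesis mX : forall n c, measurable_fun [set: T] (fun w => X n w c).
Variables (G : set (('I_d -> R) -> R)) (nG : (('I_d -> R) -> R) -> R).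
Hypothesis GS : seminormed_space G nG.
Variable Psi : R -> R.
Hypothesis PsiN : nondecr_nonneg Psi.
Hypothesis GM : moment_cond P X G nG Psi.

Definition nsum (n : nat) (f : ('I_d -> R) -> R) (w : T) : R :=
  (Num.sqrt n%:R)^-1 * csum P X n f w.

(** Uniform in [f], [n] and [A]. The bound [10 d / 2^k] is twice [d] times [5 / 2^k], the largest
    gap in quantile scale between the corners enclosing two compared functions; [(2^k)^-d] will
    compensate the number of links. *)
Definition deviation_bound (b C : R) (p k0 : nat) : Prop :=
  forall f k n (A : R), G f -> (forall x, `|f x| <= 1) -> (k0 <= k)%N ->
    nG f <= 2 * Psi (2 ^+ k) ->
    Ex P (fun w => `|f (X 0 w) - Ex P (fun w => f (X 0 w))|) <= 10 * d%:R / 2 ^+ k ->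
    (1 <= n)%N -> 1 <= A -> 4 ^+ k <= A * n%:R ->
    pr P [set w | b ^+ k < `|nsum n f w|] <=
      C * A ^+ p * (2 ^+ k)^-1 ^+ d * (b ^+ (2 * p)) ^+ k.

Lemma brv_nsum n f (M : R) : G f -> (forall x, `|f x| <= M) -> brv (nsum n f).
Proof. by move=> Gf fM; apply: brvZ; exact: (brv_csum P mX GS n Gf fM). Qed.

Lemma positive_lower_bound (f : nat -> R) p : (forall i, (1 <= i <= p)%N -> 0 < f i) ->
  exists2 kap : R, 0 < kap & forall i, (1 <= i <= p)%N -> kap <= f i.
Proof.
elim: p => [|p ih] f0; first by exists 1 => // -[].
have [|kap k0 Hk] := ih; first by move=> i /andP[i1 ip]; apply: f0; rewrite i1 leqW.
have fp : 0 < f p.+1 by apply: f0; rewrite /= leqnn.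
exists (Num.min kap (f p.+1)); first by rewrite lt_min k0.
move=> i /andP[i1]; rewrite leq_eqVlt => /predU1P[->|ip]; first by rewrite ge_min lexx orbT.
by rewrite ge_min Hk// i1.
Qed.

Let D : R := 10 * d%:R.

(** The three factors contribute the exponents [- 2 (p - i)], [- i / r] and [gam i] of [2^k]; their
    sum is at most [- d - kap]. *)
Lemma moment_term (r : R) (p : nat) (gam : nat -> R) (kap : R) (k n : nat) (A : R) (i : nat) :
  moment_exponents d r p gam -> (1 <= i <= p)%N -> 0 < kap ->
  kap <= i%:R / r + 2 * (p - i)%:R - d%:R - gam i ->
  1 <= A -> (1 <= n)%N -> 4 ^+ k <= A * n%:R ->
  n%:R ^- p * (n%:R ^+ i * ((D / 2 ^+ k) `^ r^-1) ^+ i * (2 ^+ k) `^ gam i) <=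
  A ^+ p * D ^+ p * ((2 ^+ k)^-1 ^+ d * 2 `^ (- (kap * k%:R))).
Proof.
move=> [r1 _ gamP] ip kap0 kapi A1 n1 kn.
have /andP[i1 ilep] := ip.
have r0 : 0 < r := lt_le_trans ltr01 r1.
have n0 : 0 < n%:R :> R by rewrite ltr0n.
have D1 : 1 <= D by rewrite /D -natrM ler1n muln_gt0.
have D0 : 0 <= D := le_trans ler01 D1.
have X2 m : 2 ^+ m = 2 `^ m%:R :> R by rewrite powR_mulrn.
have V2' m : (2 ^+ m)^-1 = 2 `^ (- m%:R) :> R by rewrite powRN powR_mulrn.
have nE : n%:R ^- p * n%:R ^+ i <= A ^+ p * 2 `^ (- (2 * (p - i)%:R * k%:R)).
  rewrite (_ : n%:R ^- p * n%:R ^+ i = (n%:R^-1) ^+ (p - i)); last first.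
    by rewrite -{1}(subnK ilep) exprD invfM exprVn divfK// expf_neq0// gt_eqF.
  have h : n%:R^-1 <= A * (4 ^+ k)^-1.
    rewrite -div1r ler_pdivrMr// mulrAC ler_pdivlMr ?exprn_gt0// mul1r//.
  rewrite (@le_trans _ _ ((A * (4 ^+ k)^-1) ^+ (p - i)))//.
    by rewrite lerXn2r ?nnegrE ?invr_ge0 ?mulr_ge0 ?invr_ge0 ?exprn_ge0 ?(le_trans ler01 A1)// ltW.
  rewrite exprMn ler_pM ?exprn_ge0 ?invr_ge0 ?exprn_ge0 ?(le_trans ler01 A1)//.
    by rewrite ler_weXn2l// leq_subr.
  rewrite (_ : 4 = 2 ^+ 2); last by ring.
  by rewrite -exprM V2' -powR_mulrn ?powR_ge0// -powRrM !natrM mulNr mulrAC.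
have dE : ((D / 2 ^+ k) `^ r^-1) ^+ i <= D ^+ p * 2 `^ (- (k%:R * (i%:R / r))).
  rewrite -powR_mulrn ?powR_ge0// -powRrM powRM ?invr_ge0 ?exprn_ge0//.
  rewrite V2' -powRrM ler_pM ?powR_ge0//.
    rewrite -(powR_mulrn p D0); apply: ler_powR => //.
    rewrite (@le_trans _ _ i%:R) ?ler_nat// mulrC ler_piMr// invf_le1//.
  by rewrite mulNr (mulrC r^-1).
have gE' : (2 ^+ k) `^ gam i = 2 `^ (k%:R * gam i) by rewrite X2 -powRrM.
rewrite gE' !mulrA.
have h0 : 0 <= (n%:R : R) ^- p * n%:R ^+ i by rewrite mulr_ge0 ?invr_ge0 ?exprn_ge0.
rewrite (@le_trans _ _ (A ^+ p * 2 `^ (- (2 * (p - i)%:R * k%:R)) *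
   (D ^+ p * 2 `^ (- (k%:R * (i%:R / r)))) * 2 `^ (k%:R * gam i)))//.
  by rewrite ler_wpM2r ?powR_ge0// ler_pM// exprn_ge0// powR_ge0.
rewrite (_ : (2 ^+ k)^-1 ^+ d = 2 `^ (- (k%:R * d%:R))); last first.
  by rewrite V2' -powR_mulrn ?powR_ge0// -powRrM mulNr.
have nz (x : R) : 2 `^ x != 0 by rewrite powR_eq0 (_ : 2 == 0 :> R = false)//; apply/negbTE.
rewrite (_ : A ^+ p * _ * _ * _ = A ^+ p * D ^+ p * (2 `^ (- (2 * (p - i)%:R * k%:R)) *
   2 `^ (- (k%:R * (i%:R / r))) * 2 `^ (k%:R * gam i))); last by ring.
rewrite -[leRHS]mulrA ler_wpM2l ?mulr_ge0 ?exprn_ge0// ?(le_trans ler01 A1)//.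
rewrite -!powRD; try by apply/implyP => _.
apply: ler_powR; first by rewrite ler1n.
have := ler0n R k; nra.
Qed.

Lemma deviation : exists (b C : R) (p k0 : nat), [/\ 0 < b < 1, 0 <= C, (0 < p)%N &
  deviation_bound b C p k0].
Proof.
have [r [p [gam [C [z0 [mexp C0 z01 HM]]]]]] := moment_bound mX GS PsiN GM.
have [r1 rdp gamP] := mexp.
have p0 : (0 < p)%N.
  rewrite -(ltr_nat R) (le_lt_trans _ rdp)// mulr_ge0// (le_trans ler01)//.
have [kap kap0 Hkap] := @positive_lower_bound
  (fun i => i%:R / r + 2 * (p - i)%:R - d%:R - gam i) p
  (fun i ip => ltac:(by rewrite subr_gt0; exact: (gamP i ip).2)).
(* Chosen so that [b^(4 p) = 2^(- kap)]: Markov's inequality at threshold [b^k] consumes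
   [b^(2 p k)], and as much is left for the probability. *)
pose b : R := 2 `^ (- (kap / (4 * p)%:R)).
have p40 : 0 < (4 * p)%:R :> R by rewrite ltr0n muln_gt0.
have b0 : 0 < b by rewrite powR_gt0.
have b1 : b < 1.
  rewrite /b /powR ifF; last by apply/negbTE; rewrite pnatr_eq0.
  by rewrite expR_lt1 mulNr oppr_lt0 mulr_gt0 ?divr_gt0// ln_gt0// ltr1n.
exists b, (C * p%:R * D ^+ p), p, (Num.bound z0).
have D0 : 0 <= D by rewrite /D mulr_ge0.
split => //; first by rewrite b0 b1.
  by rewrite !mulr_ge0// exprn_ge0.
move=> f k n A Gf f1 kk nf fdel n1 A1 kn.
have zk : z0 <= 2 ^+ k.
  rewrite (le_trans (ltW (archi_boundP (le_trans ler01 z01))))//.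
  rewrite (@le_trans _ _ k%:R) ?ler_nat// -natrX ler_nat ltnW// ltn_expl//.
have del0 : 0 <= D / 2 ^+ k by rewrite divr_ge0 ?exprn_ge0.
have {HM} := HM f (2 ^+ k) (D / 2 ^+ k) n Gf f1 zk nf del0 fdel n1 => HM.
have bS := brv_csum P mX GS n Gf f1.
have bV : brv (nsum n f) by exact: brv_nsum Gf f1.
have n0 : 0 < n%:R :> R by rewrite ltr0n.
have E1 : Ex P (fun w => nsum n f w ^+ (2 * p)) = n%:R ^- p * Ex P (fun w => csum P X n f w ^+ (2 * p)).
  rewrite -ExZ; last exact: brvX.
  congr Ex; apply/funext => w; rewrite /nsum exprMn; congr (_ * _).
  by rewrite exprVn exprM sqr_sqrtr// ler0n.
have b2p : 0 < (b ^+ (2 * p)) ^+ k by rewrite !exprn_gt0.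
have E2 : (b ^+ (2 * p)) ^+ k * pr P [set w | b ^+ k < `|nsum n f w|] <=
    Ex P (fun w => nsum n f w ^+ (2 * p)).
  apply: pr_markov.
  - by apply: measurable_gt_cst; exact: brv_meas (brv_abs bV).
  - exact: brvX.
  - by move=> w; rewrite exprM exprn_ge0// sqr_ge0.
  move=> w /= h; rewrite exprAC (_ : nsum n f w ^+ (2 * p) = `|nsum n f w| ^+ (2 * p)).
    by rewrite lerXn2r ?nnegrE ?exprn_ge0 ?(ltW b0)// ltW.
  by rewrite -normrX ger0_norm// exprM exprn_ge0// sqr_ge0.
have E3 : Ex P (fun w => nsum n f w ^+ (2 * p)) <=
    C * p%:R * (A ^+ p * D ^+ p * ((2 ^+ k)^-1 ^+ d * 2 `^ (- (kap * k%:R)))).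
  rewrite E1 (le_trans (ler_wpM2l _ HM)) ?invr_ge0 ?exprn_ge0// mulrCA -mulrA ler_wpM2l//.
  rewrite mulr_sumr big_nat_cond.
  rewrite (@le_trans _ _ (\sum_(1 <= i < p.+1 | (1 <= i < p.+1)%N && true)
     (A ^+ p * D ^+ p * ((2 ^+ k)^-1 ^+ d * 2 `^ (- (kap * k%:R))))))//.
    apply: ler_sum => i; rewrite andbT ltnS => ip.
    exact: (moment_term mexp ip kap0 (Hkap i ip) A1 n1 kn).
  by rewrite -big_nat_cond sumr_const_nat subn1/= -[leLHS]mulr_natl.
have bE : 2 `^ (- (kap * k%:R)) = (b ^+ (2 * p)) ^+ k * (b ^+ (2 * p)) ^+ k.
  rewrite -exprD -exprM -powR_mulrn ?(ltW b0)// /b -powRrM; congr (_ `^ _).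
  rewrite !(natrD, natrM); field.
  by rewrite pnatr_eq0 -lt0n.
rewrite -(ler_pM2l b2p) (le_trans E2)// (le_trans E3)// bE le_eqVlt; apply/orP; left; apply/eqP.
by ring.
Qed.

End deviations.

(** * Level functions and chaining *)

Section levels.
Context {R : realType} {d0 : measure_display} {T : measurableType d0}.
Variables (P : probability T R) (d : nat) (X : nat -> T -> 'I_d -> R).
Hypothesis d_gt0 : (0 < d)%N.
Hypothesis mX : forall n c, measurable_fun [set: T] (fun w => X n w c).
Hypothesis cF : cdf_continuous P X.
Variables (G : set (('I_d -> R) -> R)) (nG : (('I_d -> R) -> R) -> R).
Hypothesis GS : seminormed_space G nG.
Variable Psi : R -> R.
Hypothesis GC : control_fun G nG (marg P X) Psi.

Local Notation Fb := (Fbar P X).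
Local Notation q := (quantile P X).

Lemma quantile_mono i u v : u <= v -> (q i u <= q i v)%E.
Proof.
rewrite le_eqVlt => /predU1P[->//|uv].
have [u0|u0] := leP u 0; first by rewrite /quantile u0 leNye.
have [v1|v1] := leP 1 v.
  by rewrite [leRHS]/quantile (leNgt v) (lt_trans u0 uv)/= v1 leey.
apply/ltW/lt_quantile => //; rewrite Fbar_quantile// /clamp01.
rewrite !leNgt u0 (lt_trans u0 uv) v1 (lt_trans uv v1)//=.
Qed.

(* The level function of index [j] interpolates, in each coordinate, between the
   quantiles (j - 2)/2^k and (j - 1)/2^k, where [j] ranges over 0, ..., 2^k + 1. *)
Definition lower (k : nat) (j : 'I_d -> nat) (i : 'I_d) : \bar R :=
  q i (((j i)%:R - 2) / 2 ^+ k).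
Definition upper (k : nat) (j : 'I_d -> nat) (i : 'I_d) : \bar R :=
  q i (((j i)%:R - 1) / 2 ^+ k).

(** The sandwich and the seminorm bound are asked on the grid only, so that a level function exists
    for every [j] and can be chosen for all [j] at once. *)
Definition level_fun (k : nat) (j : 'I_d -> nat) (f : ('I_d -> R) -> R) : Prop :=
  [/\ G f, forall x, 0 <= f x <= 1 &
   (forall i, (j i <= 2 ^ k + 1)%N) ->
   (forall x, \1_[set y | leE y (lower k j)] x <= f x <= \1_[set y | leE y (upper k j)] x) /\
   nG f <= Psi (2 ^+ k)].

Lemma indic01 (A : set ('I_d -> R)) x : 0 <= (\1_A x : R) <= 1.
Proof. by rewrite indicE; case: (_ \in _); rewrite ?lexx ler01. Qed.

Lemma level_fun_ex k j : exists f, level_fun k j f.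
Proof.
have [[PsiM Psi0] GC2] := GC.
have G0 : G (fun=> 0) by exact: G_cst GS _.
have p2 : 0 < 2 ^+ k :> R by rewrite exprn_gt0.
have [jr|jr] := pselect (forall i, (j i <= 2 ^ k + 1)%N); last first.
  by exists (fun=> 0); split => // x; rewrite lexx ler01.
(* If some [j i <= 1], both corners are [-oo] in that coordinate and the control function does not
   apply; the zero function is then the level function. *)
have [j2|j2] := pselect (forall i, (2 <= j i)%N); last first.
  exists (fun=> 0); split => [//|x|_]; first by rewrite lexx ler01.
  split.
    move=> x; rewrite (andP (indic01 _ _)).1 andbT indicE memNset//=.
    have [i hi] : exists i, ~ (2 <= j i)%N.
      by apply: contrapT => h; apply: j2 => i; apply: contrapT => hi; apply: h; exists i.
    move=> /(_ i); rewrite /lower /quantile ifT//.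
    rewrite pmulr_lle0 ?invr_gt0// subr_le0 (ler_nat _ _ 2); lia.
  have := nG_lin GS 0 0 G0 G0; rewrite normr0 !mul0r addr0.
  by move=> /le_trans; apply; rewrite Psi0// ltW.
have ab i : (lower k j i < upper k j i)%E /\ (2 ^+ k)^-1 <= Fb i (upper k j i) - Fb i (lower k j i).
  have c1 : clamp01 (((j i)%:R - 2) / 2 ^+ k) = ((j i)%:R - 2) / 2 ^+ k :> R.
    rewrite /clamp01; case: (leP _ 0) => h1.
      apply/esym/eqP; by rewrite eq_le h1 divr_ge0 ?(ltW p2)// subr_ge0 (ler_nat _ 2 _) j2.
    case: (leP 1 _) => // h2; move: h2; rewrite ler_pdivlMr// mul1r lerBrDr.
    by rewrite -natrX -(natrD _ _ 2) ler_nat; have := jr i; lia.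
  have c2 : clamp01 (((j i)%:R - 1) / 2 ^+ k) = ((j i)%:R - 1) / 2 ^+ k :> R.
    rewrite /clamp01; case: (leP _ 0) => h1.
      move: h1; rewrite pmulr_lle0 ?invr_gt0// subr_le0 (ler_nat _ _ 1); have := j2 i; lia.
    case: (leP 1 _) => // h2; apply/eqP; rewrite eq_le h2/= ler_pdivrMr// mul1r lerBlDr.
    by rewrite -natrX -(natrD _ _ 1) ler_nat jr.
  rewrite !Fbar_quantile// c1 c2; split; last first.
    rewrite -mulrBl -[leLHS]mul1r ler_pM2r ?invr_gt0//; lra.
  apply: lt_quantile => //; rewrite Fbar_quantile// c1 c2 ltr_pM2r ?invr_gt0//; lra.
have [phi [Gphi phiB phiN]] := GC2 (lower k j) (upper k j) (fun i => (ab i).1).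
exists phi; split => // [x|_].
  have /andP[h1 h2] := phiB x.
  have /andP[h3 _] := indic01 [set y | leE y (lower k j)] x.
  have /andP[_ h4] := indic01 [set y | leE y (upper k j)] x.
  by rewrite (le_trans h3 h1) (le_trans h2 h4).
split => //; rewrite (le_trans phiN)//.
have h : (2 ^+ k)^-1 <= \big[Num.min/1]_(i < d) modc (marg P X i) (upper k j i - lower k j i)%E.
  apply: (big_ind (fun x : R => (2 ^+ k)^-1 <= x)).
  - by rewrite invf_le1// exprn_ege1// ler1n.
  - by move=> x y hx hy; rewrite le_min hx hy.
  - by move=> i _; rewrite (le_trans (ab i).2)// modc_ge// (ab i).1.
have h0 : 0 < (2 ^+ k)^-1 :> R by rewrite invr_gt0.
apply: PsiM; first by rewrite divr_ge0// (le_trans (ltW h0)).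
by rewrite ler_pdivrMr ?(lt_le_trans h0)// -ler_pdivrMl// mulr1.
Qed.

Lemma Ex_between f g (lo hi : 'I_d -> \bar R) (M : R) : G f -> G g ->
  (forall x, `|f x| <= M) -> (forall x, `|g x| <= M) ->
  (forall x, \1_[set y | leE y lo] x <= f x <= \1_[set y | leE y hi] x) ->
  (forall x, \1_[set y | leE y lo] x <= g x <= \1_[set y | leE y hi] x) ->
  Ex P (fun w => `|f (X 0 w) - g (X 0 w)|) <= \sum_i Num.max 0 (Fb i (hi i) - Fb i (lo i)).
Proof.
move=> Gf Gg fM gM fb gb.
have bf := G_brv mX GS 0%N Gf fM; have bg := G_brv mX GS 0%N Gg gM.
rewrite (le_trans _ (pr_leE_diff P mX lo hi))// -!Ex_indic; try exact: measurable_leE.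
have bl := @brv_indic R _ _ _ (measurable_leE mX 0%N lo).
have bh := @brv_indic R _ _ _ (measurable_leE mX 0%N hi).
rewrite -ExB//; apply: (Ex_le P (brv_abs (brvB bf bg)) (brvB bh bl)) => w.
have ind t : \1_[set w | leE (X 0 w) t] w = \1_[set y | leE y t] (X 0%N w) :> R by rewrite !indicE.
by rewrite !ind; have := fb (X 0%N w); have := gb (X 0%N w); rewrite ler_norml; lra.
Qed.

Lemma Ex_center f : brv f -> Ex P (fun w => `|f w - Ex P f|) <= 2 * Ex P (fun w => `|f w|).
Proof.
move=> bf; have ba := brv_abs bf.
rewrite (@le_trans _ _ (Ex P (fun w => `|f w| + `|Ex P f|)))//.
  apply: Ex_le; first by apply/brv_abs/brvB => //; exact: brv_cst.
    by apply: brvD => //; exact: brv_cst.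
  by move=> w; exact: ler_normB.
rewrite ExD//; last exact: brv_cst.
rewrite Ex_cst; have := Ex_norm P bf; lra.
Qed.

Lemma quantile_gap (u v : 'I_d -> R) (c : R) : 0 <= c -> (forall i, v i - u i = c) ->
  \sum_i Num.max 0 (Fb i (q i (v i)) - Fb i (q i (u i))) <= d%:R * c.
Proof.
move=> c0 uv; rewrite (@le_trans _ _ (\sum_(i < d) c))//; last first.
  by rewrite sumr_const card_ord mulr_natl.
apply: ler_sum => i _; rewrite ge_max c0/= !Fbar_quantile//.
have := clamp01_lip (v i) (u i); rewrite uv (ger0_norm c0); apply: le_trans.
exact: ler_norm.
Qed.

Lemma nsumB n f g (M : R) w : G f -> G g -> (forall x, `|f x| <= M) -> (forall x, `|g x| <= M) ->
  nsum P X n (fun x => f x - g x) w = nsum P X n f w - nsum P X n g w.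
Proof.
move=> Gf Gg fM gM.
have bf := G_brv mX GS 0%N Gf fM; have bg := G_brv mX GS 0%N Gg gM.
rewrite /nsum -mulrBr /csum -sumrB ExB//; congr (_ * _); apply: eq_bigr => i _; ring.
Qed.

End levels.

Section codes.
Variable d : nat.

(* All grid points of all levels are numbered by a single natural number, so that
   a field is a sequence. *)
Definition code (k : nat) (j : 'I_d -> nat) : nat := pickle (k, [ffun i => j i]).

Definition grid (k : nat) : finType := {ffun 'I_d -> 'I_(2 ^ k).+2}.

Definition gval (k : nat) (m : grid k) : 'I_d -> nat := fun i => m i.

Lemma gval_ex k (j : 'I_d -> nat) : (forall i, (j i <= 2 ^ k + 1)%N) -> exists m : grid k, gval m = j.
Proof.
move=> jk; exists [ffun i => inord (j i)]; apply/funext => i.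
by rewrite /gval ffunE inordK// ltnS -[X in (_ <= X)%N]addn1.
Qed.

Lemma gval_le k (m : grid k) i : (gval m i <= 2 ^ k + 1)%N.
Proof. by rewrite /gval addn1 -ltnS. Qed.

(** Links allow shifts up to [3] because the lower corner of index [j + 3] is at quantile
    [(j + 1) / 2^k], the first one above a point of index [j]. *)
Definition shifted (k : nat) (j e : 'I_d -> nat) : 'I_d -> nat :=
  fun i => minn (j i + e i) (2 ^ k + 1).

Definition halved (j : 'I_d -> nat) : 'I_d -> nat := fun i => (j i)./2.

(* Links at level [k]: [Some (m, Some e)] compares neighbouring grid points,
   [Some (m, None)] compares with the coarser level, [None] is the top corner. *)
Definition link (k : nat) : finType := option (grid k * option {ffun 'I_d -> 'I_4}).

Definition link_src k (l : link k) : nat :=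
  match l with
  | Some (m, _) => code k (gval m)
  | None => code k (fun=> 2 ^ k)%N
  end.

Definition link_tgt k (l : link k) : nat :=
  match l with
  | Some (m, Some e) => code k (shifted k (gval m) (fun i => e i))
  | Some (m, None) => code k.-1 (halved (gval m))
  | None => code k (fun=> 0)%N
  end.

(** [18 = 3 * 6]: [2^k + 2 <= 3 * 2^k] for each coordinate, and [4^d + 2 <= 6^d] counts the shifts,
    the coarser level and the top corner. *)
Lemma card_link k : (0 < d)%N -> (#|link k| <= 18 ^ d * (2 ^ k) ^ d)%N.
Proof.
move=> d0; rewrite card_option card_prod card_option !card_ffun !card_ord.
have h1 : ((2 ^ k).+2 ^ d <= 3 ^ d * (2 ^ k) ^ d)%N.
  by rewrite -expnMn leq_exp2r//; have := expn_gt0 2 k; lia.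
have h2 : (4 ^ d + 2 <= 6 ^ d)%N.
  case: (d) d0 => // e _; elim: e => // e ih.
  by rewrite expnS [X in (_ <= X)%N]expnS; lia.
have h3 : (0 < (2 ^ k).+2 ^ d)%N by rewrite expn_gt0.
rewrite (_ : 18 = 3 * 6)%N// expnMn mulnAC.
rewrite (leq_trans _ (leq_mul h1 h2))//; nia.
Qed.

End codes.

Section bad_events.
Context {R : realType} {d0 : measure_display} {T : measurableType d0}.
Variables (P : probability T R) (d : nat) (Y : T -> nat -> R).
Hypothesis d_gt0 : (0 < d)%N.
Hypothesis mY : forall j, measurable_fun [set: T] (fun w => Y w j).

Definition bad k (x : R) : set T :=
  [set w | exists l : link d k, x < `|Y w (link_src l) - Y w (link_tgt l)|].

Lemma badE k x : bad k x = \big[setU/set0]_(l : link d k)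
  [set w | x < `|Y w (link_src l) - Y w (link_tgt l)|].
Proof.
apply/seteqP; split => w.
  by move=> [l hl]; rewrite (bigD1 l)//=; left.
rewrite /bad /=; elim/big_ind: _ => //= [A B hA hB [/hA|/hB]//|l _ h]; by exists l.
Qed.

Lemma measurable_link k x (l : link d k) :
  measurable [set w | x < `|Y w (link_src l) - Y w (link_tgt l)|].
Proof.
apply: measurable_gt_cst; apply: measurableT_comp => //.
by apply: measurable_funB.
Qed.

Lemma measurable_bad k x : measurable (bad k x).
Proof. rewrite badE; apply: bigsetU_measurable => l _; exact: measurable_link. Qed.

Lemma pr_bad k (x c : R) : 0 <= c ->
  (forall l : link d k, pr P [set w | x < `|Y w (link_src l) - Y w (link_tgt l)|] <=
      c * (2 ^+ k)^-1 ^+ d) ->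
  pr P (bad k x) <= 18 ^+ d * c.
Proof.
move=> c0 h; rewrite badE (le_trans (pr_bigcup_fin P _ (fun l _ => measurable_link x l)))//.
rewrite (le_trans (ler_sum _ (fun l _ => h l)))// sumr_const -[leLHS]mulr_natl.
have := card_link k d_gt0; rewrite -(ler_nat R) natrM !natrX => hc.
have e0 : 0 < (2 ^+ k) ^+ d :> R by rewrite !exprn_gt0.
rewrite exprVn mulrA ler_pdivrMr// mulrAC ler_wpM2r//.
Qed.

End bad_events.

Section level_deviations.
Context {R : realType} {d0 : measure_display} {T : measurableType d0}.
Variables (P : probability T R) (d : nat) (X : nat -> T -> 'I_d -> R).
Hypothesis d_gt0 : (0 < d)%N.
Hypothesis mX : forall n c, measurable_fun [set: T] (fun w => X n w c).
Hypothesis cF : cdf_continuous P X.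
Variables (G : set (('I_d -> R) -> R)) (nG : (('I_d -> R) -> R) -> R).
Hypothesis GS : seminormed_space G nG.
Variable Psi : R -> R.
Hypothesis PsiN : nondecr_nonneg Psi.
Variable psi : nat -> ('I_d -> nat) -> ('I_d -> R) -> R.
Hypothesis psiP : forall k j, level_fun P X G nG Psi k j (psi k j).

Local Notation q := (quantile P X).

Lemma psi_G k j : G (psi k j). Proof. by case: (psiP k j). Qed.

Lemma psi_bd k j x : 0 <= psi k j x <= 1. Proof. by case: (psiP k j). Qed.

Lemma psi_norm k j x : `|psi k j x| <= 1.
Proof. by have /andP[h1 h2] := psi_bd k j x; rewrite ger0_norm. Qed.

Lemma indic_leE_le (a b : 'I_d -> \bar R) x : (forall i, (a i <= b i)%E) ->
  \1_[set y | leE y a] x <= \1_[set y | leE y b] x :> R.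
Proof.
move=> ab; rewrite !indicE; case: (boolP (x \in [set y | leE y a])) => h; last by case: (_ \in _); rewrite ?ler01.
rewrite mem_set// => i; move: h; rewrite inE => /(_ i) h; exact: le_trans (ab i).
Qed.

Lemma psi_sandwich k j (u v : 'I_d -> R) x : (forall i, (j i <= 2 ^ k + 1)%N) ->
  (forall i, u i <= ((j i)%:R - 2) / 2 ^+ k) -> (forall i, ((j i)%:R - 1) / 2 ^+ k <= v i) ->
  \1_[set y | leE y (fun i => q i (u i))] x <= psi k j x <=
  \1_[set y | leE y (fun i => q i (v i))] x.
Proof.
move=> jk ju jv; have [_ _ /(_ jk)[/(_ x)/andP[h1 h2] _]] := psiP k j.
rewrite (le_trans (indic_leE_le _ _) h1) ?(le_trans h2 (indic_leE_le _ _))// => i;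
  exact: quantile_mono.
Qed.

Lemma psi_nG k k' j : (forall i, (j i <= 2 ^ k + 1)%N) -> (k <= k')%N ->
  nG (psi k j) <= Psi (2 ^+ k').
Proof.
move=> jk kk; have [_ _ /(_ jk)[_ h]] := psiP k j.
rewrite (le_trans h)//; case: PsiN => mono _; apply: mono; rewrite ?exprn_ge0//.
by rewrite ler_weXn2l// ler1n.
Qed.

Lemma Ex_diff_center f g (u v : 'I_d -> R) (c : R) : G f -> G g ->
  (forall x, `|f x| <= 1) -> (forall x, `|g x| <= 1) -> 0 <= c ->
  (forall i, v i - u i = c) ->
  (forall x, \1_[set y | leE y (fun i => q i (u i))] x <= f x <=
     \1_[set y | leE y (fun i => q i (v i))] x) ->
  (forall x, \1_[set y | leE y (fun i => q i (u i))] x <= g x <=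
     \1_[set y | leE y (fun i => q i (v i))] x) ->
  Ex P (fun w => `|(f (X 0 w) - g (X 0 w)) - Ex P (fun w => f (X 0 w) - g (X 0 w))|) <=
  2 * (d%:R * c).
Proof.
move=> Gf Gg f1 g1 c0 uv fb gb.
have bf := G_brv mX GS 0%N Gf f1; have bg := G_brv mX GS 0%N Gg g1.
rewrite (le_trans (Ex_center P (brvB bf bg)))// ler_wpM2l//.
rewrite (le_trans (Ex_between P mX GS Gf Gg f1 g1 fb gb))//.
exact: quantile_gap.
Qed.

Definition coded_sum (n : nat) (w : T) (c : nat) : R :=
  match (unpickle c : option (nat * {ffun 'I_d -> nat})) with
  | Some kj => nsum P X n (psi kj.1 kj.2) w
  | None => 0
  end.

Lemma coded_sum_code n w k j : coded_sum n w (code k j) = nsum P X n (psi k j) w.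
Proof.
rewrite /coded_sum /code pickleK /=; congr (nsum _ _ _ _ _); congr psi.
by apply/funext => i; rewrite ffunE.
Qed.

Lemma brv_coded_sum n c : brv (fun w => coded_sum n w c).
Proof.
rewrite /coded_sum; case: unpickle => [kj|]; last exact: brv_cst.
exact: (brv_nsum P mX GS n (@psi_G _ _) (@psi_norm _ _)).
Qed.

Lemma measurable_coded_sum n c : measurable_fun [set: T] (fun w => coded_sum n w c).
Proof. exact: brv_meas (brv_coded_sum n c). Qed.

(** At index [0] the upper corner is [-oo], and no real vector lies below it since [d > 0]. The link
    of the top corner can therefore be compared with index [0]. *)
Lemma psi_0 k x : psi k (fun=> 0%N) x = 0.
Proof.
have := @psi_sandwich k (fun=> 0%N) (fun=> - 2 / 2 ^+ k) (fun=> 0) x.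
have p2 : 0 < (2 ^+ k)^-1 :> R by rewrite invr_gt0 exprn_gt0.
case/(_ _ _ _)/andP => //.
  by move=> i; rewrite ler_pM2r//; lra.
move=> h1 h2; apply/eqP; rewrite eq_le (andP (psi_bd k (fun=> 0%N) x)).1 andbT (le_trans h2)//.
rewrite indicE memNset//= => /(_ (Ordinal d_gt0)).
by rewrite /quantile lexx.
Qed.

Lemma nsum_psi0 n k w : nsum P X n (psi k (fun=> 0%N)) w = 0.
Proof.
rewrite /nsum /csum; under eq_bigr do rewrite psi_0.
rewrite (_ : (fun w => psi k _ (X 0 w)) = fun=> 0) ?Ex_cst ?subrr ?big1 ?mulr0//.
by apply/funext => w'; rewrite psi_0.
Qed.

Variables (b C : R) (p k0 : nat).
Hypothesis b01 : 0 < b < 1.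
Hypothesis C_ge0 : 0 <= C.
Hypothesis p_gt0 : (0 < p)%N.
Hypothesis dev : deviation_bound P X G nG Psi b C p k0.

(** A common pair of corners, [c / 2^k] apart in quantile scale, makes the difference small in
    [L^1], so that [dev] applies to it. *)
Lemma pair_deviation k n (A : R) f g (u : 'I_d -> R) (c : R) : G f -> G g ->
  (forall x, 0 <= f x <= 1) -> (forall x, 0 <= g x <= 1) -> 0 <= c -> c <= 5 ->
  (forall x, \1_[set y | leE y (fun i => q i (u i / 2 ^+ k))] x <= f x <=
     \1_[set y | leE y (fun i => q i ((u i + c) / 2 ^+ k))] x) ->
  (forall x, \1_[set y | leE y (fun i => q i (u i / 2 ^+ k))] x <= g x <=
     \1_[set y | leE y (fun i => q i ((u i + c) / 2 ^+ k))] x) ->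
  nG f <= Psi (2 ^+ k) -> nG g <= Psi (2 ^+ k) ->
  (k0 <= k)%N -> (1 <= n)%N -> 1 <= A -> 4 ^+ k <= A * n%:R ->
  pr P [set w | b ^+ k < `|nsum P X n f w - nsum P X n g w|] <=
    C * A ^+ p * (2 ^+ k)^-1 ^+ d * (b ^+ (2 * p)) ^+ k.
Proof.
move=> Gf Gg f01 g01 c0 c5 fb gb nf ng kk n1 A1 kn.
have f1 x : `|f x| <= 1 by have /andP[h1 h2] := f01 x; rewrite ger0_norm.
have g1 x : `|g x| <= 1 by have /andP[h1 h2] := g01 x; rewrite ger0_norm.
have fgE : (fun x => f x - g x) = (fun x => 1 * f x + (-1) * g x).
  by apply/funext => x; rewrite mul1r mulN1r.
have -> : [set w | b ^+ k < `|nsum P X n f w - nsum P X n g w|] =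
    [set w | b ^+ k < `|nsum P X n (fun x => f x - g x) w|].
  by apply/seteqP; split => w /=; rewrite (nsumB P mX GS n w Gf Gg f1 g1).
have p2 : 0 < (2 ^+ k)^-1 :> R by rewrite invr_gt0 exprn_gt0.
apply: dev => //.
- by rewrite fgE; exact: (G_lin GS).
- by move=> x; have := f01 x; have := g01 x; rewrite ler_norml; lra.
- rewrite fgE (le_trans (nG_lin GS _ _ Gf Gg))// normrN !normr1 !mul1r; lra.
rewrite (le_trans (@Ex_diff_center f g (fun i => u i / 2 ^+ k) (fun i => (u i + c) / 2 ^+ k) (c / 2 ^+ k) _ _ _ _ _ _ _ _))//.
- by rewrite divr_ge0// exprn_ge0.
- by move=> i; rewrite -mulrBl; congr (_ / _); ring.
rewrite !mulrA ler_pM2r//; move: dev => _.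
have : c * d%:R <= 5 * d%:R by rewrite ler_wpM2r.
lra.
Qed.

(** The function of the top corner is close to the constant [1], from which it differs only if some
    coordinate is above its quantile of order [1 - 2 / 2^k]; constants do not contribute to centred
    sums. *)
Lemma top_deviation k n (A : R) : (k0 <= k)%N -> (1 <= n)%N -> 1 <= A -> 4 ^+ k <= A * n%:R ->
  pr P [set w | b ^+ k < `|nsum P X n (psi k (fun=> 2 ^ k)%N) w|] <=
    C * A ^+ p * (2 ^+ k)^-1 ^+ d * (b ^+ (2 * p)) ^+ k.
Proof.
move=> kk n1 A1 kn; pose j (_ : 'I_d) := (2 ^ k)%N; rewrite -/j.
have jk i : (j i <= 2 ^ k + 1)%N by rewrite /j addn1.
have p2 : 0 < (2 ^+ k)^-1 :> R by rewrite invr_gt0 exprn_gt0.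
have Ps0 : 0 <= Psi (2 ^+ k) by case: PsiN => _; apply; rewrite exprn_ge0.
apply: dev => //.
- exact: psi_G.
- exact: psi_norm.
- by rewrite (le_trans (psi_nG jk (leqnn k)))//; lra.
have bf := G_brv mX GS 0%N (psi_G k j) (@psi_norm _ _).
have c11 (x : 'I_d -> R) : `|(fun=> 1) x| <= 1 :> R by rewrite normr1.
have := @Ex_diff_center (psi k j) (fun=> 1) (fun=> ((2 ^ k)%:R - 2) / 2 ^+ k) (fun=> 1) (2 / 2 ^+ k)
  (psi_G _ _) (G_cst GS 1) (@psi_norm _ _) c11.
rewrite ExB//; last exact: brv_cst.
rewrite Ex_cst (_ : (fun w => `|_|) = (fun w => `|psi k j (X 0 w) - Ex P (fun w => psi k j (X 0 w))|)); last first.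
  by apply/funext => w; congr `|_|; ring.
move=> /(_ _ _ _ _)/le_trans; apply; last first.
- by rewrite !mulrA ler_pM2r// mulrAC ler_wpM2r// -natrM ler_nat.
- move=> x; rewrite (andP (indic01 _ _)).2/= indicE mem_set// => i /=.
  by rewrite /quantile (leNgt 1) ltr01/= lexx leey.
- move=> x; apply: psi_sandwich => // i; rewrite ler_pdivrMr ?exprn_gt0// mul1r natrX; move: c11 => _; lra.
- by move=> i; rewrite natrX; field; rewrite expf_neq0.
- by rewrite divr_ge0// exprn_ge0.
Qed.

Lemma gval_shift_le k (m e : 'I_d -> nat) i : (shifted k m e i <= 2 ^ k + 1)%N.
Proof. by rewrite geq_minr. Qed.

Lemma link_deviation k n (A : R) (l : link d k) : (0 < k)%N -> (k0 <= k)%N -> (1 <= n)%N ->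
  1 <= A -> 4 ^+ k <= A * n%:R ->
  pr P [set w | b ^+ k < `|coded_sum n w (link_src l) - coded_sum n w (link_tgt l)|] <=
    C * A ^+ p * (b ^+ (2 * p)) ^+ k * (2 ^+ k)^-1 ^+ d.
Proof.
move=> k_gt0 kk n1 A1 kn; rewrite -mulrA (mulrC ((b ^+ _) ^+ _)) mulrA.
have p2 : 0 < (2 ^+ k)^-1 :> R by rewrite invr_gt0 exprn_gt0.
case: l => [[m [e|]]|] /=; last first.
- rewrite (_ : [set w | _] = [set w | b ^+ k < `|nsum P X n (psi k (fun=> 2 ^ k)%N) w|]).
    exact: top_deviation.
  by apply/seteqP; split => w /=; rewrite !coded_sum_code nsum_psi0 subr0.
- rewrite (_ : [set w | _] = [set w | b ^+ k <
    `|nsum P X n (psi k (gval m)) w - nsum P X n (psi k.-1 (halved (gval m))) w|]); last first.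
    by apply/seteqP; split => w /=; rewrite !coded_sum_code.
  have hm i : (halved (gval m) i <= 2 ^ k.-1 + 1)%N.
    have := gval_le m i; have := expnS 2 k.-1; rewrite (prednK k_gt0) /halved; lia.
  have hk : 2 ^+ k = 2 * 2 ^+ k.-1 :> R by rewrite -exprS prednK.
  have h2 i : exists2 r : R, (gval m i)%:R = 2 * (halved (gval m) i)%:R + r & 0 <= r <= 1.
    exists (odd (gval m i))%:R; last by rewrite ler0n lern1 leq_b1.
    by rewrite /halved -{1}(odd_double_half (gval m i)) natrD addrC -muln2 natrM mulrC.
  have q2 : 0 < (2 ^+ k.-1)^-1 :> R by rewrite invr_gt0 exprn_gt0.
  have he x : x / 2 ^+ k.-1 = 2 * x / 2 ^+ k :> R by rewrite hk; field; rewrite expf_neq0.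
  (* With [j = 2 h + r] and [r <= 1], the window from [j - 5] to [j - 1] contains both
     [[j - 2, j - 1]] and, in units of level [k], [[2 h - 4, 2 h - 2]]. *)
  apply: (@pair_deviation _ _ _ _ _ (fun i => (gval m i)%:R - 5) 4) => //; try exact: psi_G;
    try exact: psi_bd; try lra.
  + move=> x; apply: psi_sandwich => [i|i|i]; rewrite ?gval_le// ler_pM2r//; lra.
  + move=> x; apply: psi_sandwich => [i|i|i]; rewrite ?hm// he// ler_pM2r//;
      have [r -> /andP[r0 r1]] := h2 i; lra.
  + exact: psi_nG (gval_le m) _.
  + exact: psi_nG hm (leq_pred k).
- rewrite (_ : [set w | _] = [set w | b ^+ k <
    `|nsum P X n (psi k (gval m)) w - nsum P X n (psi k (shifted k (gval m) (fun i => e i))) w|]); last first.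
    by apply/seteqP; split => w /=; rewrite !coded_sum_code.
  have hs i : (gval m i)%:R <= ((shifted k (gval m) (fun i => e i) i)%:R : R) <= (gval m i)%:R + (3 : R).
    rewrite -(natrD _ _ 3) !ler_nat /shifted leq_min gval_le leq_addr/=.
    by rewrite geq_min leq_add2l -ltnS ltn_ord.
  (* A shifted index lies in [[j, j + 3]], so its corners stay between [j - 2] and [j + 2]. *)
  apply: (@pair_deviation _ _ _ _ _ (fun i => (gval m i)%:R - 2) 4) => //; try exact: psi_G;
    try exact: psi_bd; try lra.
  + move=> x; apply: psi_sandwich => [i|i|i]; rewrite ?gval_le// ler_pM2r//; lra.
  + move=> x; apply: psi_sandwich => [i|i|i]; rewrite ?gval_shift_le// ler_pM2r//;
      have /andP[] := hs i; lra.
  + exact: psi_nG (gval_le m) _.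
  + by apply: psi_nG => // i; exact: gval_shift_le.
Qed.

Lemma pr_bad_coded_sum k n (A : R) : (0 < k)%N -> (k0 <= k)%N -> (1 <= n)%N ->
  1 <= A -> 4 ^+ k <= A * n%:R ->
  pr P (bad d (coded_sum n) k (b ^+ k)) <= 18 ^+ d * (C * A ^+ p) * (b ^+ (2 * p)) ^+ k.
Proof.
move=> k_gt0 kk n1 A1 kn; have /andP[b0 b1] := b01.
rewrite -mulrA; apply: pr_bad => //; first exact: measurable_coded_sum.
  by rewrite !mulr_ge0 ?exprn_ge0// ?(ltW b0)// (le_trans ler01 A1).
by move=> l; exact: link_deviation.
Qed.

End level_deviations.

Section chaining.
Context {R : realType} {d0 : measure_display} {T : measurableType d0}.
Variables (P : probability T R) (d : nat) (X : nat -> T -> 'I_d -> R).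
Hypothesis mX : forall n c, measurable_fun [set: T] (fun w => X n w c).

Local Notation Fb := (Fbar P X).

Definition level_index (k : nat) (t : 'I_d -> \bar R) (i : 'I_d) : nat := Num.truncn (2 ^+ k * Fb i (t i)).

Lemma level_index_itv k t i : (level_index k t i)%:R <= 2 ^+ k * Fb i (t i) < (level_index k t i).+1%:R.
Proof. by apply: truncn_itv; rewrite mulr_ge0 ?exprn_ge0 ?Fbar_ge0. Qed.

Lemma level_index_eq k t i m : m%:R <= 2 ^+ k * Fb i (t i) < m.+1%:R -> level_index k t i = m.
Proof. by move=> h; apply/eqP; rewrite truncn_eq// mulr_ge0 ?exprn_ge0 ?Fbar_ge0. Qed.

Lemma level_index_le k t i : (level_index k t i <= 2 ^ k)%N.
Proof.
have /andP[h _] := level_index_itv k t i; rewrite -(ler_nat R) (le_trans h)// natrX ler_piMr ?exprn_ge0//.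
exact: Fbar_le1.
Qed.

Lemma level_index_half k t : halved (level_index k.+1 t) = level_index k t.
Proof.
apply/funext => i; apply/esym/level_index_eq; have := level_index_itv k.+1 t i; rewrite exprS /halved.
set j := level_index k.+1 t i; rewrite -[in X in X -> _](odd_double_half j) -muln2.
rewrite -![_.+1%:R]natr1 !natrD !natrM.
have : 0 <= ((odd j)%:R : R) <= 1 by rewrite ler0n lern1 leq_b1.
lra.
Qed.

Definition step_path (u : nat -> R) k t : R := u (code k (level_index k t)).

Definition good_links (u : nat -> R) k (x : R) := forall l : link d k, `|u (link_src l) - u (link_tgt l)| <= x.

Lemma step_path_refine u k x t : good_links u k.+1 x -> `|step_path u k.+1 t - step_path u k t| <= x.
Proof.
have [m hm] : exists m : grid d k.+1, gval m = level_index k.+1 t.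
  by apply: gval_ex => i; rewrite (leq_trans (level_index_le _ _ _))// leq_addr.
by move=> /(_ (Some (m, None))); rewrite /= hm level_index_half.
Qed.

Lemma good_shift u k x (j : 'I_d -> nat) (e : 'I_d -> nat) : good_links u k x ->
  (forall i, (j i <= 2 ^ k + 1)%N) -> (forall i, (e i <= 3)%N) ->
  `|u (code k j) - u (code k (shifted k j e))| <= x.
Proof.
move=> gu /gval_ex[m <-] e3.
have := gu (Some (m, Some [ffun i => inord (e i)])) => /=.
by rewrite (_ : (fun i => _) = e)//; apply/funext => i; rewrite ffunE inordK// ltnS.
Qed.

(** The right-hand side telescopes exactly, as [b / (1 - b) * (b^i - b^(i + 1)) = b^(i + 1)]; a
    bound by the whole geometric tail would not pass through the induction. *)
Lemma step_path_chain u (b s : R) k m t : 0 < b < 1 ->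
  (forall k', (k < k')%N -> (k' <= k + m)%N -> good_links u k' (s * b ^+ k')) ->
  `|step_path u (k + m) t - step_path u k t| <= s * (b / (1 - b)) * (b ^+ k - b ^+ (k + m)).
Proof.
move=> /andP[b0 b1]; elim: m => [|m ih] gu; first by rewrite addn0 !subrr normr0 mulr0.
have {}ih := ih (fun k' h1 h2 => gu k' h1 (leq_trans h2 (leq_add (leqnn k) (leqnSn m)))).
have := @step_path_refine u (k + m) (s * b ^+ (k + m).+1) t; rewrite addnS => h.
have {}h : `|step_path u (k + m).+1 t - step_path u (k + m) t| <= s * b ^+ (k + m).+1.
  by apply: h; apply: gu; rewrite ?addnS// ltnS leq_addr.
rewrite -(subrKA (step_path u (k + m) t)) (le_trans (ler_normD _ _))// (le_trans (lerD h ih))//.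
rewrite le_eqVlt; apply/orP; left; apply/eqP; rewrite exprS; field.
by rewrite subr_eq0 gt_eqF.
Qed.

End chaining.

Lemma geometric_le (R : realType) (rho : R) k m : 0 <= rho < 1 -> (k <= m)%N ->
  \sum_(k <= i < m) rho ^+ i <= rho ^+ k / (1 - rho).
Proof.
move=> /andP[r0 r1] /subnK <-; have r1' : 0 < 1 - rho by rewrite subr_gt0.
rewrite ler_pdivlMr// (_ : _ * _ = rho ^+ k - rho ^+ (m - k + k)) ?gerBl ?exprn_ge0//.
elim: (m - k)%N => [|n ih]; first by rewrite big_geq// mul0r subrr.
by rewrite addSn big_nat_recr ?leq_addl//= mulrDl ih exprS; ring.
Qed.

(** * Comparison of the empirical process with step paths *)

Section sandwich.
Context {R : realType} {d0 : measure_display} {T : measurableType d0}.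
Variables (P : probability T R) (d : nat) (X : nat -> T -> 'I_d -> R).
Hypothesis d_gt0 : (0 < d)%N.
Hypothesis mX : forall n c, measurable_fun [set: T] (fun w => X n w c).
Hypothesis cF : cdf_continuous P X.
Variables (G : set (('I_d -> R) -> R)) (nG : (('I_d -> R) -> R) -> R).
Hypothesis GS : seminormed_space G nG.
Variable Psi : R -> R.
Hypothesis PsiN : nondecr_nonneg Psi.
Variable psi : nat -> ('I_d -> nat) -> ('I_d -> R) -> R.
Hypothesis psiP : forall k j, level_fun P X G nG Psi k j (psi k j).

Local Notation Fb := (Fbar P X).
Local Notation q := (quantile P X).
Local Notation level_index := (level_index P X).

Lemma clamp01_le (x z : R) : 0 <= z -> x <= z -> clamp01 x <= z.
Proof. by rewrite /clamp01; case: (leP x 0) => // _ _; case: (leP 1 x) => // h; exact: le_trans. Qed.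

Lemma le_clamp01 (x z : R) : z <= 1 -> z <= x -> z <= clamp01 x.
Proof. by rewrite /clamp01; case: (leP x 0) => [h _ h'|_]; [exact: le_trans h|case: (leP 1 x)]. Qed.

Lemma Ex_psi_le k j (v : 'I_d -> R) : (forall i, (j i <= 2 ^ k + 1)%N) ->
  (forall i, ((j i)%:R - 1) / 2 ^+ k <= v i) ->
  Ex P (fun w => psi k j (X 0 w)) <= pr P [set w | leE (X 0 w) (fun i => q i (v i))].
Proof.
move=> jk jv; have mL := measurable_leE mX 0%N (fun i => q i (v i)).
rewrite -(Ex_indic P mL); apply: Ex_le; first exact: (G_brv mX GS 0%N (psi_G psiP k j) (psi_norm psiP _ _)).
  exact: (@brv_indic R).
move=> w; have := psi_sandwich mX cF psiP (X 0%N w) jk (fun i => lexx _) jv => /andP[_].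
by rewrite !indicE.
Qed.

Lemma Ex_psi_ge k j (u : 'I_d -> R) : (forall i, (j i <= 2 ^ k + 1)%N) ->
  (forall i, u i <= ((j i)%:R - 2) / 2 ^+ k) ->
  pr P [set w | leE (X 0 w) (fun i => q i (u i))] <= Ex P (fun w => psi k j (X 0 w)).
Proof.
move=> jk ju; have mL := measurable_leE mX 0%N (fun i => q i (u i)).
rewrite -(Ex_indic P mL); apply: Ex_le; last first.
- move=> w; have := psi_sandwich mX cF psiP (X 0%N w) jk ju (fun i => lexx _) => /andP[+ _].
  by rewrite !indicE.
- exact: (G_brv mX GS 0%N (psi_G psiP k j) (psi_norm psiP _ _)).
exact: (@brv_indic R).
Qed.

Lemma sum_max_le (f : 'I_d -> R) (c : R) : 0 <= c -> (forall i, f i <= c) ->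
  \sum_i Num.max 0 (f i) <= d%:R * c.
Proof.
move=> c0 fc; rewrite (@le_trans _ _ (\sum_(i < d) c))//; last by rewrite sumr_const card_ord mulr_natl.
by apply: ler_sum => i _; rewrite ge_max c0 fc.
Qed.

Definition top k : 'I_d -> nat := fun=> (2 ^ k)%N.

(** The upper corner is one unit below the index, hence strictly below [Fbar i (t i)]; strictness is
    what orders the quantile and [t i] where [Fbar i] is flat. *)
Lemma psi_le_indic k t x : psi k (level_index k t) x <= \1_[set y | leE y t] x.
Proof.
have jk i : (level_index k t i <= 2 ^ k + 1)%N by rewrite (leq_trans (level_index_le P mX _ _ _))// leq_addr.
have /andP[_ h] := psi_sandwich mX cF psiP x jk (fun i => lexx _) (fun i => lexx _).
rewrite (le_trans h)//; apply: indic_leE_le => i.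
have p2 : 0 < 2 ^+ k :> R by rewrite exprn_gt0.
have [j0|j0] := posnP (level_index k t i); first by rewrite j0 /quantile ifT ?leNye// pmulr_lle0 ?invr_gt0// sub0r oppr_le0.
apply/ltW/(quantile_lt mX cF); have /andP[h1 _] := level_index_itv P X k t i.
have F0 : 0 < Fb i (t i).
  by rewrite -(pmulr_rgt0 _ p2) (lt_le_trans _ h1)// ltr0n.
rewrite (@le_lt_trans _ _ (Num.max 0 (((level_index k t i)%:R - 1) / 2 ^+ k)))//.
  by apply: clamp01_le; rewrite le_max lexx ?orbT.
by rewrite gt_max F0 ltr_pdivrMr// mulrC (lt_le_trans _ h1)// gtrDl oppr_lt0.
Qed.

(** Where the shift is not capped, the lower corner is above [t]. Where it is capped, the lower
    corner equals the upper corner of [top k], and the points [x] beyond that corner are paid for by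
    [1 - psi k (top k) x = 1]. *)
Lemma indic_le_psi k t x :
  \1_[set y | leE y t] x <= psi k (shifted k (level_index k t) (fun=> 3%N)) x + (1 - psi k (top k) x).
Proof.
have p2 : 0 < 2 ^+ k :> R by rewrite exprn_gt0.
set l := shifted _ _ _.
have lk i : (l i <= 2 ^ k + 1)%N by exact: gval_shift_le.
have tk i : (top k i <= 2 ^ k + 1)%N by rewrite leq_addr.
have bl := psi_bd psiP k l x; have bt := psi_bd psiP k (top k) x.
have [xt|xt] := pselect (leE x t); last by rewrite indicE memNset//=; lra.
rewrite indicE mem_set//.
have [h|h] := pselect (leE x (fun i => q i (((top k i)%:R - 1) / 2 ^+ k))); last first.
  have /andP[_] := psi_sandwich mX cF psiP x tk (fun i => lexx _) (fun i => lexx _).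
  by rewrite indicE memNset//=; lra.
have /andP[+ _] := psi_sandwich mX cF psiP x lk (fun i => lexx _) (fun i => lexx _).
rewrite indicE mem_set; first by lra.
move=> i; have := xt i; have := h i; rewrite /l /shifted /top.
case: (leqP (level_index k t i + 3) (2 ^ k + 1)) => hj h1 h2; last first.
  by rewrite (le_trans h1)// (quantile_mono mX cF)// ler_pM2r ?invr_gt0// natrD; lra.
rewrite (le_trans h2)//; have /andP[_ h3] := level_index_itv P X k t i.
have [h4|h4] := leP 1 (((level_index k t i + 3)%:R - 2) / 2 ^+ k : R).
  by rewrite /quantile (leNgt _ 0) (lt_le_trans ltr01 h4)/= h4 leey.
apply/ltW/(lt_quantile mX cF).
rewrite (@lt_le_trans _ _ (((level_index k t i + 3)%:R - 2) / 2 ^+ k))//.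
  by rewrite ltr_pdivlMr// mulrC (lt_le_trans h3)// natrD -natr1; lra.
by apply: le_clamp01 => //; exact: ltW.
Qed.

Lemma bias_lower k t : Defs.cdf P X t - Ex P (fun w => psi k (level_index k t) (X 0 w)) <= d%:R * (4 / 2 ^+ k).
Proof.
have p2 : 0 < 2 ^+ k :> R by rewrite exprn_gt0.
have jk i : (level_index k t i <= 2 ^ k + 1)%N by rewrite (leq_trans (level_index_le P mX _ _ _))// leq_addr.
have h1 := Ex_psi_ge jk (fun i => lexx _).
have h2 := pr_leE_diff P mX (fun i => q i (((level_index k t i)%:R - 2) / 2 ^+ k)) t.
apply: (@le_trans _ _ (pr P [set w | leE (X 0 w) t] -
   pr P [set w | leE (X 0 w) (fun i => q i (((level_index k t i)%:R - 2) / 2 ^+ k))])).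
  by rewrite lerD2l lerN2.
rewrite (le_trans h2)//; apply: sum_max_le => [|i]; first by rewrite divr_ge0 ?exprn_ge0.
rewrite Fbar_quantile//; have /andP[h3 h4] := level_index_itv P X k t i.
have : (((level_index k t i)%:R - 2) / 2 ^+ k) <= clamp01 (((level_index k t i)%:R - 2) / 2 ^+ k) :> R.
  apply: le_clamp01 => //; rewrite ler_pdivrMr// mul1r.
  have := level_index_le P mX k t i; rewrite -(ler_nat R) natrX; lra.
have : Fb i (t i) <= ((level_index k t i)%:R + 1) / 2 ^+ k by rewrite ler_pdivlMr// mulrC natr1 ltW.
have : 0 < (2 ^+ k)^-1 :> R by rewrite invr_gt0.
rewrite !mulrDl; lra.
Qed.

Lemma bias_upper k t : Ex P (fun w => psi k (shifted k (level_index k t) (fun=> 3%N)) (X 0 w)) +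
  (1 - Ex P (fun w => psi k (top k) (X 0 w))) - Defs.cdf P X t <= d%:R * (4 / 2 ^+ k).
Proof.
have p2 : 0 < 2 ^+ k :> R by rewrite exprn_gt0.
have q2 : 0 < (2 ^+ k)^-1 :> R by rewrite invr_gt0.
set l := shifted _ _ _.
have lk i : (l i <= 2 ^ k + 1)%N by exact: gval_shift_le.
have tk i : (top k i <= 2 ^ k + 1)%N by rewrite leq_addr.
have h1 := Ex_psi_le lk (fun i => lexx _).
have h2 := pr_leE_diff P mX t (fun i => q i (((l i)%:R - 1) / 2 ^+ k)).
have h3 := Ex_psi_ge tk (fun i => lexx _).
have h4 := pr_leE_diff P mX (fun i => q i (((top k i)%:R - 2) / 2 ^+ k)) (fun=> +oo%E).
have h5 : pr P [set w | leE (X 0 w) (fun=> +oo%E)] = 1.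
  by rewrite (_ : [set w | _] = setT) ?pr_setT//; apply/seteqP; split => w //= _ i; exact: leey.
have h6 : \sum_i Num.max 0 (Fb i (q i (((l i)%:R - 1) / 2 ^+ k)) - Fb i (t i)) <= d%:R * (2 / 2 ^+ k).
  apply: sum_max_le => [|i]; first by rewrite divr_ge0 ?exprn_ge0.
  rewrite Fbar_quantile// lerBlDr; have /andP[h6 _] := level_index_itv P X k t i.
  have F0 := Fbar_ge0 P X i (t i).
  apply: clamp01_le; first by rewrite addr_ge0// mulr_ge0// ltW.
  have : (level_index k t i)%:R / 2 ^+ k <= Fb i (t i) by rewrite ler_pdivrMr// mulrC.
  have : ((l i)%:R - 1) / 2 ^+ k <= ((level_index k t i)%:R + 2) / 2 ^+ k :> R.
    rewrite ler_pM2r// lerBlDr -(natrD _ _ 2) -(natrD _ _ 1) ler_nat /l /shifted geq_min.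
    by rewrite -addnA leqnn.
  rewrite !mulrDl; lra.
have h7 : \sum_i Num.max 0 (Fb i +oo%E - Fb i (q i (((top k i)%:R - 2) / 2 ^+ k))) <= d%:R * (2 / 2 ^+ k).
  apply: sum_max_le => [|i]; first by rewrite divr_ge0 ?exprn_ge0.
  rewrite Fbary Fbar_quantile//.
  have : ((top k i)%:R - 2) / 2 ^+ k <= clamp01 (((top k i)%:R - 2) / 2 ^+ k) :> R.
    apply: le_clamp01 => //; rewrite ler_pdivrMr// mul1r natrX; lra.
  rewrite /top natrX mulrBl divff ?gt_eqF//; lra.
rewrite -[Defs.cdf P X t]/(pr P [set w | leE (X 0 w) t]).
rewrite (_ : d%:R * (4 / 2 ^+ k) = d%:R * (2 / 2 ^+ k) + d%:R * (2 / 2 ^+ k)); last by ring.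
lra.
Qed.

(** The shift and the top corner cost one link each. The bias [4 d / 2^k] per observation becomes
    [sqrt n * 4 d / 2^k], which [A n <= 4^(k + 1)] bounds by [8 d / sqrt A]. *)
Lemma Uemp_near n w t k (A x : R) : (1 <= n)%N -> 0 < A -> A * n%:R <= 4 ^+ k.+1 ->
  @good_links R d (coded_sum P X psi n w) k x ->
  `|Uemp P X n w t - step_path P X (coded_sum P X psi n w) k t| <= 2 * x + 8 * d%:R / Num.sqrt A.
Proof.
move=> n1 A0 An gw.
have n0 : 0 < n%:R :> R by rewrite ltr0n.
have sn0 : 0 < Num.sqrt n%:R :> R by rewrite sqrtr_gt0.
have sA0 : 0 < Num.sqrt A by rewrite sqrtr_gt0.
have p2 : 0 < 2 ^+ k :> R by rewrite exprn_gt0.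
pose B : R := d%:R * (4 / 2 ^+ k).
have B8 : (Num.sqrt n%:R)^-1 * (n%:R * B) <= 8 * d%:R / Num.sqrt A.
  rewrite mulrA (_ : (Num.sqrt n%:R)^-1 * n%:R = Num.sqrt n%:R); last first.
    by rewrite -{2}(sqr_sqrtr (ltW n0)) expr2 mulrA mulVf ?mul1r// gt_eqF.
  rewrite ler_pdivlMr// (_ : _ * _ * _ = (Num.sqrt A * Num.sqrt n%:R) * B); last by ring.
  rewrite -sqrtrM ?(ltW A0)//.
  have h : Num.sqrt (A * n%:R) <= 2 * 2 ^+ k.
    rewrite (le_trans (ler_wsqrtr An))// (_ : 4 ^+ k.+1 = (2 ^+ k.+1) ^+ 2 :> R).
      by rewrite sqrtr_sqr ger0_norm ?exprS// -exprS exprn_ge0.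
    by rewrite exprAC; congr (_ ^+ _); ring.
  have B0 : 0 <= B by rewrite /B mulr_ge0// divr_ge0// ltW.
  rewrite (le_trans (ler_wpM2r B0 h))// /B le_eqVlt; apply/orP; left; apply/eqP.
  by field; rewrite gt_eqF.
set j := level_index k t; set l := shifted k j (fun=> 3%N).
have jk i : (j i <= 2 ^ k + 1)%N by rewrite (leq_trans (level_index_le P mX _ _ _))// leq_addr.
have Vj : step_path P X (coded_sum P X psi n w) k t = nsum P X n (psi k j) w by rewrite /step_path coded_sum_code.
have hl : `|nsum P X n (psi k j) w - nsum P X n (psi k l) w| <= x.
  by rewrite -!coded_sum_code; exact: good_shift.
have ht : `|nsum P X n (psi k (top k)) w| <= x.
  by have := gw None; rewrite /= !coded_sum_code (nsum_psi0 d_gt0 mX cF psiP) subr0.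
have S1 : csum P X n (psi k j) w - n%:R * B <=
    \sum_(1 <= i < n.+1) (\1_[set x | leE x t] (X i w) - Defs.cdf P X t).
  have -> : n%:R * B = \sum_(1 <= i < n.+1) B by rewrite sumr_const_nat subn1 mulr_natl.
  rewrite /csum -sumrB; apply: ler_sum => i _.
  have := bias_lower k t; have := psi_le_indic k t (X i w); rewrite /B -/j; lra.
have S2 : \sum_(1 <= i < n.+1) (\1_[set x | leE x t] (X i w) - Defs.cdf P X t) <=
    csum P X n (psi k l) w - csum P X n (psi k (top k)) w + n%:R * B.
  have -> : n%:R * B = \sum_(1 <= i < n.+1) B by rewrite sumr_const_nat subn1 mulr_natl.
  rewrite /csum -sumrB -big_split/=; apply: ler_sum => i _.
  have := bias_upper k t; have := indic_le_psi k t (X i w); rewrite /B -/l; lra.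
have isn : 0 <= (Num.sqrt n%:R)^-1 :> R by rewrite invr_ge0 ltW.
have {}S1 := ler_wpM2l isn S1; have {}S2 := ler_wpM2l isn S2.
move: S1 S2; rewrite mulrBr mulrDr mulrBr -/(nsum P X n (psi k j) w).
rewrite -/(nsum P X n (psi k l) w) -/(nsum P X n (psi k (top k)) w) -/(Uemp P X n w t) => S1 S2.
rewrite Vj; move: hl ht; rewrite !ler_norml; lra.
Qed.

Variables (b C : R) (p k0 : nat).
Hypothesis b01 : 0 < b < 1.
Hypothesis C_ge0 : 0 <= C.
Hypothesis p_gt0 : (0 < p)%N.
Hypothesis dev : deviation_bound P X G nG Psi b C p k0.

Lemma Uemp_step_path (e : R) : 0 < e -> exists k1, forall k, (k1 <= k)%N -> exists N, forall n, (N <= n)%N ->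
  exists B : set T, [/\ measurable B, pr P B <= e &
    forall w, ~ B w -> forall t, `|Uemp P X n w t - step_path P X (coded_sum P X psi n w) k t| <= e].
Proof.
move=> e0; have /andP[b0 b1] := b01.
have d0' : 0 < d%:R :> R by rewrite ltr0n.
(* [sqrt A >= 16 d / e] makes the bias at most [e / 2]; the [1 +] ensures [A >= 1], as [dev]
   requires. *)
pose A : R := (1 + 16 * d%:R / e) ^+ 2.
have sA : Num.sqrt A = 1 + 16 * d%:R / e.
  by rewrite sqrtr_sqr ger0_norm// addr_ge0// divr_ge0 ?mulr_ge0// ltW.
have q0 : 0 < 16 * d%:R / e by rewrite divr_gt0 ?mulr_gt0.
have A1 : 1 <= A by rewrite /A exprn_ege1//; lra.
have A0 : 0 < A := lt_le_trans ltr01 A1.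
have hA : 8 * d%:R / Num.sqrt A <= e / 2.
  rewrite sA ler_pdivrMr; last by lra.
  rewrite mulrDr mulr1 (_ : e / 2 * (16 * d%:R / e) = 8 * d%:R); last by field; rewrite gt_eqF.
  by rewrite lerDr divr_ge0// ltW.
pose rho := b ^+ (2 * p).
have rho01 : 0 <= rho < 1.
  by rewrite exprn_ge0 ?(ltW b0)//= exprn_ilt1 ?(ltW b0)// muln_eq0/= -lt0n p_gt0.
have r1 : 0 < 1 - rho by rewrite subr_gt0; case/andP: rho01.
pose c1 := 18 ^+ d * (C * A ^+ p).
have c10 : 0 <= c1 by rewrite /c1 mulr_ge0 ?exprn_ge0// mulr_ge0// exprn_ge0// ltW.
have b1' : 0 < 1 - b by rewrite subr_gt0.
have [k2 H2] := @expr_small R (c1 / (1 - rho)) rho e rho01 (divr_ge0 c10 (ltW r1)) e0.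
have b01' : 0 <= b < 1 by rewrite ltW.
have bb0 : 0 <= b / (1 - b) by rewrite divr_ge0// ltW.
have e2 : 0 < e / 2 by rewrite divr_gt0.
(* [b / (1 - b)] is the chaining from level [k] to the last level, [2] the links used there by
   [Uemp_near]. *)
have [k3 H3] := @expr_small R (b / (1 - b) + 2) b (e / 2) b01' (addr_ge0 bb0 (ler0n R 2)) e2.
exists (maxn (maxn k0 1) (maxn k2 k3)) => k; rewrite !geq_max => /andP[/andP[kk0 kk1] /andP[kk2 kk3]].
exists (4 ^ k)%N => n nk.
have n1 : (1 <= n)%N by rewrite (leq_trans _ nk)// expn_gt0.
have An : 4 ^+ k <= A * n%:R.
  rewrite -natrX (@le_trans _ _ n%:R) ?ler_nat// ler_peMl//.
(* The last level with [4^K <= A * n]: the moment bound applies up to [K], and [A * n <= 4^(K + 1)]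
   suits [Uemp_near]. *)
pose K := trunc_log 4 (Num.truncn (A * n%:R)).
have An0 : 0 <= A * n%:R by rewrite mulr_ge0// ltW.
have /andP[t1 t2] := truncn_itv An0.
have tk : (4 ^ k <= Num.truncn (A * n%:R))%N.
  by rewrite -ltnS -(ltr_nat R) (le_lt_trans _ t2)// natrX.
have tr0 : (0 < Num.truncn (A * n%:R))%N by rewrite (leq_trans _ tk)// expn_gt0.
have /andP[K1 K2] : (4 ^ K <= Num.truncn (A * n%:R) < 4 ^ K.+1)%N.
  by rewrite trunc_logP//= trunc_log_ltn.
have kK : (k <= K)%N by rewrite -ltnS -(@ltn_exp2l 4)// (leq_ltn_trans tk).
have AK : 4 ^+ K <= A * n%:R by rewrite (le_trans _ t1)// -natrX ler_nat.
have AK' : A * n%:R <= 4 ^+ K.+1 by rewrite (le_trans (ltW t2))// -natrX ler_nat.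
pose B := \big[setU/set0]_(k <= i < K.+1) bad d (coded_sum P X psi n) i (b ^+ i).
have mbad i : measurable (bad d (coded_sum P X psi n) i (b ^+ i)).
  by apply: measurable_bad => j; exact: (@measurable_coded_sum R _ _ P d X mX G nG GS Psi psi psiP n j).
have notB w : ~ B w -> forall i, (k <= i <= K)%N -> @good_links R d (coded_sum P X psi n w) i (b ^+ i).
  move=> nB i ikK l; rewrite leNgt; apply/negP => h; apply: nB.
  by rewrite /B -bigcup_seq; exists i => //=; [rewrite mem_index_iota ltnS|exists l].
exists B; split.
- exact: bigsetU_measurable.
- rewrite (le_trans (pr_bigcup_fin P _ (fun i _ => mbad i)))//.
  rewrite (@le_trans _ _ (\sum_(k <= i < K.+1) c1 * rho ^+ i))//.
    rewrite big_nat_cond [leRHS]big_nat_cond; apply: ler_sum => i; rewrite andbT ltnS => /andP[ki iK].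
    have h := @pr_bad_coded_sum R _ _ P d X d_gt0 mX cF G nG GS Psi PsiN psi psiP b C p k0 b01 C_ge0 p_gt0 dev i n A.
    apply: h => //.
    + exact: leq_trans ki.
    + exact: leq_trans ki.
    + by rewrite (le_trans _ AK)// ler_weXn2l// ler1n.
  rewrite -mulr_sumr (le_trans (ler_wpM2l c10 (geometric_le rho01 (leqW kK))))//.
  by rewrite mulrA mulrAC H2.
move=> w /notB gw t.
have g1 := @Uemp_near n w t K A (b ^+ K) n1 A0 AK' (gw K ltac:(by rewrite kK leqnn)).
have g2 : `|step_path P X (coded_sum P X psi n w) K t - step_path P X (coded_sum P X psi n w) k t| <= b / (1 - b) * b ^+ k.
  have := @step_path_chain R _ _ P d X mX (coded_sum P X psi n w) b 1 k (K - k) t b01.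
  rewrite subnKC// !mul1r => h; rewrite (le_trans (h _))//.
    by move=> k' h1 h2; rewrite mul1r; apply: gw; rewrite h2 ltnW.
  by rewrite ler_wpM2l// gerBl exprn_ge0// ltW.
have g3 : b ^+ K <= b ^+ k by rewrite ler_wiXn2l ?(ltW b0) ?(ltW b1).
have g4 := H3 k kk3.
rewrite -(subrKA (step_path P X (coded_sum P X psi n w) K t)) (le_trans (ler_normD _ _))//.
rewrite (le_trans (lerD g1 g2))//; move: g4; rewrite mulrDl; lra.
Qed.

End sandwich.

(** * The limit process *)

Section limit_process.
Context {R : realType} {d0 : measure_display} {T : measurableType d0}.
Variables (P : probability T R) (d : nat) (X : nat -> T -> 'I_d -> R).
Hypothesis d_gt0 : (0 < d)%N.
Hypothesis mX : forall n c, measurable_fun [set: T] (fun w => X n w c).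
Hypothesis cF : cdf_continuous P X.
Variables (G : set (('I_d -> R) -> R)) (nG : (('I_d -> R) -> R) -> R).
Hypothesis GS : seminormed_space G nG.
Hypothesis GL : clt_cond P X G.
Variable Psi : R -> R.
Hypothesis PsiN : nondecr_nonneg Psi.
Hypothesis GM : moment_cond P X G nG Psi.
Variable psi : nat -> ('I_d -> nat) -> ('I_d -> R) -> R.
Hypothesis psiP : forall k j, level_fun P X G nG Psi k j (psi k j).
Hypothesis psiG : forall k j, nG (psi k j) <= Psi (2 ^+ k).

Local Notation V := (coded_sum P X psi).

Definition coded (c : nat) : ('I_d -> R) -> R :=
  match (unpickle c : option (nat * {ffun 'I_d -> nat})) with
  | Some kj => psi kj.1 kj.2
  | None => fun=> 0
  end.

Lemma coded_G c : G (coded c).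
Proof. by rewrite /coded; case: unpickle => [kj|]; [exact: (psi_G psiP)|exact: (G_cst GS)]. Qed.

Lemma coded_norm c x : `|coded c x| <= 1.
Proof. by rewrite /coded; case: unpickle => [kj|]; rewrite ?normr0//; exact: (psi_norm psiP). Qed.

Lemma coded_nG c : exists k, nG (coded c) <= Psi (2 ^+ k).
Proof.
rewrite /coded; case: unpickle => [kj|]; first by exists kj.1.
exists 0%N; have := nG_lin GS 0 0 (G_cst GS 0) (G_cst GS 0).
rewrite normr0 !mul0r addr0 => /le_trans; apply.
by case: PsiN => _; apply; rewrite exprn_ge0.
Qed.

Lemma coded_sumE n w c : V n w c = nsum P X n (coded c) w.
Proof.
rewrite /coded_sum /coded; case: unpickle => [kj//|].
by rewrite /nsum /csum Ex_cst subrr big1 ?mulr0.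
Qed.

Let bV := brv_coded_sum mX GS psiP.

(** From the moments of order [2 p], by [y <= 1 + y^p]; after division by [n^p] the powers
    [n^(i - p)] are at most [1]. At a fixed code the crude mean deviation [2] is enough. *)
Lemma coded_sum_second_moment c : exists B : R, forall n, Ex P (fun w => V n w c ^+ 2) <= B.
Proof.
have [r [p [gam [C [z0 [[r1 rdp gamP] C0 z01 HM]]]]]] := moment_bound mX GS PsiN GM.
have p0 : (0 < p)%N.
  rewrite -(ltr_nat R) (le_lt_trans _ rdp)// mulr_ge0// (le_trans ler01)//.
have [k Hk] := coded_nG c.
pose z : R := Num.max z0 (2 ^+ k).
pose S := C * \sum_(1 <= i < p.+1) ((2 `^ r^-1) ^+ i * z `^ gam i).
have S0 : 0 <= S by rewrite mulr_ge0// sumr_ge0// => i _; rewrite mulr_ge0 ?exprn_ge0 ?powR_ge0.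
exists (1 + S) => n.
have bVc : brv (fun w => nsum P X n (coded c) w) by exact: (brv_nsum P mX GS n (coded_G c) (@coded_norm c)).
have E1 : Ex P (fun w => V n w c ^+ 2) <= 1 + Ex P (fun w => V n w c ^+ (2 * p)).
  rewrite -{1}(Ex_cst P 1) -ExD; [|exact: brv_cst|exact/brvX/bV].
  apply: (Ex_le P (brvX 2 (bV n c)) (brvD (brv_cst _) (brvX _ (bV n c)))) => w.
  rewrite exprM; set y := _ ^+ 2; have y0 : 0 <= y by exact: sqr_ge0.
  have [y1|y1] := leP y 1; first by rewrite (le_trans y1)// lerDl exprn_ge0.
  by rewrite -[leLHS]add0r lerD// ler_eXnr// ltW.
rewrite (le_trans E1)// lerD2l.
under [X in Ex P X]eq_fun do rewrite coded_sumE.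
have [->|n0] := posnP n.
  rewrite (_ : (fun w => _) = fun=> 0) ?Ex_cst//; apply/funext => w.
  by rewrite /nsum /csum big_geq// mulr0 expr0n muln_eq0/= gtn_eqF.
have n0' : 0 < n%:R :> R by rewrite ltr0n.
have -> : Ex P (fun w => nsum P X n (coded c) w ^+ (2 * p)) =
    n%:R ^- p * Ex P (fun w => csum P X n (coded c) w ^+ (2 * p)).
  rewrite -ExZ; last by apply: brvX; exact: (brv_csum P mX GS n (coded_G c) (@coded_norm c)).
  congr Ex; apply/funext => w; rewrite /nsum exprMn; congr (_ * _).
  by rewrite exprVn exprM sqr_sqrtr// ler0n.
have bc := G_brv mX GS 0%N (coded_G c) (@coded_norm c).
have del2 : Ex P (fun w => `|coded c (X 0 w) - Ex P (fun w => coded c (X 0 w))|) <= 2.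
  rewrite (le_trans (Ex_center P bc))// -[leRHS]mulr1 ler_wpM2l//.
  by rewrite -(Ex_cst P 1); apply: (Ex_le P (brv_abs bc) (brv_cst _)) => w; exact: coded_norm.
have zk : nG (coded c) <= 2 * Psi z.
  have P1 : Psi (2 ^+ k) <= Psi z.
    by case: PsiN => mono _; apply: mono; rewrite ?exprn_ge0// le_max lexx orbT.
  have : 0 <= Psi z by case: PsiN => _; apply; rewrite le_max exprn_ge0 ?orbT.
  lra.
have := HM (coded c) z 2 n (coded_G c) (@coded_norm c) _ zk (ler0n R 2) del2 n0.
rewrite le_max lexx => /(_ isT) h.
rewrite (le_trans (ler_wpM2l _ h)) ?invr_ge0 ?exprn_ge0// mulrCA ler_wpM2l// mulr_sumr.
rewrite big_nat_cond [leRHS]big_nat_cond; apply: ler_sum => i; rewrite andbT ltnS => /andP[i1 ip].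
rewrite -mulrA [leLHS]mulrA ler_piMl ?mulr_ge0 ?exprn_ge0 ?powR_ge0//.
by rewrite mulrC ler_pdivrMr ?exprn_gt0// mul1r ler_weXn2l// ler1n.
Qed.

(** The Cramer-Wold device: [G] being a vector space containing the constants, a linear combination
    of the centred functions is again a function to which the limit theorem applies. *)
Lemma cvg_linf (al : seq (R * nat)) :
  exists v : R, 0 <= v /\ cvg_dist_normal P (fun n w => linf al (V n w)) v.
Proof.
pose h (x : R * nat) y := x.1 * (coded x.2 y - Ex P (fun w => coded x.2 (X 0 w))).
pose f y := \sum_(x <- al) h x y.
have hG x : G (h x).
  rewrite (_ : h x = fun y => x.1 * coded x.2 y + (- (x.1 * Ex P (fun w => coded x.2 (X 0 w)))) * 1).
    by apply: (G_lin GS) => //; [exact: coded_G|exact: (G_cst GS)].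
  by apply/funext => y; rewrite /h; ring.
have hb x y : `|h x y| <= `|x.1| * 2.
  rewrite normrM ler_wpM2l// (le_trans (ler_normB _ _))// -[leRHS]/(1 + 1).
  rewrite lerD ?coded_norm// (Ex_norm_le P (G_brv mX GS 0%N (coded_G _) (@coded_norm _)))//.
  by move=> w; exact: coded_norm.
have fG : G f.
  rewrite /f {f}; elim: al => [|x l ih]; first by under eq_fun do rewrite big_nil; exact: (G_cst GS).
  under eq_fun do rewrite big_cons.
  by case: GS => _ _ aG _ _; exact: aG.
have bh x : brv (fun w => h x (X 0%N w)) := G_brv mX GS 0%N (hG x) (hb x).
have fE : expE P (fun w => f (X 0 w)) = 0%E.
  rewrite /expE -EFin_Ex; last by apply: brv_sum => x _.
  rewrite Ex_sum// big1// => x _.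
  have bc := G_brv mX GS 0%N (coded_G x.2) (@coded_norm x.2).
  rewrite /h ExZ; last by apply: brvB => //; exact: brv_cst.
  by rewrite ExB//; [rewrite Ex_cst subrr mulr0|exact: brv_cst].
have fB : (supn f < +oo)%E.
  apply: (@le_lt_trans _ _ ((\sum_(x <- al) `|x.1| * 2)%:E)); last exact: ltry.
  apply: ub_ereal_sup => _ [y _ <-]; rewrite lee_fin (le_trans (ler_norm_sum _ _ _))//.
  by apply: ler_sum => x _; exact: hb.
have [v [v0 hv]] := GL fG fB fE; exists v; split => //.
rewrite (_ : (fun n w => linf al (V n w)) = (fun n w => (Num.sqrt n%:R)^-1 * \sum_(1 <= i < n.+1) f (X i w)))//.
apply/funext => n; apply/funext => w; rewrite /linf exchange_big/= mulr_sumr.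
by apply: eq_bigr => x _; rewrite coded_sumE /nsum /csum mulrCA mulr_sumr.
Qed.

Lemma measurable_linf_V al n : measurable_fun [set: T] (fun w => linf al (V n w)).
Proof. by apply: brv_meas; apply: brv_sum => x _; apply: brvZ. Qed.

Lemma coded_sum_trig al b : exists l : R, (fun n => Ex P (fun w => cos (linf al (V n w) + b))) @ \oo --> l.
Proof.
have [v [v0 hv]] := cvg_linf al; exists (gE v (fun x => cos (x + b))).
have cc : continuous (fun x : R => cos (x + b)).
  by move=> x; apply: continuous_comp; [apply: cvgD; [exact: cvg_id|exact: cvg_cst]|exact: continuous_cos].
have cb (x : R) : `|cos (x + b)| <= 1 by rewrite ler_norml cos_geN1 cos_le1.
exact: (@cvg_dist_Ex R _ _ P (fun n w => linf al (V n w)) v hv _ 1 cc cb).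
Qed.

Lemma coded_sum_atomless j (c : R) : c != 0 -> forall e : R, 0 < e ->
  exists2 eps : R, 0 < eps & exists N, forall n, (N <= n)%N ->
    pr P [set w | `|V n w j - c| <= eps] <= e.
Proof.
move=> c0 e e0; have [v [v0 hv]] := cvg_linf [:: (1, j)].
have [eps eps0 [N HN]] := @cvg_dist_atomless R _ _ P (fun n w => linf [:: (1, j)] (V n w)) v
  (measurable_linf_V _) v0 hv c e c0 e0.
exists eps => //; exists N => n /HN; rewrite (_ : [set w | _] = [set w | `|V n w j - c| <= eps])//.
by apply/seteqP; split => w /=; rewrite /linf big_seq1 mul1r.
Qed.

Let Vcvg m K (g : (nat -> R) -> R) (M : R) := @cvg_Ex_lipn R _ _ P V bV coded_sum_second_moment coded_sum_trig m K g M.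

Notation RT := (measurableTypeR R).
Notation Q := (@U01 R).

Definition limit_field (x : RT) (c : nat) : R := limit_rv P V x c.

Lemma limit_field_cvg m K (g : (nat -> R) -> R) (M : R) : lipn m K g -> (forall v, `|g v| <= M) ->
  (fun n => Ex P (fun w => g (V n w))) @ \oo --> Ex Q (fun x => g (limit_field x)).
Proof. exact: (@cvg_limit_rv R _ _ P V bV coded_sum_second_moment Vcvg coded_sum_atomless m K g M). Qed.

Lemma measurable_limit_field c : measurable_fun [set: RT] (fun x => limit_field x c).
Proof. exact: (@measurable_limit_rv R _ _ P V bV Vcvg coded_sum_atomless c). Qed.

(** The constant [2] bounds each of the two coordinates by the whole sum, which covers [a = b] as
    well. *)
Lemma lipn_diff a b (f : R -> R) : lip1 1 f -> lipn (a + b).+1 2 (fun v => f (v a - v b)).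
Proof.
move=> lf; split => // x y; rewrite (le_trans (lf _ _))// mul1r.
have ha : (a < (a + b).+1)%N by rewrite ltnS leq_addr.
have hb : (b < (a + b).+1)%N by rewrite ltnS leq_addl.
have h c (hc : (c < (a + b).+1)%N) : `|x c - y c| <= \sum_(j < (a + b).+1) `|x j - y j|.
  by rewrite (bigD1 (Ordinal hc))//= lerDl sumr_ge0.
rewrite (_ : _ - _ = (x a - y a) - (x b - y b)); last by ring.
by rewrite (le_trans (ler_normB _ _))// mulr_natl lerD ?h.
Qed.

Lemma brv_lipn_V m K (g : (nat -> R) -> R) (M : R) n : lipn m K g -> (forall v, `|g v| <= M) ->
  brv (fun w => g (V n w)).
Proof. by move=> lg gM; apply: (brv_lipn lg gM) => j _; exact: brv_meas (bV n j). Qed.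

Lemma brv_lipn_limit_field m K (g : (nat -> R) -> R) (M : R) : lipn m K g -> (forall v, `|g v| <= M) ->
  brv (fun x => g (limit_field x)).
Proof. by move=> lg gM; apply: (brv_lipn lg gM) => j _; exact: measurable_limit_field. Qed.

(** Doubling the threshold makes room for a ramp between [x] and [2 x], as only Lipschitz tests pass
    to the limit. The ramp is multiplied by [x] to have Lipschitz constant [1]. *)
Lemma pr_limit_field_diff a c (x e : R) : 0 < x ->
  (exists N, forall n, (N <= n)%N -> pr P [set w | x < `|V n w a - V n w c|] <= e) ->
  pr Q [set y | 2 * x < `|limit_field y a - limit_field y c|] <= e.
Proof.
move=> x0 [N HN].
have lf : lip1 1 (fun z : R => x * clamp01 ((`|z| - x) / x)).
  move=> z z'; rewrite mul1r -mulrBr normrM (gtr0_norm x0).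
  have := clamp01_lipZ x x0 `|z| `|z'|.
  rewrite -(ler_pM2l x0) mulrA divff ?gt_eqF// mul1r => /le_trans; apply.
  exact: ler_dist_dist.
have lg := lipn_diff a c lf.
set f := (fun z : R => _) in lf lg; pose g (v : nat -> R) := f (v a - v c).
have gM v : `|g v| <= x.
  by rewrite normrM (gtr0_norm x0) ler_piMr ?(ltW x0)// clamp01_norm.
have g0 v : 0 <= g v by rewrite mulr_ge0 ?(ltW x0)//; case/andP: (clamp01_bd ((`|v a - v c| - x) / x)).
have mV n : measurable [set w | x < `|V n w a - V n w c|].
  by apply: measurable_gt_cst; exact: brv_meas (brv_abs (brvB (bV n a) (bV n c))).
have mQ : measurable ([set y | 2 * x < `|limit_field y a - limit_field y c|] : set RT).
  apply: measurable_gt_cst; apply: measurableT_comp => //.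
  by apply: measurable_funB; exact: measurable_limit_field.
have h1 : x * pr Q [set y | 2 * x < `|limit_field y a - limit_field y c|] <= Ex Q (fun y => g (limit_field y)).
  apply: pr_markov => // [|y /= h]; first exact: brv_lipn_limit_field lg gM.
  rewrite /g /f clamp01_ge1 ?mulr1// ler_pdivlMr//; lra.
have h2 : Ex Q (fun y => g (limit_field y)) <= x * e.
  have := limit_field_cvg lg gM => h.
  apply/ler_addgt0Pr => e' e'0; have /cvgnP/(_ _ e'0)[N' HN'] := h.
  have h3 : Ex P (fun w => g (V (maxn N N') w)) <= x * pr P [set w | x < `|V (maxn N N') w a - V (maxn N N') w c|].
    rewrite -Ex_indic// -ExZ; last exact: (@brv_indic R).
    apply: (Ex_le P (brv_lipn_V _ lg gM)).
      by apply: brvZ; exact: (@brv_indic R).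
    move=> w; rewrite indicE; case: (boolP (w \in _)) => hw.
      by apply: ler_wpM2l; [exact: ltW|case/andP: (clamp01_bd ((`|V (maxn N N') w a - V (maxn N N') w c| - x) / x))].
    rewrite mulr0 /g /f clamp01_le0 ?mulr0// pmulr_lle0 ?invr_gt0// subr_le0 leNgt.
    by apply/negP => h4; move: hw; rewrite mem_set.
  have := HN' _ (leq_maxr N N'); rewrite ler_norml => /andP[h4 h5].
  have := HN _ (leq_maxl N N'); rewrite -(ler_pM2l x0) => h6.
  by lra.
by rewrite -(ler_pM2l x0) (le_trans h1).
Qed.

Lemma gaussian_limit_field (al : seq (R * nat)) :
  exists v : R, 0 <= v /\ gaussian_rv Q (fun x => linf al (limit_field x)) v.
Proof.
have [v [v0 hv]] := cvg_linf al; exists v; split => // K M f K0 lf fM.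
have lg : lipn (\sum_(x <- al) x.2.+1) (K * \sum_(x <- al) `|x.1|) (fun u => f (linf al u)).
  split; first by rewrite mulr_ge0// sumr_ge0.
  move=> y z; rewrite (le_trans (lf _ _))// -mulrA ler_wpM2l// /linf -sumrB mulr_suml.
  rewrite (le_trans (ler_norm_sum _ _ _))// big_seq [leRHS]big_seq; apply: ler_sum => x xal.
  rewrite -mulrBr normrM ler_wpM2l//.
  have hx : (x.2 < \sum_(x <- al) x.2.+1)%N by rewrite (big_rem x xal)/= addSn ltnS leq_addr.
  by rewrite (bigD1 (Ordinal hx))//= lerDl sumr_ge0.
have h1 := limit_field_cvg lg (fun u => fM _).
have h2 := @cvg_dist_Ex R _ _ P (fun n w => linf al (V n w)) v hv f M (lip1_continuous K0 lf) fM.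
exact: cvgn_uniq h1 h2.
Qed.

Variables (b C : R) (p k0 : nat).
Hypothesis b01 : 0 < b < 1.
Hypothesis C_ge0 : 0 <= C.
Hypothesis p_gt0 : (0 < p)%N.
Hypothesis dev : deviation_bound P X G nG Psi b C p k0.

Lemma pr_bad_limit_field k : (0 < k)%N -> (k0 <= k)%N ->
  pr Q (bad d limit_field k (2 * b ^+ k)) <= 18 ^+ d * C * (b ^+ (2 * p)) ^+ k.
Proof.
move=> k_gt0 kk; have /andP[b0 b1] := b01.
rewrite -mulrA; apply: pr_bad => //; first exact: measurable_limit_field.
  by rewrite mulr_ge0// !exprn_ge0// ltW.
move=> l; apply: pr_limit_field_diff; first exact: exprn_gt0.
(* The level is fixed while [n] grows, so [A = 1] is allowed. *)
exists (4 ^ k)%N => n nk.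
have n1 : (1 <= n)%N by rewrite (leq_trans _ nk)// expn_gt0.
have An : 4 ^+ k <= 1 * n%:R :> R by rewrite mul1r -natrX ler_nat.
have := @link_deviation R _ _ P d X d_gt0 mX cF G nG GS Psi PsiN psi psiP b C p k0 b01 C_ge0 p_gt0 dev k n 1 l k_gt0 kk n1 (lexx _) An.
by rewrite expr1n mulr1.
Qed.

End limit_process.

(** * Continuity and Gaussianity of the limit paths *)

Section limit_paths.
Context {R : realType} {d0 : measure_display} {T : measurableType d0}.
Variables (P : probability T R) (d : nat) (X : nat -> T -> 'I_d -> R).
Hypothesis mX : forall n c, measurable_fun [set: T] (fun w => X n w c).
Hypothesis cF : cdf_continuous P X.
Context {d1 : measure_display} {S : measurableType d1}.
Variables (Q : probability S R) (W0 : S -> nat -> R) (b c rho : R) (k1 : nat).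
Hypothesis mW0 : forall j, measurable_fun [set: S] (fun x => W0 x j).
Hypothesis b01 : 0 < b < 1.
Hypothesis c_ge0 : 0 <= c.
Hypothesis rho01 : 0 <= rho < 1.
Hypothesis bad0 : forall k, (k1 <= k)%N -> pr Q (bad d W0 k (2 * b ^+ k)) <= c * rho ^+ k.
Hypothesis gauss0 : forall al, exists v : R, 0 <= v /\ gaussian_rv Q (fun x => linf al (W0 x)) v.

Local Notation Fb := (Fbar P X).
Local Notation level_index := (level_index P X).

Let ratio_ge0 : 0 <= b / (1 - b).
Proof. by have /andP[b0 b1] := b01; rewrite divr_ge0 ?subr_ge0 ?ltW. Qed.

Definition regular : set S := eventually_not (fun n => bad d W0 (n + k1) (2 * b ^+ (n + k1))).

Lemma measurable_regular : measurable regular.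
Proof. by apply: measurable_eventually_not => n; apply: measurable_bad. Qed.

Lemma pr_regular : pr Q regular = 1.
Proof.
have /andP[r0 r1] := rho01.
apply: (@pr_eventually_not R _ _ Q _ c rho) => // [n|n]; first exact: measurable_bad.
rewrite (le_trans (bad0 _))// ?leq_addl// ler_wpM2l// exprD ler_piMr ?exprn_ge0//.
by rewrite exprn_ile1// ltW.
Qed.

(** Off a null event the field is replaced with [0], all of whose links are good; the limit path is
    then continuous at every [x], as [empirical_clt] asks. *)
Definition regularized (x : S) (j : nat) : R := \1_regular x * W0 x j.

Lemma measurable_regularized j : measurable_fun [set: S] (fun x => regularized x j).
Proof.
apply: measurable_funM => //; apply: brv_meas.
exact: (@brv_indic R _ _ _ measurable_regular).
Qed.

Lemma regularizedE x : regular x -> regularized x = W0 x.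
Proof. by move=> rx; apply/funext => j; rewrite /regularized indicE mem_set// mul1r. Qed.

Lemma good_links_eventually x : exists M, forall k, (M <= k)%N -> good_links d (regularized x) k (2 * b ^+ k).
Proof.
have /andP[b0 _] := b01.
have [rx|rx] := pselect (regular x); last first.
  exists 0%N => k _ l; rewrite /regularized indicE memNset// !mul0r subrr normr0.
  by rewrite mulr_ge0 ?exprn_ge0// ltW.
rewrite (regularizedE rx); case: rx => M _ HM; exists (M + k1)%N => k Mk l.
rewrite leNgt; apply/negP => h.
have := HM (k - k1)%N; rewrite /= leq_subRL; last by rewrite (leq_trans _ Mk)// leq_addl.
rewrite addnC Mk => /(_ isT); apply; rewrite subnK; last by rewrite (leq_trans _ Mk)// leq_addl.
by exists l.
Qed.

Definition limit_path (t : 'I_d -> \bar R) (x : S) : R := limn (fun k => step_path P X (regularized x) k t).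

Lemma limit_path_dist x : exists M, forall k, (M <= k)%N -> forall t,
  `|step_path P X (regularized x) k t - limit_path t x| <= 2 * (b / (1 - b)) * b ^+ k.
Proof.
have /andP[b0 b1] := b01.
have c0 : 0 <= 2 * (b / (1 - b)) by rewrite mulr_ge0 ?ratio_ge0.
have [M HM] := good_links_eventually x.
have H k m t : (M <= k)%N -> `|step_path P X (regularized x) (k + m) t - step_path P X (regularized x) k t| <= 2 * (b / (1 - b)) * b ^+ k.
  move=> Mk; have := @step_path_chain R _ _ P d X mX (regularized x) b 2 k m t b01 => h.
  rewrite (le_trans (h _))//; first by move=> k' h1 _; apply: HM; rewrite ltnW// (leq_ltn_trans Mk).
  by rewrite ler_wpM2l// gerBl exprn_ge0// ltW.
exists M => k Mk t.
have cv : (fun k => step_path P X (regularized x) k t) @ \oo --> limit_path t x.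
  suff [l hl] : exists l : R, (fun k => step_path P X (regularized x) k t) @ \oo --> l.
    by rewrite /limit_path (cvg_lim _ hl).
  apply: cauchy_cvgn => e e0.
  have e2 : 0 < e / 2 by rewrite divr_gt0.
  have [|N HN] := @expr_small R (2 * (b / (1 - b))) b (e / 2) _ c0 e2; first by rewrite ltW.
  exists (maxn M N) => i j; rewrite !geq_max => /andP[Mi Ni] /andP[Mj Nj].
  have HK l : (M <= l)%N -> (N <= l)%N -> `|step_path P X (regularized x) l t - step_path P X (regularized x) (maxn M N) t| <= e / 2.
    move=> Ml Nl; have ml : (maxn M N <= l)%N by rewrite geq_max Ml Nl.
    rewrite -(subnKC ml) (le_trans (H _ _ _ (leq_maxl _ _)))//.
    by rewrite HN// leq_maxr.
  have := HK i Mi Ni; have := HK j Mj Nj; rewrite !ler_norml; lra.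
have cv' : (fun m => `|step_path P X (regularized x) (k + m) t - step_path P X (regularized x) k t|) @ \oo --> `|limit_path t x - step_path P X (regularized x) k t|.
  apply: cvg_norm; apply: cvgB; last exact: cvg_cst.
  have := cv; rewrite -(cvg_shiftn k) => cv2.
  by apply: cvgn_ext cv2 => m; rewrite addnC.
by rewrite distrC; apply: cvgn_le cv' _ => m; exact: H.
Qed.

(** In each coordinate the indices differ by at most one, in either direction. Links only shift
    upwards, so both indices are reached from their coordinatewise minimum [m], whence the factor
    [2]. *)
Lemma step_path_near x k s t (y : R) : good_links d (regularized x) k y ->
  (forall i, `|Fb i (s i) - Fb i (t i)| < (2 ^+ k)^-1) ->
  `|step_path P X (regularized x) k s - step_path P X (regularized x) k t| <= 2 * y.
Proof.
move=> gx st; pose m i := minn (level_index k s i) (level_index k t i).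
have p2 : 0 < 2 ^+ k :> R by rewrite exprn_gt0.
have mk i : (m i <= 2 ^ k + 1)%N by rewrite geq_min (leq_trans (level_index_le P mX _ _ _)) ?leq_addr.
have near1 u v i : `|Fb i (u i) - Fb i (v i)| < (2 ^+ k)^-1 -> (level_index k u i <= level_index k v i + 1)%N.
  have /andP[h1 _] := level_index_itv P X k u i; have /andP[_ h2] := level_index_itv P X k v i.
  rewrite ltr_norml => /andP[_]; rewrite -(ltr_pM2l p2) mulrBr divff ?gt_eqF// => h3.
  rewrite addn1 -ltnS -(ltr_nat R) -[_.+2%:R]natr1; move: h2; rewrite -[_.+1%:R]natr1; lra.
have sh u : (forall i, (level_index k u i <= m i + 1)%N) -> (forall i, (m i <= level_index k u i)%N) ->
    `|regularized x (code k m) - step_path P X (regularized x) k u| <= y.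
  move=> h1 h2; have := @good_shift R d (regularized x) k y m (fun i => level_index k u i - m i)%N gx mk.
  rewrite /step_path (_ : shifted k m _ = level_index k u); last first.
    apply/funext => i; rewrite /shifted subnKC//; apply/minn_idPl.
    by rewrite (leq_trans (level_index_le P mX _ _ _))// leq_addr.
  by apply => i; rewrite leq_subLR (leq_trans (h1 i))// leq_add2l.
rewrite -(subrKA (regularized x (code k m))) (le_trans (ler_normD _ _))// mulr_natl mulr2n lerD//.
  rewrite distrC; apply: sh => i; last by rewrite geq_minl.
  rewrite /m; case: (leqP (level_index k s i) (level_index k t i)) => _; first by rewrite leq_addr.
  exact: near1.
apply: sh => i; last by rewrite geq_minr.
rewrite /m; case: (leqP (level_index k s i) (level_index k t i)) => _; last by rewrite leq_addr.
by apply: near1; rewrite distrC.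
Qed.

Lemma limit_path_continuous x : cont_path (fun t => limit_path t x).
Proof.
move=> t e e0; have /andP[b0 b1] := b01.
have [M HM] := good_links_eventually x; have [M' HM'] := limit_path_dist x.
(* [4 * (b / (1 - b))] for the uniform distances at [s] and [t], and [4] for two links of size
   [2 * b^k]. *)
have [|||N HN] := @expr_small R (4 * (b / (1 - b)) + 4) b (e / 2) _ _ _.
- by rewrite ltW.
- by rewrite addr_ge0// mulr_ge0 ?ratio_ge0.
- by rewrite divr_gt0.
pose k := maxn N (maxn M M').
have Nk : (N <= k)%N by rewrite leq_max leqnn.
have Mk : (M <= k)%N by rewrite !leq_max leqnn ?orbT.
have M'k : (M' <= k)%N by rewrite !leq_max leqnn ?orbT.
have p2 : 0 < (2 ^+ k)^-1 :> R by rewrite invr_gt0 exprn_gt0.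
exists (fun i => [set s | `|Fb i s - Fb i (t i)| < (2 ^+ k)^-1]); split.
  by move=> i; exact: (near_Fbar mX cF).
move=> s hs; have h1 := step_path_near (HM k Mk) hs.
have h2 := HM' k M'k s; have h3 := HM' k M'k t; have h4 := HN k Nk.
rewrite (_ : limit_path s x - limit_path t x = (step_path P X (regularized x) k s - step_path P X (regularized x) k t) - (step_path P X (regularized x) k s - limit_path s x) + (step_path P X (regularized x) k t - limit_path t x)); last by ring.
rewrite (le_lt_trans (ler_normD _ _))// (le_lt_trans (lerD (ler_normB _ _) (lexx _)))//.
move: h1 h2 h3 h4; rewrite mulrDl; lra.
Qed.

Lemma step_path_cvg x t : (fun k => step_path P X (regularized x) k t) @ \oo --> limit_path t x.
Proof.
have /andP[b0 b1] := b01.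
have [M HM] := limit_path_dist x; apply/cvgnP => e e0.
have [||N HN] := @expr_small R (2 * (b / (1 - b))) b e _ _ e0.
- by rewrite ltW.
- by rewrite mulr_ge0 ?ratio_ge0.
exists (maxn M N) => k; rewrite geq_max => /andP[Mk Nk].
exact: le_trans (HM k Mk t) (HN k Nk).
Qed.

Lemma measurable_limit_path t : measurable_fun [set: S] (limit_path t).
Proof.
apply: (@measurable_fun_cvg _ _ _ _ (fun k x => step_path P X (regularized x) k t)) => //.
  by move=> k; exact: measurable_regularized.
by move=> x _; exact: step_path_cvg.
Qed.

Lemma Ex_regular f g (M : R) : brv f -> brv g -> (forall x, `|f x| <= M) ->
  (forall x, `|g x| <= M) -> (forall x, regular x -> f x = g x) -> Ex Q f = Ex Q g.
Proof.
move=> bf bg fM gM fg; apply/eqP; rewrite -subr_eq0 -normr_le0.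
rewrite (le_trans (Ex_dist Q (measurableC measurable_regular) (lexx _) bf bg fM gM _))//.
  by move=> x /contrapT /fg ->; rewrite subrr normr0.
by rewrite pr_setC; [rewrite pr_regular subrr mulr0 addr0|exact: measurable_regular].
Qed.

Lemma limit_path_gaussian : centered_gaussian Q limit_path.
Proof.
move=> m ts a Y.
pose al k := [seq (a i, code k (level_index k (ts i))) | i <- enum 'I_m].
have alE k u : linf (al k) u = \sum_(i < m) a i * step_path P X u k (ts i).
  by rewrite /linf big_map big_enum.
have mY : measurable_fun [set: S] Y.
  by apply: measurable_sum => i; apply: measurable_funM => //; exact: measurable_limit_path.
have mk k u : (forall j, measurable_fun [set: S] (fun x : S => u x j)) ->
   measurable_fun [set: S] (fun x => linf (al k) (u x)).
  by move=> mu; apply: measurable_sum => y; apply: measurable_funM.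
have [||| v v0 gv] := @gaussian_rv_cvg R _ _ Q (fun k x => linf (al k) (regularized x)) Y.
- by move=> k; apply: mk; exact: measurable_regularized.
- move=> x; under eq_fun do rewrite alE; apply: cvgn_sum => i.
  by move=> _; apply: cvgMr; exact: step_path_cvg.
- move=> k; have [v [v0 gv]] := gauss0 (al k); exists v => // K M f K0 lf fM.
  rewrite -(gv K M f K0 lf fM).
  have cf := lip1_continuous K0 lf.
  have bf u : (forall j, measurable_fun [set: S] (fun x : S => u x j)) -> brv (fun x => f (linf (al k) (u x))).
    move=> mu; split; last by exists M => x; exact: fM.
    by apply: measurableT_comp; [exact: continuous_measR|exact: mk].
  apply: (@Ex_regular _ _ M) => [| |x|x|x rx]; [exact/bf/measurable_regularized|exact: bf|exact: fM|exact: fM|].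
  by rewrite regularizedE.
split => //; exists v; split => // B mB.
exact: (gaussian_rv_law mY v0 gv).
Qed.

End limit_paths.

(** * Skorokhod space *)

Section cadlag_functions.
Context {R : realType}.
Variable d : nat.
Implicit Types (t s : 'I_d -> \bar R) (x y : ('I_d -> \bar R) -> R).

Lemma near_boxI t (A B : ('I_d -> \bar R) -> Prop) : near_box t A -> near_box t B ->
  near_box t (fun s => A s /\ B s).
Proof.
move=> [U [nU UA]] [V [nV VB]]; exists (fun i => U i `&` V i); split.
  by move=> i; exact: filterI.
by move=> s UVs; split; [apply: UA => i; case: (UVs i)|apply: VB => i; case: (UVs i)].
Qed.

Lemma near_box_sub t (A B : ('I_d -> \bar R) -> Prop) : (forall s, A s -> B s) ->
  near_box t A -> near_box t B.
Proof. by move=> AB [U [nU UA]]; exists U; split => // s /UA/AB. Qed.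

Lemma cont_path_cadlag x : cont_path x -> cadlag x.
Proof.
move=> cx t rho; exists (x t); split => // e e0.
by apply: near_box_sub (cx t e e0) => s h _.
Qed.

Lemma cadlagD x y : cadlag x -> cadlag y -> cadlag (fun t => x t + y t).
Proof.
move=> cx cy t rho; have [L [HL L1]] := cx t rho; have [K [HK K1]] := cy t rho.
exists (L + K); split; last by move=> h; rewrite L1// K1.
move=> e e0; have e2 : 0 < e / 2 by rewrite divr_gt0.
apply: near_box_sub (near_boxI (HL _ e2) (HK _ e2)) => s [h1 h2] q.
have := h1 q; have := h2 q; rewrite !ltr_norml; lra.
Qed.

Lemma cadlagZ (a : R) x : cadlag x -> cadlag (fun t => a * x t).
Proof.
move=> cx t rho; have [L [HL L1]] := cx t rho.
exists (a * L); split; last by move=> h; rewrite L1.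
move=> e e0; have a0 : 0 < `|a| + 1 by rewrite ltr_wpDl.
apply: near_box_sub (HL _ (divr_gt0 e0 a0)) => s h1 q; have := h1 q.
rewrite ltr_pdivlMr// -mulrBr normrM => h; rewrite (le_lt_trans _ h)// mulrC ler_wpM2l//.
by rewrite lerDl.
Qed.

Lemma cadlag_cst (a : R) : cadlag (fun _ : 'I_d -> \bar R => a).
Proof.
apply: cont_path_cadlag => t e e0; exists (fun=> setT); split => [i|s _]; first exact: filterT.
by rewrite subrr normr0.
Qed.

Lemma cadlag_sum (I : Type) (r : seq I) (F : I -> ('I_d -> \bar R) -> R) :
  (forall i, cadlag (F i)) -> cadlag (fun t => \sum_(i <- r) F i t).
Proof.
move=> cF; elim: r => [|i r ih].
  by under eq_fun do rewrite big_nil; exact: cadlag_cst.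
by under eq_fun do rewrite big_cons; exact: cadlagD.
Qed.

(** Each point has a constant germ strictly to the left, and one to the right that includes the
    point. No topology on [A] is involved, so any [H] of finitely many such functions is constant
    near a point in each quadrant. *)
Definition regulated (A : Type) (g : \bar R -> A) : Prop := forall u,
  (exists a, nbhs u [set v | (v < u)%E -> g v = a]) /\ nbhs u [set v | (u <= v)%E -> g v = g u].

Lemma regulated_cadlag (A : Type) (g : 'I_d -> \bar R -> A) (H : ('I_d -> A) -> R) :
  (forall i, regulated (g i)) -> cadlag (fun t => H (fun i => g i (t i))).
Proof.
move=> rg t rho.
have [a Ha] := choice (fun i => (rg i (t i)).1).
pose L i := if rho i then g i (t i) else a i.
exists (H L); split; last by move=> h; congr H; apply/funext => i; rewrite /L h.
move=> e e0; exists (fun i => [set v | (if rho i then (t i <= v)%E else (v < t i)%E) -> g i v = L i]); split.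
  by move=> i; rewrite /L; case: (rho i) => /=; [exact: (rg i (t i)).2|exact: Ha].
move=> s hs q; rewrite (_ : (fun i => g i (s i)) = L) ?subrr ?normr0//.
by apply/funext => i; exact: (hs i (q i)).
Qed.

(** Being integer-valued and bounded, [g] attains its maximum to the left of [u]; by monotonicity it
    is constant from there up to [u]. *)
Lemma nat_regulated (g : \bar R -> nat) (B : nat) : (forall u v, (u <= v)%E -> (g u <= g v)%N) ->
  (forall u, (g u <= B)%N) -> (forall u, nbhs u [set v | (u <= v)%E -> g v = g u]) -> regulated g.
Proof.
move=> mg gB rg u; split => //.
(* Nothing lies to the left of [-oo], where any value serves as left germ. *)
have [[v0 v0u]|no] := pselect (exists v, (v < u)%E); last first.
  by exists 0%N; apply: filterE => v vu; case: no; exists v.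
have ex : exists m, `[< exists2 v, (v < u)%E & g v = m >].
  by exists (g v0); apply/asboolP; exists v0.
have bd m : `[< exists2 v, (v < u)%E & g v = m >] -> (m <= B)%N.
  by move=> /asboolP[v _ <-].
case: (ex_maxnP ex bd) => m /asboolP[v vu <-] vmax.
exists (g v); apply: (filterS (P := [set z | (v < z)%E])).
  move=> z /= vz zu; apply/eqP; rewrite eqn_leq (mg _ _ (ltW vz)) andbT.
  by apply: vmax; apply/asboolP; exists z.
by apply: open_nbhs_nbhs; split => //; exact: open_ereal_gt_ereal.
Qed.

End cadlag_functions.

Section skorokhod_distance.
Context {R : realType}.
Variable d : nat.
Implicit Types (t s : 'I_d -> \bar R) (x y : ('I_d -> \bar R) -> R).

Lemma skod_le x y (lam : 'I_d -> \bar R -> \bar R) (e : R) : (forall i, tchange (lam i)) ->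
  (forall i u, `|contract (lam i u) - contract u| <= e) ->
  (forall t, `|x t - y (fun i => lam i (t i))| <= e) -> (skod x y <= e%:E)%E.
Proof.
move=> tl h1 h2; apply: (le_trans (ereal_inf_lbound _)); first by exists lam; split.
rewrite ge_max; apply/andP; split; apply: ub_ereal_sup.
  by move=> _ [i [u ->]]; rewrite lee_fin.
by move=> _ [t ->]; rewrite lee_fin.
Qed.

Lemma skod_le_sup x y (e : R) : 0 <= e -> (forall t, `|x t - y t| <= e) -> (skod x y <= e%:E)%E.
Proof.
move=> e0 h; apply: (@skod_le _ _ (fun _ u => u)) => //.
  by move=> i; split => // v; exists v.
by move=> i u; rewrite subrr normr0.
Qed.

Variables (h : (('I_d -> \bar R) -> R) -> R).
Hypothesis hC : sko_bounded_continuous h.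

(** The Pasch-Hausdorff envelope of [h] for the uniform distance; ranging over upper bounds [c] of
    that distance avoids a supremum. *)
Definition infconv (l : R) x : R :=
  inf [set z | exists y c, [/\ cadlag y, 0 <= c, (forall t, `|x t - y t| <= c) & z = h y + l * c]].

Lemma infconv_lbound (M l : R) x : (forall x, cadlag x -> `|h x| <= M) -> 0 <= l ->
  lbound [set z | exists y c, [/\ cadlag y, 0 <= c, (forall t, `|x t - y t| <= c) & z = h y + l * c]] (- M).
Proof.
move=> hM l0 _ [y [c [cy c0 _ ->]]]; have := hM y cy; rewrite ler_norml => /andP[h1 _].
by rewrite (le_trans h1)// lerDl mulr_ge0.
Qed.

Lemma infconv_le_add (M l : R) x y (c : R) : (forall x, cadlag x -> `|h x| <= M) -> 0 <= l ->
  cadlag y -> 0 <= c -> (forall t, `|x t - y t| <= c) -> infconv l x <= h y + l * c.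
Proof.
move=> hM l0 cy c0 xy; apply: ge_inf; first by exists (- M); exact: infconv_lbound.
by exists y, c; split.
Qed.

Lemma infconv_le (M l : R) x : (forall x, cadlag x -> `|h x| <= M) -> 0 <= l -> cadlag x ->
  infconv l x <= h x.
Proof.
move=> hM l0 cx; rewrite -[leRHS]addr0 -[X in _ + X](mulr0 l).
by apply: (infconv_le_add hM) => // t; rewrite subrr normr0.
Qed.

Lemma infconv_ge (l z : R) x : cadlag x ->
  (forall y c, cadlag y -> 0 <= c -> (forall t, `|x t - y t| <= c) -> z <= h y + l * c) ->
  z <= infconv l x.
Proof.
move=> cx H; apply: lb_le_inf; last by move=> _ [y [c [cy c0 xy ->]]]; exact: H.
exists (h x + l * 0), x, 0; split => // t; by rewrite subrr normr0.
Qed.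

Lemma infconv_norm (M l : R) x : (forall x, cadlag x -> `|h x| <= M) -> 0 <= l -> cadlag x ->
  `|infconv l x| <= M.
Proof.
move=> hM l0 cx; rewrite ler_norml (le_trans (infconv_le hM l0 cx)) ?andbT; last first.
  by have := hM x cx; rewrite ler_norml => /andP[].
by apply: infconv_ge => // y c cy c0 xy; apply: (infconv_lbound hM l0); exists y, c; split.
Qed.

Lemma infconv_lip (M l : R) x y (c : R) : (forall x, cadlag x -> `|h x| <= M) -> 0 <= l ->
  cadlag x -> cadlag y -> 0 <= c -> (forall t, `|x t - y t| <= c) ->
  infconv l x <= infconv l y + l * c.
Proof.
move=> hM l0 cx cy c0 xy; rewrite -lerBlDr; apply: infconv_ge => // z a cz a0 yz.
rewrite lerBlDr -addrA -mulrDr; apply: (infconv_le_add hM) => //; first by rewrite addr_ge0.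
by move=> t; rewrite -(subrKA (y t)) addrC (le_trans (ler_normD _ _))// lerD.
Qed.

(** Competitors at uniform distance less than [del] are as close for the Skorokhod distance, where
    [h] is continuous; the others pay [m * c >= 2 * M], more than the oscillation of [h]. *)
Lemma infconv_cvg x : cadlag x -> (fun m => infconv m%:R x) @ \oo --> h x.
Proof.
move=> cx; have [[M hM] hc] := hC.
apply/cvgnP => e e0; have [del del0 hdel] := hc x cx e e0.
have M0 : 0 <= M by exact: le_trans (hM x cx).
exists (Num.bound (2 * M / del)) => m Hm.
have hm : 2 * M <= m%:R * del.
  rewrite -ler_pdivrMr// (le_trans (ltW (archi_boundP _))) ?ler_nat//.
  by rewrite divr_ge0 ?mulr_ge0// ltW.
rewrite ler_norml lerBlDr (le_trans (infconv_le hM _ cx)) ?lerDr ?(ltW e0)// andbT.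
rewrite lerBrDr addrC; apply: infconv_ge => // y c cy c0 xy.
have [cd|cd] := ltP c del.
  have := hdel y cy; rewrite (le_lt_trans (skod_le_sup c0 xy)) ?lte_fin// => /(_ isT).
  by rewrite ltr_norml; have := mulr_ge0 (ler0n R m) c0; lra.
have : m%:R * del <= m%:R * c by rewrite ler_wpM2l.
by have := hM x cx; have := hM y cy; rewrite !ler_norml; lra.
Qed.

End skorokhod_distance.

Section empirical_cadlag.
Context {R : realType} {d0 : measure_display} {T : measurableType d0}.
Variables (P : probability T R) (d : nat) (X : nat -> T -> 'I_d -> R).
Hypothesis mX : forall n c, measurable_fun [set: T] (fun w => X n w c).
Hypothesis cF : cdf_continuous P X.

Local Notation Fb := (Fbar P X).

Lemma cadlag_step_path u k : cadlag (fun t => step_path P X u k t).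
Proof.
apply: (@regulated_cadlag R d nat (fun i v => Num.truncn (2 ^+ k * Fb i v)) (fun j => u (code k j))).
have p2 : 0 < 2 ^+ k :> R by rewrite exprn_gt0.
have ge0 i v : 0 <= 2 ^+ k * Fb i v by rewrite mulr_ge0 ?exprn_ge0 ?Fbar_ge0.
have mono i v v' : (v <= v')%E -> 2 ^+ k * Fb i v <= 2 ^+ k * Fb i v'.
  by move=> vv; rewrite ler_wpM2l ?exprn_ge0// (Fbar_mono P mX).
move=> i; apply: (@nat_regulated R _ (2 ^ k)%N) => [v v' vv|v|v].
- by apply: le_truncn; exact: mono.
- exact: (level_index_le P mX k (fun=> v) i).
have /andP[t1 t2] := truncn_itv (ge0 i v); set m := Num.truncn _ in t1 t2 *.
have e0 : 0 < m.+1%:R / 2 ^+ k - Fb i v by rewrite subr_gt0 ltr_pdivlMr// mulrC.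
apply: filterS (near_Fbar mX cF i v e0) => v' /= h vv.
apply/eqP; rewrite truncn_eq// (le_trans t1)/= ?mono//.
move: h; rewrite ltr_norml => /andP[_]; rewrite ltrD2r ltr_pdivlMr// mulrC; exact.
Qed.

Lemma cdf_dist s t : `|Defs.cdf P X s - Defs.cdf P X t| <= \sum_i `|Fb i (s i) - Fb i (t i)|.
Proof.
have H u v : Defs.cdf P X u - Defs.cdf P X v <= \sum_i `|Fb i (u i) - Fb i (v i)|.
  rewrite (le_trans (pr_leE_diff P mX v u))//; apply: ler_sum => i _.
  by rewrite ge_max normr_ge0 ler_norm.
rewrite ler_norml H andbT -lerN2 opprK opprB.
by under eq_bigr do rewrite distrC; exact: H.
Qed.

Lemma cont_path_cdf : cont_path (fun t => Defs.cdf P X t).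
Proof.
move=> t e e0; have d1 : 0 < d%:R + 1 :> R by rewrite ltr_wpDl.
exists (fun i => [set v | `|Fb i v - Fb i (t i)| < e / (d%:R + 1)]); split.
  by move=> i; apply: (near_Fbar mX cF); rewrite divr_gt0.
move=> s hs; rewrite (le_lt_trans (cdf_dist s t))//.
rewrite (@le_lt_trans _ _ (\sum_(i < d) e / (d%:R + 1)))//.
  by apply: ler_sum => i _; exact: ltW (hs i).
rewrite sumr_const card_ord -[ltLHS]mulr_natl mulrA ltr_pdivrMr// mulrC ltr_pM2l//.
by rewrite ltrDl.
Qed.

Lemma cadlag_indic (x : 'I_d -> R) : cadlag (fun t => \1_[set y | leE y t] x : R).
Proof.
rewrite (_ : (fun t => _) = fun t => (fun f : 'I_d -> bool => (`[< forall i, f i >])%:R) (fun i => (x i)%:E <= t i)%E).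
  apply: (@regulated_cadlag R d bool (fun i v => ((x i)%:E <= v)%E) (fun f => (`[< forall i, f i >])%:R)) => i u; split.
    have [xu|ux] := ltP (x i)%:E u.
      exists true; apply: (filterS (P := [set v | ((x i)%:E < v)%E])).
        by move=> v /= /ltW.
      by apply: open_nbhs_nbhs; split => //; exact: open_ereal_gt_ereal.
    by exists false; apply: filterE => v vu; apply/negbTE; rewrite -ltNge (lt_le_trans vu).
  have [xu|ux] := leP (x i)%:E u.
    by apply: filterE => v uv; exact: le_trans uv.
  apply: (filterS (P := [set v | (v < (x i)%:E)%E])).
    by move=> v /= h _; apply/negbTE; rewrite -ltNge.
  by apply: open_nbhs_nbhs; split => //; exact: open_ereal_lt_ereal.
apply/funext => t; rewrite indicE; congr (nat_of_bool _)%:R.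
Qed.

(** The empirical process as a function of finitely many reals, in the form that [measurable_dyfl]
    handles. *)
Definition emp (n : nat) (z : 'I_n * 'I_d -> R) (t : 'I_d -> \bar R) : R :=
  (Num.sqrt n%:R)^-1 * \sum_(i < n) (\1_[set x | leE x t] (fun c => z (i, c)) - Defs.cdf P X t).

Lemma Uemp_emp n w : Uemp P X n w = emp (fun ic : 'I_n * 'I_d => X ic.1.+1 w ic.2).
Proof.
apply/funext => t; rewrite /Uemp /emp; congr (_ * _).
by rewrite big_add1/= big_mkord.
Qed.

Lemma cadlag_emp n (z : 'I_n * 'I_d -> R) : cadlag (emp z).
Proof.
apply: cadlagZ; apply: cadlag_sum => i; apply: cadlagD; first exact: cadlag_indic.
rewrite (_ : (fun t => - _) = (fun t => (-1) * Defs.cdf P X t)).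
  exact/cadlagZ/cont_path_cadlag/cont_path_cdf.
by apply/funext => t; rewrite mulN1r.
Qed.

End empirical_cadlag.

Section time_change.
Context {R : realType}.

Lemma finite_positive (A : eqType) (s : seq A) (p : A -> R -> Prop) :
  (forall a e e', p a e -> 0 < e' -> e' <= e -> p a e') ->
  (forall a, a \in s -> exists2 e, 0 < e & p a e) ->
  exists2 e : R, 0 < e & forall a, a \in s -> p a e.
Proof.
move=> mono; elim: s => [|a s ih] h; first by exists 1.
have [|e e0 he] := ih; first by move=> b bs; apply: h; rewrite inE bs orbT.
have [e' e'0 he'] := h a (mem_head a s).
exists (Num.min e e'); first by rewrite lt_min e0.
move=> b; rewrite inE => /predU1P[->|bs].
  by apply: mono he' _ _; rewrite ?lt_min ?e0// ge_min lexx orbT.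
by apply: mono (he b bs) _ _; rewrite ?lt_min ?e0// ge_min lexx.
Qed.

Definition tent (v rho u : R) : R := Num.max 0 (1 - `|u - v| / rho).

Lemma tent_lip v rho u u' : 0 < rho -> `|tent v rho u - tent v rho u'| <= `|u - u'| / rho.
Proof.
move=> r0; have h : `| `|u - v| / rho - `|u' - v| / rho| <= `|u - u'| / rho.
  rewrite -mulrBl normrM (gtr0_norm (_ : 0 < rho^-1)) ?invr_gt0// ler_wpM2r ?invr_ge0 ?(ltW r0)//.
  by rewrite (le_trans (ler_dist_dist _ _))// (_ : _ - _ = u - u')//; ring.
move: h; rewrite /tent; set x := `|u - v| / rho; set y := `|u' - v| / rho.
by case: (leP 0 (1 - x)) => ?; case: (leP 0 (1 - y)) => ?; rewrite !ler_norml => /andP[? ?]; lra.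
Qed.

Lemma tent_bd v rho u : 0 < rho -> 0 <= tent v rho u <= 1.
Proof.
move=> r0; rewrite /tent le_max lexx/= ge_max ler01/= gerBl.
by rewrite divr_ge0// ltW.
Qed.

Lemma tent_out v rho u : 0 < rho -> rho <= `|u - v| -> tent v rho u = 0.
Proof. by move=> r0 h; apply/max_idPl; rewrite subr_le0 ler_pdivlMr// mul1r. Qed.

Lemma tent_center v rho : tent v rho v = 1.
Proof. by rewrite /tent subrr normr0 mul0r subr0; apply/max_idPr. Qed.

(* [l] is the identity plus a sum of disjoint tents centred at the points of [s];
   it is increasing because the tents have small slopes. *)
Lemma small_time_change (s : seq R) (eta : R) : 0 < eta -> exists2 del : R, 0 < del &
  forall w : R -> R, (forall v, v \in s -> `|w v - v| <= del) -> exists l : R -> R,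
    [/\ {homo l : u v / u < v}, (forall v, exists u, l u = v),
        (forall v, v \in s -> l v = w v), (forall u, `|l u - u| <= eta) &
        forall u, l u != u -> exists2 v, v \in s & `|u - v| <= eta].
Proof.
(* One tent for each point: a repeated sample value must not be displaced twice. *)
move=> eta0; pose t := undup s.
have [rho0 rho00 Hrho0] : exists2 e : R, 0 < e &
    forall a, a \in [seq (v, v') | v <- s, v' <- s] -> a.1 != a.2 -> e <= `|a.1 - a.2|.
  apply: finite_positive => [a e e' h e'0 ee ne|a _]; first by rewrite (le_trans ee)// h.
  have [->|ne] := eqVneq a.1 a.2; first by exists 1.
  by exists `|a.1 - a.2|; rewrite ?normr_gt0 ?subr_eq0.
pose rho := Num.min eta rho0.
have r0 : 0 < rho by rewrite lt_min eta0.
have gap v v' : v \in s -> v' \in s -> v != v' -> rho <= `|v - v'|.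
  move=> vs v's ne; rewrite ge_min; apply/orP; right.
  by apply: (Hrho0 (v, v')) => //; apply/allpairsP; exists (v, v').
pose N : R := (size t)%:R + 1.
have N0 : 0 < N by rewrite ltr_wpDl.
(* At most [N] tents of height [del] and radius [rho] have total slope at most
   [N * del / rho = 1/2 < 1]. Since points are at least [rho] apart, each tent vanishes at the other
   centres. *)
exists (rho / (2 * N)); first by rewrite divr_gt0 ?mulr_gt0.
move=> w hw; pose S u := \sum_(v <- t) (w v - v) * tent v rho u.
have Nh : (size t)%:R * (rho / (2 * N)) <= rho / 2.
  rewrite (_ : rho / (2 * N) = (rho / 2) / N); last by field; rewrite gt_eqF.
  by rewrite mulrA ler_pdivrMr// mulrC ler_wpM2l ?divr_ge0 ?(ltW r0)// lerDl.
have Slip u u' : `|S u - S u'| <= `|u - u'| / 2.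
  rewrite -sumrB (le_trans (ler_norm_sum _ _ _))//.
  rewrite (@le_trans _ _ (\sum_(v <- t) rho / (2 * N) * (`|u - u'| / rho)))//.
    rewrite big_seq [leRHS]big_seq; apply: ler_sum => v; rewrite mem_undup => vs.
    by rewrite -mulrBr normrM ler_pM// ?hw// tent_lip.
  rewrite big_const_seq count_predT iter_addr_0 -[leLHS]mulr_natl mulrA.
  rewrite (le_trans (ler_wpM2r _ Nh)) ?divr_ge0// ?(ltW r0)//.
  by rewrite (_ : rho / 2 * (`|u - u'| / rho) = `|u - u'| / 2)//; field; rewrite gt_eqF.
have Sbd u : `|S u| <= eta.
  rewrite (le_trans (ler_norm_sum _ _ _))//.
  rewrite (@le_trans _ _ (\sum_(v <- t) rho / (2 * N)))//.
    rewrite big_seq [leRHS]big_seq; apply: ler_sum => v; rewrite mem_undup => vs.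
    have /andP[h1 h2] := tent_bd v u r0.
    by rewrite normrM (ger0_norm h1) -[leRHS]mulr1 ler_pM// hw.
  rewrite big_const_seq count_predT iter_addr_0 -[leLHS]mulr_natl (le_trans Nh)//.
  have : rho <= eta by rewrite ge_min lexx.
  lra.
exists (fun u => u + S u); split.
- move=> u u' uu; have := Slip u u'; rewrite ler_norml => /andP[_].
  by rewrite (distrC u) (gtr0_norm (_ : 0 < u' - u)) ?subr_gt0//; lra.
- move=> v.
  have cl : continuous (fun u => u + S u).
    apply: (@lip1_continuous R 2) => // a c.
    rewrite (_ : _ - _ = (a - c) + (S a - S c)); last by ring.
    rewrite (le_trans (ler_normD _ _))//; have := Slip a c; have := normr_ge0 (a - c); lra.
  have [|||u _ hu] := @IVT R (fun u => u + S u) (v - eta) (v + eta) v; last by exists u.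
  + by rewrite lerD2l; lra.
  + exact/continuous_subspaceT.
  + rewrite ge_min le_max; have := Sbd (v - eta); have := Sbd (v + eta); rewrite !ler_norml.
    by move=> /andP[? ?] /andP[? ?]; apply/andP; split; apply/orP; [left|right]; lra.
- move=> v vs; rewrite /S (bigD1_seq v) ?mem_undup ?undup_uniq//=.
  rewrite tent_center mulr1 big1_seq ?addr0 ?[RHS]addrC ?subrK//; first by ring.
  move=> v' /andP[ne]; rewrite mem_undup => v's.
  by rewrite tent_out ?mulr0// gap// eq_sym.
- by move=> u; rewrite addrAC subrr add0r.
move=> u ne; apply: contrapT => no; move/eqP: ne; apply.
rewrite /S big1_seq ?addr0// => v /andP[_]; rewrite mem_undup => vs.
rewrite tent_out ?mulr0//; apply: contrapT => /negP; rewrite -ltNge => h.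
by apply: no; exists v => //; rewrite (le_trans (ltW h))// ge_min lexx.
Qed.

Definition lift_ereal (l : R -> R) (u : \bar R) : \bar R :=
  match u with x%:E => (l x)%:E | +oo%E => +oo%E | -oo%E => -oo%E end.

Lemma tchange_lift (l : R -> R) : {homo l : u v / u < v} -> (forall v, exists u, l u = v) ->
  tchange (lift_ereal l).
Proof.
move=> hl sl; split.
  by move=> [u| |] [v| |]//=; rewrite ?lte_fin => // uv; rewrite ?ltry ?ltNyr// hl.
move=> [v| |]; [|by exists +oo%E|by exists -oo%E].
by have [u hu] := sl v; exists u%:E; rewrite /= hu.
Qed.

Lemma contract_lip (x y : R) : `|contract x%:E - contract y%:E| <= `|x - y|.
Proof.
rewrite /=.
have x1 : 0 < 1 + `|x| by rewrite ltr_pwDl.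
have y1 : 0 < 1 + `|y| by rewrite ltr_pwDl.
rewrite (_ : x / _ - _ = (x * (1 + `|y|) - y * (1 + `|x|)) / ((1 + `|x|) * (1 + `|y|))); last first.
  by field; rewrite !gt_eqF.
rewrite normrM (gtr0_norm (_ : 0 < _^-1)) ?invr_gt0 ?mulr_gt0// ler_pdivrMr ?mulr_gt0//.
have h : 1 <= (1 + `|x|) * (1 + `|y|) by have := normr_ge0 x; have := normr_ge0 y; nra.
case: (ler0P x) => hx; case: (ler0P y) => hy.
- rewrite (_ : x * (1 - y) - y * (1 - x) = x - y); last by ring.
  by rewrite -[leLHS]mulr1 ler_wpM2l//; nra.
- rewrite !ler0_norm; [nra|nra|nra].
- rewrite !ger0_norm; [nra|nra|nra].
- rewrite (_ : x * (1 + y) - y * (1 + x) = x - y); last by ring.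
  by rewrite -[leLHS]mulr1 ler_wpM2l//; nra.
Qed.

End time_change.

(** * Measurability of Skorokhod-continuous functionals *)

Section measurability_of_functionals.
Context {R : realType} {d0 : measure_display} {T : measurableType d0}.
Variables (P : probability T R) (d : nat) (X : nat -> T -> 'I_d -> R).
Hypothesis mX : forall n c, measurable_fun [set: T] (fun w => X n w c).
Hypothesis cF : cdf_continuous P X.
Variable h : (('I_d -> \bar R) -> R) -> R.
Hypothesis hC : sko_bounded_continuous h.

Local Notation Fb := (Fbar P X).

(** The radius [2 * eta] leaves room for a point within [eta] of [v] that is then moved by at most
    [eta]. *)
Lemma marg_near (s : seq R) (c : 'I_d) (e e' : R) : 0 < e -> 0 < e' ->
  exists2 eta : R, 0 < eta & eta <= e' /\
    forall v, v \in s -> forall u, `|u - v| <= 2 * eta -> `|Fb c u%:E - Fb c v%:E| <= e.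
Proof.
move=> e0 e'0.
have [eta eta0 H] : exists2 eta : R, 0 < eta &
    forall v, v \in s -> forall u, `|u - v| <= 2 * eta -> `|Fb c u%:E - Fb c v%:E| <= e.
  apply: finite_positive => [v a a' ha a'0 aa u hu|v _].
    by apply: ha; rewrite (le_trans hu)// ler_wpM2l.
  have /cvgrPdist_le/(_ e e0) := @marg_continuous R _ _ P d X mX cF c v.
  move=> /nbhs_ballP[r /= r0 hr]; exists (r / 4); first by rewrite divr_gt0.
  move=> u hu; rewrite !FbarE distrC; apply: hr; rewrite /ball/= distrC.
  by rewrite (le_lt_trans hu)//; lra.
exists (Num.min eta e'); first by rewrite lt_min eta0.
split; first by rewrite ge_min lexx orbT.
move=> v vs u hu; apply: (H v vs); rewrite (le_trans hu)// ler_wpM2l// ge_min lexx //.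
Qed.

(** When the time change carries one sample to the other, the indicators agree exactly and only the
    centring [cdf] differs, [n] times. *)
Lemma emp_dist n (z z' : 'I_n * 'I_d -> R) (lam : 'I_d -> \bar R -> \bar R) (e1 : R) t :
  (forall i c, ((z' (i, c))%:E <= lam c (t c))%E = ((z (i, c))%:E <= t c)%E) ->
  (forall c, `|Fb c (lam c (t c)) - Fb c (t c)| <= e1) ->
  `|emp P X z t - emp P X z' (fun c => lam c (t c))| <= Num.sqrt n%:R * (d%:R * e1).
Proof.
move=> hz hF; rewrite /emp -mulrBr -sumrB.
rewrite (eq_bigr (fun=> Defs.cdf P X (fun c => lam c (t c)) - Defs.cdf P X t)); last first.
  move=> i _; rewrite !indicE (_ : (_ \in [set x | leE x (fun c => lam c (t c))]) = ((fun c => z (i, c)) \in [set x | leE x t])); first by ring.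
  by apply/idP/idP; rewrite !inE => H c; have := H c; rewrite hz.
rewrite sumr_const card_ord -[X in _ * X]mulr_natl.
have [->|n0] := posnP n; first by rewrite sqrtr0 invr0 !mul0r normr0.
have n0' : 0 < n%:R :> R by rewrite ltr0n.
have s0 : 0 < Num.sqrt n%:R :> R by rewrite sqrtr_gt0.
rewrite mulrA (_ : (Num.sqrt n%:R)^-1 * n%:R = Num.sqrt n%:R); last first.
  by rewrite -{2}(sqr_sqrtr (ltW n0')) expr2 mulrA mulVf ?mul1r// gt_eqF.
rewrite normrM (gtr0_norm s0) ler_wpM2l ?(ltW s0)//.
rewrite (le_trans (cdf_dist P mX _ _))// (@le_trans _ _ (\sum_(i < d) e1))//.
  by apply: ler_sum => c _; exact: hF.
by rewrite sumr_const card_ord mulr_natl.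
Qed.

(* A time change carries each sample point to its dyadic rounding. *)
Lemma emp_skod n (z : 'I_n * 'I_d -> R) (e : R) : 0 < e ->
  exists k0, forall k, (k0 <= k)%N -> (skod (emp P X z) (emp P X (fun j => dyfl k (z j))) <= e%:E)%E.
Proof.
move=> e0; pose e1 := e / (2 * (Num.sqrt n%:R * d%:R) + 1).
have D0 : 0 < 2 * (Num.sqrt n%:R * d%:R) + 1 :> R.
  by rewrite ltr_wpDl// !mulr_ge0// sqrtr_ge0.
have e10 : 0 < e1 by rewrite divr_gt0.
pose s c := [seq z (i, c) | i <- enum 'I_n].
have zs i c : z (i, c) \in s c by apply: map_f; rewrite mem_enum.
have H1 c : exists eta : R, [/\ 0 < eta, eta <= e &
    forall v, v \in s c -> forall u, `|u - v| <= 2 * eta -> `|Fb c u%:E - Fb c v%:E| <= e1].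
  by have [eta h1 [h2 h3]] := @marg_near (s c) c e1 e e10 e0; exists eta.
have [eta Heta] := choice H1.
have [del del0 Hdel] : exists2 del : R, 0 < del & forall c, c \in enum 'I_d ->
  forall w : R -> R, (forall v, v \in s c -> `|w v - v| <= del) -> exists l : R -> R,
    [/\ {homo l : u v / u < v}, (forall v, exists u, l u = v),
        (forall v, v \in s c -> l v = w v), (forall u, `|l u - u| <= eta c) &
        forall u, l u != u -> exists2 v, v \in s c & `|u - v| <= eta c].
  apply: finite_positive => [c a a' ha a'0 aa w hw|c _].
    by apply: ha => v /hw h1; exact: le_trans h1 aa.
  by apply: small_time_change; case: (Heta c).
have [k0 Hk0] := inv2X_small del0; exists k0 => k kk.
have H2 c : exists l : R -> R,
    [/\ {homo l : u v / u < v}, (forall v, exists u, l u = v),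
        (forall v, v \in s c -> l v = dyfl k v), (forall u, `|l u - u| <= eta c) &
        forall u, l u != u -> exists2 v, v \in s c & `|u - v| <= eta c].
  apply: (Hdel c); first by rewrite mem_enum.
  by move=> v _; rewrite (le_trans (dyfl_dist k v))// Hk0.
have [l Hl] := choice H2.
have tl c : tchange (lift_ereal (l c)) by apply: tchange_lift; case: (Hl c).
apply: (skod_le tl).
  move=> c [x| |] /=; rewrite ?subrr ?normr0 ?(ltW e0)//.
  rewrite (le_trans (contract_lip _ _))//.
  by case: (Hl c) => _ _ _ h1 _; rewrite (le_trans (h1 x))//; case: (Heta c).
move=> t.
have h1 i c : ((dyfl k (z (i, c)))%:E <= lift_ereal (l c) (t c))%E = ((z (i, c))%:E <= t c)%E.
  have -> : (dyfl k (z (i, c)))%:E = lift_ereal (l c) (z (i, c))%:E.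
    by rewrite /=; case: (Hl c) => _ _ -> //.
  by have /le_mono -> := (tl c).1.
(* Only points near a sample coordinate [v] are moved; before and after, they are within [2 * eta c]
   of [v], so the two values of [Fb c] are each within [e1] of the one at [v]. *)
have h2 c : `|Fb c (lift_ereal (l c) (t c)) - Fb c (t c)| <= 2 * e1.
  have z2 : 0 <= 2 * e1 by rewrite mulr_ge0// ltW.
  case: (t c) => [x| |] /=; rewrite ?subrr ?normr0//.
  have [_ _ _ h3 h4] := Hl c; have [et0 _ h5] := Heta c.
  have [->|ne] := eqVneq (l c x) x; first by rewrite subrr normr0.
  have [v vs xv] := h4 x ne.
  have h6 : `|x - v| <= 2 * eta c by rewrite (le_trans xv)//; lra.
  have h7 : `|l c x - v| <= 2 * eta c.
    rewrite (_ : l c x - v = (l c x - x) + (x - v)); last by ring.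
    by rewrite (le_trans (ler_normD _ _))// mulr_natl mulr2n lerD.
  have := h5 v vs _ h6; have := h5 v vs _ h7; rewrite !ler_norml; lra.
rewrite (le_trans (@emp_dist n z (fun j => dyfl k (z j)) (fun c => lift_ereal (l c)) _ t h1 h2))//.
rewrite (_ : Num.sqrt n%:R * (d%:R * (2 * e1)) = (2 * (Num.sqrt n%:R * d%:R)) * e1); last by ring.
rewrite /e1 mulrCA ler_piMr ?(ltW e0)// ler_pdivrMr// mul1r lerDl//.
Qed.

(** Rounding moves the jumps, so it changes the empirical process little for the Skorokhod distance
    though not uniformly; continuity of [h] gives the convergence wanted by [measurable_dyfl]. *)
Lemma measurable_functional_Uemp n : measurable_fun [set: T] (fun w => h (Uemp P X n w)).
Proof.
under eq_fun do rewrite Uemp_emp.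
apply: (@measurable_dyfl R _ _ ('I_n * 'I_d)%type (fun ic w => X ic.1.+1 w ic.2) (fun z => h (emp P X z))).
  by move=> ic; exact: mX.
move=> w; apply/cvgnP => e e0.
set z := (fun ic : 'I_n * 'I_d => X ic.1.+1 w ic.2).
have [_ hc] := hC; have [del del0 hdel] := hc _ (cadlag_emp mX cF z) e e0.
have [k0 Hk0] := emp_skod z (divr_gt0 del0 (ltr0Sn R 1)).
exists k0 => k kk; rewrite distrC ltW//; apply: hdel; first exact: cadlag_emp.
by rewrite (le_lt_trans (Hk0 k kk))// lte_fin; lra.
Qed.

Lemma brv_functional_Uemp n : brv (fun w => h (Uemp P X n w)).
Proof.
split; first exact: measurable_functional_Uemp.
have [[M hM] _] := hC; exists M => w; apply: hM; rewrite Uemp_emp; exact: cadlag_emp.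
Qed.

End measurability_of_functionals.

(** * Weak convergence *)

Section weak_limit.
Context {R : realType} {d0 : measure_display} {T : measurableType d0}.
Variables (P : probability T R) (d : nat) (X : nat -> T -> 'I_d -> R).
Hypothesis mX : forall n c, measurable_fun [set: T] (fun w => X n w c).
Hypothesis cF : cdf_continuous P X.
Context {d1 : measure_display} {S : measurableType d1}.
Variables (Q : probability S R) (Y : nat -> T -> nat -> R) (U : S -> nat -> R).
Variable Z : ('I_d -> \bar R) -> S -> R.
Hypothesis mY : forall n j, measurable_fun [set: T] (fun w => Y n w j).
Hypothesis mU : forall j, measurable_fun [set: S] (fun x => U x j).
Hypothesis cZ : forall x, cont_path (fun t => Z t x).
Hypothesis Uemp_Y : forall e : R, 0 < e -> exists k1, forall k, (k1 <= k)%N ->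
  exists N, forall n, (N <= n)%N -> exists B : set T, [/\ measurable B, pr P B <= e &
    forall w, ~ B w -> forall t, `|Uemp P X n w t - step_path P X (Y n w) k t| <= e].
Hypothesis Y_U : forall m K (g : (nat -> R) -> R) (M : R), lipn m K g -> (forall v, `|g v| <= M) ->
  (fun n => Ex P (fun w => g (Y n w))) @ \oo --> Ex Q (fun x => g (U x)).
Hypothesis U_Z : forall x (e : R), 0 < e -> exists N, forall k, (N <= k)%N ->
  forall t, `|step_path P X (U x) k t - Z t x| <= e.

Implicit Type h : (('I_d -> \bar R) -> R) -> R.

Lemma lipn_infconv h (M : R) m k : (forall x, cadlag x -> `|h x| <= M) ->
  lipn (\sum_(g : grid d k) (code k (gval g)).+1) m%:R
    (fun u => infconv h m%:R (fun t => step_path P X u k t)).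
Proof.
move=> hM; split => // u v; set N := (\sum_(g : grid d k) _)%N.
have H (u' v' : nat -> R) : infconv h m%:R (fun t => step_path P X u' k t) <=
    infconv h m%:R (fun t => step_path P X v' k t) + m%:R * \sum_(j < N) `|u' j - v' j|.
  apply: (infconv_lip hM) => //; try exact: cadlag_step_path.
    by rewrite sumr_ge0.
  move=> t; have [g hg] : exists g : grid d k, gval g = level_index P X k t.
    by apply: gval_ex => i; rewrite (leq_trans (level_index_le P mX _ _ _))// leq_addr.
  have hN : (code k (level_index P X k t) < N)%N by rewrite -hg /N (bigD1 g)//= addSn ltnS leq_addr.
  by rewrite /step_path (bigD1 (Ordinal hN))//= lerDl sumr_ge0.
rewrite ler_norml lerBlDl [X in _ && X]H ?andbT//.
rewrite lerNl opprB lerBlDl; under eq_bigr do rewrite distrC; exact: H.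
Qed.

Section functional.
Variable h : (('I_d -> \bar R) -> R) -> R.
Hypothesis hC : sko_bounded_continuous h.

Let cadlagZ' x : cadlag (fun t => Z t x). Proof. exact: cont_path_cadlag. Qed.

Lemma infconv_Z m : brv (fun x => infconv h m%:R (fun t => Z t x)) /\
  (fun k => Ex Q (fun x => infconv h m%:R (fun t => step_path P X (U x) k t))) @ \oo -->
    Ex Q (fun x => infconv h m%:R (fun t => Z t x)).
Proof.
have [[M hM] _] := hC.
apply: (@Ex_dct R _ _ Q (fun k x => infconv h m%:R (fun t => step_path P X (U x) k t)) _ M).
- by move=> k; apply: (lipn_meas (lipn_infconv m k hM)) => j _; exact: mU.
- by move=> k x; apply: (infconv_norm hM) => //; exact: cadlag_step_path.
move=> x; apply/cvgnP => e e0.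
have m0 : 0 < m%:R + 1 :> R by rewrite ltr_wpDl.
have [N HN] := U_Z x (divr_gt0 e0 m0); exists N => k Nk.
have ed : 0 <= e / (m%:R + 1) by rewrite divr_ge0// ltW.
have h1 := infconv_lip hM (ler0n R m) (cadlag_step_path mX cF (U x) k) (cadlagZ' x) ed (HN k Nk).
have h2 := infconv_lip hM (ler0n R m) (cadlagZ' x) (cadlag_step_path mX cF (U x) k) ed
  (fun t => ltac:(by rewrite distrC; exact: HN)).
have h3 : m%:R * (e / (m%:R + 1)) <= e.
  by rewrite mulrCA ler_piMr ?(ltW e0)// ler_pdivrMr// mul1r lerDl.
by rewrite ler_norml; lra.
Qed.

Lemma functional_Z : brv (fun x => h (fun t => Z t x)) /\
  (fun m => Ex Q (fun x => infconv h m%:R (fun t => Z t x))) @ \oo --> Ex Q (fun x => h (fun t => Z t x)).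
Proof.
have [[M hM] _] := hC.
apply: (@Ex_dct R _ _ Q (fun m x => infconv h m%:R (fun t => Z t x)) _ M).
- by move=> m; exact: brv_meas (infconv_Z m).1.
- by move=> m x; apply: (infconv_norm hM).
by move=> x; apply: (infconv_cvg hC).
Qed.

Lemma liminf_functional (e : R) : 0 < e -> exists N, forall n, (N <= n)%N ->
  Ex Q (fun x => h (fun t => Z t x)) - e <= Ex P (fun w => h (Uemp P X n w)).
Proof.
move=> e0; have [[M hM] _] := hC.
have M0 : 0 <= M := le_trans (normr_ge0 _) (hM _ (cadlag_cst 0)).
have e4 : 0 < e / 4 by rewrite divr_gt0.
have /cvgnP/(_ _ e4)[m Hm] := functional_Z.2.
have {}Hm := Hm m (leqnn m).
have D0 : 0 < m%:R + 2 * M + 1 by rewrite ltr_wpDl// addr_ge0// mulr_ge0.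
(* The last quarter of [e]: [m * e'] for the uniform distance off the exceptional event,
   [2 * M * e'] for that event. The other quarters go to [m], [k] and [n]. *)
pose e' := e / 4 / (m%:R + 2 * M + 1).
have e'0 : 0 < e' by rewrite divr_gt0.
have [k1 Hk1] := Uemp_Y e'0.
have /cvgnP/(_ _ e4)[k2 Hk2] := (infconv_Z m).2.
pose k := maxn k1 k2; have {}Hk2 := Hk2 k (leq_maxr _ _).
have [N1 HN1] := Hk1 k (leq_maxl _ _).
have lg := lipn_infconv m k hM.
set g := (fun u => infconv _ _ _) in lg.
have gM u : `|g u| <= M by apply: (infconv_norm hM) => //; exact: cadlag_step_path.
have /cvgnP/(_ _ e4)[N2 HN2] := Y_U lg gM.
exists (maxn N1 N2) => n; rewrite geq_max => /andP[n1 n2].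
have [B [mB prB HB]] := HN1 n n1.
have {}HN2 := HN2 n n2.
have bU := brv_functional_Uemp mX cF hC n.
have bg : brv (fun w => g (Y n w)) by apply: (brv_lipn lg gM) => j _; exact: mY.
have bi : brv (fun w => \1_B w : R) := @brv_indic R _ _ _ mB.
have key : Ex P (fun w => g (Y n w)) - (m%:R * e' + 2 * M * e') <= Ex P (fun w => h (Uemp P X n w)).
  rewrite (@le_trans _ _ (Ex P (fun w => g (Y n w) - (m%:R * e' + 2 * M * \1_B w))))//.
    rewrite ExB//; last by apply: brvD; [exact: brv_cst|exact: brvZ].
    rewrite ExD//; [|exact: brv_cst|exact: brvZ].
    rewrite Ex_cst ExZ// Ex_indic// lerD2l lerN2 lerD2l ler_wpM2l// mulr_ge0//.
  apply: (Ex_le P (brvB bg (brvD (brv_cst _) (brvZ _ bi))) bU) => w.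
  have cU : cadlag (Uemp P X n w) by rewrite Uemp_emp; exact: cadlag_emp.
  have me : 0 <= m%:R * e' by rewrite mulr_ge0// ltW.
  have [Bw|Bw] := pselect (B w).
    rewrite indicE mem_set//= mulr1; have := gM (Y n w); have := hM _ cU.
    rewrite !ler_norml; lra.
  rewrite indicE memNset//= mulr0 addr0 lerBlDr.
  rewrite (le_trans (infconv_lip hM (ler0n R m) (cadlag_step_path mX cF (Y n w) k) cU (ltW e'0) _))//.
    by move=> t; rewrite distrC; exact: HB.
  by rewrite lerD2r (infconv_le hM).
have he' : m%:R * e' + 2 * M * e' <= e / 4.
  rewrite -mulrDl /e' mulrCA ler_piMr ?(ltW e4)// ler_pdivrMr// mul1r lerDl//.
move: Hm Hk2 HN2; rewrite -/(g _) !ler_norml; lra.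
Qed.

End functional.

Lemma sko_bounded_continuousN h : sko_bounded_continuous h -> sko_bounded_continuous (fun x => - h x).
Proof.
move=> [[M hM] hc]; split; first by exists M => x /hM; rewrite normrN.
move=> x cx e e0; have [del del0 hd] := hc x cx e e0; exists del => // y cy xy.
by rewrite -opprD normrN; exact: hd.
Qed.

Lemma cvg_functional h : sko_bounded_continuous h ->
  (fun n => Ex P (fun w => h (Uemp P X n w))) @ \oo --> Ex Q (fun x => h (fun t => Z t x)).
Proof.
move=> hC; have hN := sko_bounded_continuousN hC.
apply/cvgnP => e e0; have [N1 H1] := liminf_functional hC e0.
have [N2 H2] := liminf_functional hN e0.
exists (maxn N1 N2) => n; rewrite geq_max => /andP[n1 n2].
have := H1 n n1; have := H2 n n2.
rewrite (ExN P (brv_functional_Uemp mX cF hC n)) (ExN Q (functional_Z hC).1) ler_norml; lra.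
Qed.

End weak_limit.

Theorem theorem1 (R : realType) (d0 : measure_display) (T : measurableType d0)
  (P : probability T R) (d : nat) (X : nat -> T -> 'I_d -> R)
  (G : set (('I_d -> R) -> R)) (nG : (('I_d -> R) -> R) -> R) (Psi : R -> R) :
  (0 < d)%N ->
  (forall (n : nat) (c : 'I_d), measurable_fun setT (fun w => X n w c)) ->
  stationary P X ->
  cdf_continuous P X ->
  seminormed_space G nG ->
  clt_cond P X G ->
  control_fun G nG (marg P X) Psi ->
  moment_cond P X G nG Psi ->
  empirical_clt P X.
Proof.
move=> d_gt0 mX _ cF GS GL GC GM.
have PsiN : nondecr_nonneg Psi by case: GC.
have [b [C [p [k0 [b01 C0 p0 dev]]]]] := deviation d_gt0 mX GS PsiN GM.
(* Off the grid the zero function is taken, so that the seminorm bound holds at every code;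
   [coded_nG] relies on it. *)
have ex kj : exists f, level_fun P X G nG Psi kj.1 kj.2 f /\ nG f <= Psi (2 ^+ kj.1).
  case: kj => k j /=.
  have [jk|jk] := pselect (forall i, (j i <= 2 ^ k + 1)%N).
    by have [f fP] := level_fun_ex d_gt0 mX cF GS GC k j; exists f; split => //; case: fP => _ _ /(_ jk)[].
  exists (fun=> 0); split; first by split => // [|x]; [exact: (G_cst GS)|rewrite lexx ler01].
  have := nG_lin GS 0 0 (G_cst GS 0) (G_cst GS 0); rewrite normr0 !mul0r addr0 => /le_trans; apply.
  by case: PsiN => _; apply; rewrite exprn_ge0.
have [psi' Hpsi] := choice ex; pose psi k j := psi' (k, j).
have psiP k j : level_fun P X G nG Psi k j (psi k j) by case: (Hpsi (k, j)).
have psiG k j : nG (psi k j) <= Psi (2 ^+ k) by case: (Hpsi (k, j)).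
have /andP[b0 b1] := b01.
pose rho := b ^+ (2 * p).
have rho01 : 0 <= rho < 1.
  by rewrite exprn_ge0 ?(ltW b0)//= exprn_ilt1 ?(ltW b0)// muln_eq0/= -lt0n p0.
(* [k1 >= 1] because links at level [k] refer to level [k - 1]. *)
pose Q := @U01 R; pose W0 := limit_field P X psi; pose k1 := maxn k0 1.
have mW0 := measurable_limit_field mX GS GL PsiN GM psiP psiG.
have c0 : 0 <= 18 ^+ d * C by rewrite mulr_ge0.
have bad0 k : (k1 <= k)%N -> pr Q (bad d W0 k (2 * b ^+ k)) <= 18 ^+ d * C * rho ^+ k.
  rewrite geq_max => /andP[kk k_gt0].
  exact: (pr_bad_limit_field d_gt0 mX cF GS GL PsiN GM psiP psiG b01 C0 p0 dev k_gt0 kk).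
have gauss0 := gaussian_limit_field mX GS GL PsiN GM psiP psiG.
have cZ := limit_path_continuous mX cF W0 k1 b01.
pose W1 := regularized d W0 b k1.
have mW1 := measurable_regularized d b k1 mW0.
have Y_U m K (g : (nat -> R) -> R) (M : R) : lipn m K g -> (forall v, `|g v| <= M) ->
    (fun n => Ex P (fun w => g (coded_sum P X psi n w))) @ \oo --> Ex Q (fun x => g (W1 x)).
  move=> lg gM; rewrite (_ : Ex Q _ = Ex Q (fun x => g (W0 x))).
    exact: (limit_field_cvg mX GS GL PsiN GM psiP psiG lg gM).
  apply: (Ex_regular mW0 c0 rho01 bad0 (M := M)) => [| |x|x|x rx] //.
  - by apply: (brv_lipn lg gM) => j _; exact: mW1.
  - by apply: (brv_lipn lg gM) => j _; exact: mW0.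
  - by rewrite /W1 regularizedE.
have U_Z x (e : R) : 0 < e -> exists N, forall k, (N <= k)%N ->
    forall t, `|step_path P X (W1 x) k t - limit_path P X W0 b k1 t x| <= e.
  move=> e0; have [M HM] := limit_path_dist P mX W0 k1 b01 x.
  have [||N HN] := @expr_small R (2 * (b / (1 - b))) b e _ _ e0; first by rewrite ltW.
    by rewrite mulr_ge0// divr_ge0 ?subr_ge0 ?ltW.
  exists (maxn M N) => k; rewrite geq_max => /andP[Mk Nk] t.
  exact: le_trans (HM k Mk t) (HN k Nk).
have mV n j := measurable_coded_sum mX GS psiP n j.
have near0 := @Uemp_step_path R _ _ P d X d_gt0 mX cF G nG GS Psi PsiN psi psiP b C p k0 b01 C0 p0 dev.
exists _, (measurableTypeR R), Q, (limit_path P X W0 b k1); split.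
- exact: (limit_path_gaussian P mX mW0 b01 c0 rho01 bad0 gauss0).
- exact: cZ.
move=> h hC.
have bZ := (functional_Z mX cF Q mW1 cZ U_Z hC).1.
split; first exact: measurable_functional_Uemp.
split; first exact: brv_meas bZ.
rewrite -(EFin_Ex Q bZ).
under eq_fun do rewrite -(EFin_Ex P (brv_functional_Uemp mX cF hC _)).
apply: cvg_EFin; first exact: nearW.
exact: (cvg_functional mX cF mV mW1 cZ near0 Y_U U_Z hC).
Qed.
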